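(* For each integer $d\ge 2$, every isotropic 2-attractor in $\mathbb{R}^d$ is homeomorphic to the closed $d$-dimensional ball.
   Context: An integer $d\times d$ matrix $M$ is called expanding if all its (complex) eigenvalues have modulus strictly greater than $1$. Let $M$ be an integer expanding $d\times d$ matrix with $|\det M|=2$ and let $D=\{\boldsymbol d_0,\boldsymbol d_1\}\subset\mathbb{Z}^d$ with $\boldsymbol d_1-\boldsymbol d_0\notin M\mathbb{Z}^d$. The 2-attractor generated by $M$ and $D$ is the compact set $G(M,D)=\{\sum_{k=1}^{\infty}M^{-k}\boldsymbol a_k : \boldsymbol a_k\in D \text{ for all } k\}\subset\mathbb{R}^d$. A matrix is isotropic if it is diagonalizable over $\mathbb{C}$ and all its eigenvalues have the same modulus. A 2-attractor is isotropic if it is generated by an isotropic matrix $M$. *)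

(* Defs.v *)
From HB Require Import structures.
From mathcomp Require Import all_boot all_order all_algebra.
From mathcomp Require Import complex.
From mathcomp Require Import all_classical all_reals all_analysis.
Import Order.TTheory GRing.Theory Num.Theory.
Import numFieldNormedType.Exports.

Set Implicit Arguments.
Unset Strict Implicit.
Unset Printing Implicit Defensive.

Local Open Scope classical_set_scope.
Local Open Scope ring_scope.

(* In [R[i]] the norm [`|a|] is the modulus, embedded in [R[i]].              *)
Definition expanding (R : realType) (d : nat) (A : 'M[R[i]]_d) : Prop :=
  forall a : R[i], eigenvalue A a -> 1 < `|a|.

Definition isotropic (R : realType) (d : nat) (A : 'M[R[i]]_d) : Prop :=
  diagonalizable A /\
  forall a b : R[i], eigenvalue A a -> eigenvalue A b -> `|a| = `|b|.

(* [series u n] sums the terms of index [0 <= k < n], hence the shift of the  *)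
(* exponent: digit [a k] is the usual (k+1)-st one.                           *)
Definition attractor (R : realType) (d : nat) (M : 'M[int]_d)
    (D : set 'cV[int]_d) : set 'cV[R]_d :=
  [set x | exists a : nat -> 'cV[int]_d, (forall k, D (a k)) /\
     series (fun k => invmx (map_mx intr M : 'M[R]_d) ^+ k.+1
                        *m map_mx intr (a k)) @ \oo --> x].

Definition isotropic_2attractor (R : realType) (d : nat) (G : set 'cV[R]_d) :
    Prop :=
  exists (M : 'M[int]_d) (d0 d1 : 'cV[int]_d),
    [/\ expanding (map_mx intr M : 'M[R[i]]_d),
        `|\det M| = 2,
        ~ (exists z : 'cV[int]_d, d1 - d0 = M *m z),
        isotropic (map_mx intr M : 'M[R[i]]_d)
      & G = attractor M [set d0; d1]].

(* The library norm on ['cV[R]_d] is the sup norm, so the Euclidean ball is   *)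
(* written out.                                                               *)
Definition euclidean_closed_ball (R : realType) (d : nat) : set 'cV[R]_d :=
  [set x | \sum_(i < d) x i ord0 ^+ 2 <= 1].

(* Subspace topologies on [A] and [B]; the maps are total, so the spaces are  *)
(* taken pointed to avoid losing the case where [A] and [B] are empty.        *)
Definition homeomorphic (T U : ptopologicalType) (A : set T) (B : set U) :
    Prop :=
  exists (f : T -> U) (g : U -> T),
    [/\ {within A, continuous f} /\ {within B, continuous g},
        forall x, A x -> B (f x),
        forall y, B y -> A (g y),
        forall x, A x -> g (f x) = x
      & forall y, B y -> f (g y) = y].

(* Main.v *)
(* The attractor is the image of the Cantor space of digit sequences under
   [expansion], and [M] being expanding, two sequences have the same image iff
   the integer vectors accumulated from the differences of their digits stay
   bounded. So it suffices to find a convex body carrying an address map with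
   the same kernel: both are then the same quotient of the Cantor space, and a
   radial map takes the body to the Euclidean ball.

   If [M] is isotropic, all coefficients of its characteristic polynomial vanish
   except the two extreme ones and possibly the middle one, so that either
   [M^d = +-2] or [M^(2m) = - b M^m - 2] with [d = 2m] and [|b|] in [{1, 2}]. As this
   polynomial is irreducible, [d1 - d0] is a cyclic vector, and boundedness can
   be tested separately on each class of digits modulo [d] (resp. [m]), where it
   becomes boundedness for the multiplication by [+-2] on [Z] (resp. by a root
   of [y^2 + b y + 2] on [Z[y]]). The first is the kernel of binary expansions of
   the points of an interval. For the second, the (tame) twindragon is replaced
   by a hexagon [P], with a piecewise affine contraction [F] such that
   [F x] and [- F (- x)] cover [P] and are glued along the lattice exactly as the
   two similarities of the tile are; only the gluing matters for the kernel. The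
   convex bodies are thus the cube and the product of [m] hexagons. *)

From HB Require Import structures.
Require Import Defs.
From mathcomp Require Import all_boot all_order all_algebra.
From mathcomp Require Import complex.
From mathcomp Require Import all_classical all_reals all_analysis.
From mathcomp Require Import lra ring zify.
Import Order.TTheory GRing.Theory Num.Theory.
Import numFieldNormedType.Exports.

Set Implicit Arguments.
Unset Strict Implicit.
Unset Printing Implicit Defensive.

Local Open Scope classical_set_scope.
Local Open Scope ring_scope.

(** * Planar iterated function systems glued along an integer lattice *)

(** The genuine tiles have fractal boundary, and the substitutes are not linear; what replaces
    linearity is the gluing. It makes the inverse branches fit together into a single map on the
    union of the lattice translates of [P]. The n-th iterate of this map brings points of translates
    that are a bounded number of steps apart to within a multiple of [K ^+ n], so bounded digit
    differences force equal addresses. Conversely, equal addresses have tails that differ exactly by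
    the accumulated lattice vector, which the diameter of [P] bounds. The price is that [F] is no
    similarity: some affine pieces lengthen Euclidean distances, and contraction holds only for a
    quadratic form adapted to each hexagon, with the weak ratio 97/100. On the matrix side,
    eigenvalues of one modulus make the characteristic polynomial self-reciprocal up to scaling, and
    diagonalizability keeps polynomial factors out of the growth of the powers, so that bounded
    integer vectors correspond exactly to equal expansions. Irreducibility rests on 2 being prime: a
    nonconstant factor of an expanding polynomial has constant coefficient of absolute value at
    least 2. *)

Definition shift (T : Type) (n : nat) (a : nat -> T) : nat -> T := fun k => a (n + k)%N.

Lemma shift1_shift (T : Type) (n : nat) (a : nat -> T) :
  shift 1 (shift n a) = shift n.+1 a.
Proof. by apply/funext => k; rewrite /shift add1n addSnnS. Qed.

(** Uniform continuity for the cylinder metric, stated on bare sequences so that the models can be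
    built without the topology of the Cantor space; [cylinder_continuousT] makes the link. *)
Definition cylinder_continuous (R : realType) (f : (nat -> bool) -> R) : Prop :=
  forall e, 0 < e -> exists n, forall a b : nat -> bool,
    (forall k, (k < n)%N -> a k = b k) -> `|f a - f b| < e.

Lemma expr_lt_eps (R : realType) (K c e : R) : 0 <= K -> K < 1 -> 0 < e ->
  exists n, c * K ^+ n < e.
Proof.
move=> K0 K1 e0.
have h : (fun n => c * K ^+ n) @ \oo --> (0 : R).
  rewrite -(mulr0 c); apply: cvgM; first exact: cvg_cst.
  by apply: cvg_expr; rewrite ger0_norm.
have /cvgrPdist_lt /(_ _ e0) [n _ /(_ n (leqnn n))] := h.
rewrite /= sub0r normrN => hn; exists n; apply: le_lt_trans hn; exact: ler_norm.
Qed.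

Lemma geometric_cvg (R : realType) (u : nat -> R) (c K : R) : 0 <= K -> K < 1 ->
  (forall n k, `|u n - u (n + k)%N| <= c * K ^+ n) ->
  forall n, `|u n - lim (u @ \oo)| <= c * K ^+ n.
Proof.
move=> K0 K1 hu.
have cu : cvg (u @ \oo).
  apply/cauchy_cvgP/cauchy_ballP => e e0.
  have e20 : 0 < e / 2 by lra.
  have [N hN] := expr_lt_eps c K0 K1 e20.
  exists ([set u k | k in [set k | (N <= k)%N]], [set u k | k in [set k | (N <= k)%N]]) => /=.
    by split; exists N => // k /= hk; exists k.
  move=> [x y] /= [[i hi <-] [j hj <-]].
  rewrite -ball_normE /=.
  have -> : u i - u j = (u N - u (N + (j - N))%N) - (u N - u (N + (i - N))%N).
    by rewrite !subnKC //; ring.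
  apply: (le_lt_trans (ler_normB _ _)).
  have := hu N (j - N)%N; have := hu N (i - N)%N; lra.
move=> n.
have h : (fun k => `|u n - u (n + k)%N|) @ \oo --> `|u n - lim (u @ \oo)|.
  apply: cvg_norm; apply: cvgB; first exact: cvg_cst.
  have := cu; rewrite -(cvg_shiftn n) => h.
  by under eq_fun do rewrite addnC.
rewrite -(cvg_lim _ h) //; apply: limr_le; first by apply/cvg_ex; eexists; exact: h.
by near=> k; exact: hu.
Unshelve. all: by end_near.
Qed.

(* The maps [F i] behave like the inverse branches [y |-> (y + i v) / A] modulo the
   lattice [iota L]; [size] is the length of a path from [0] through translates
   of [P] that meet their predecessor. *)
Section Model.
Variables (R : realType) (L : zmodType) (A : {additive L -> L}) (v : L).
Variables (iota : {additive L -> (R * R)%type}) (size : L -> nat).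
Variables (N : R * R -> R) (c1 c2 Delta K : R).
Variables (P : set (R * R)) (F : bool -> R * R -> R * R) (p0 : R * R).
Hypothesis N_triangle : forall x y z, N (x - z) <= N (x - y) + N (y - z).
Hypothesis N_coord : forall x, `|x.1| <= c1 * N x /\ `|x.2| <= c1 * N x.
Hypothesis N_le : forall x, N x <= c2 * (`|x.1| + `|x.2|).
Hypothesis c1_ge0 : 0 <= c1.
Hypothesis c2_ge0 : 0 <= c2.
Hypothesis K_ge0 : 0 <= K.
Hypothesis K_lt1 : K < 1.
Hypothesis P_closed : closed P.
Hypothesis P_p0 : P p0.
Hypothesis P_diam : forall x y, P x -> P y -> N (x - y) <= Delta.
Hypothesis F_P : forall i x, P x -> P (F i x).
Hypothesis F_lip : forall i x y, P x -> P y -> N (F i x - F i y) <= K * N (x - y).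
Hypothesis F_cover : forall y, P y -> exists i x, P x /\ F i x = y.
(** For true inverse branches [x |-> (x + iota (v *+ i)) / A] the two equations differ by a division
    by [A]; only their equivalence is retained. *)
Hypothesis F_glue : forall (i j : bool) x x' m, P x -> P x' ->
  (x + iota (v *+ i) = x' + iota (v *+ j + A m) <-> F i x = F j x' + iota m).
Hypothesis residues : forall n, exists (i : bool) m, n = v *+ i + A m.
Hypothesis size0 : forall n, size n = 0%N -> n = 0.
Hypothesis size_step : forall n k, size n = k.+1 -> exists e,
  (size (n - e) <= k)%N /\ exists x y, [/\ P x, P y & x = y + iota e].
Hypothesis size_bounded : forall C : R, exists k, forall n,
  `|(iota n).1| <= C -> `|(iota n).2| <= C -> (size n <= k)%N.

Lemma Delta_ge0 : 0 <= Delta.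
Proof.
have N0 : 0 <= N 0 by have := N_triangle 0 0 0; rewrite !subr0; lra.
by apply: le_trans N0 _; rewrite -(subrr p0); exact: P_diam.
Qed.

Fixpoint approx (n : nat) (a : nat -> bool) : R * R :=
  if n is n'.+1 then F (a 0%N) (approx n' (shift 1 a)) else p0.

Lemma approx_P n a : P (approx n a).
Proof. by elim: n a => [|n IH] a //=; apply: F_P. Qed.

Lemma approx_eq n a b : (forall k, (k < n)%N -> a k = b k) -> approx n a = approx n b.
Proof.
elim: n a b => [|n IH] a b h //=; rewrite h //; congr (F _ _).
by apply: IH => k hk; apply: h.
Qed.

Lemma approx_shift n m a : approx n.+1 (shift m a) = F (a m) (approx n (shift m.+1 a)).
Proof.
by rewrite /= shift1_shift {1}/shift addn0.
Qed.

Lemma approx_dist n k a : N (approx n a - approx (n + k) a) <= Delta * K ^+ n.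
Proof.
elim: n a => [|n IH] a; first by rewrite mulr1; apply: P_diam => //; exact: approx_P.
rewrite addSn /=; apply: le_trans (F_lip _ (approx_P _ _) (approx_P _ _)) _.
by rewrite exprS mulrCA; apply: ler_wpM2l.
Qed.

Definition address (a : nat -> bool) : R * R :=
  (lim ((fun n => (approx n a).1) @ \oo), lim ((fun n => (approx n a).2) @ \oo)).

Lemma approx_address n a :
  `|(approx n a).1 - (address a).1| <= c1 * Delta * K ^+ n /\
  `|(approx n a).2 - (address a).2| <= c1 * Delta * K ^+ n.
Proof.
split; [apply: (geometric_cvg (u := fun n => (approx n a).1)) => // m k
       |apply: (geometric_cvg (u := fun n => (approx n a).2)) => // m k];
 have := approx_dist m k a; have [h1 h2] := N_coord (approx m a - approx (m + k) a);
 rewrite -mulrA => h; [apply: le_trans h1 _|apply: le_trans h2 _]; exact: ler_wpM2l.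
Qed.

Lemma eq_eps (x y c : R) : (forall n, `|x - y| <= c * K ^+ n) -> x = y.
Proof.
move=> h; apply/eqP; rewrite -subr_eq0 -normr_le0 leNgt; apply/negP => e0.
have [n hn] := expr_lt_eps c K_ge0 K_lt1 e0.
by have := lt_le_trans hn (h n); rewrite ltxx.
Qed.

Lemma address_cvg a : (fun n => approx n a) @ \oo --> address a.
Proof.
have h (u : nat -> R) (l : R) : (forall n, `|u n - l| <= c1 * Delta * K ^+ n) ->
    u @ \oo --> l.
  move=> hu; apply/cvgrPdist_le => e e0.
  have hK : (fun n => c1 * Delta * K ^+ n) @ \oo --> (0 : R).
    rewrite -(mulr0 (c1 * Delta)); apply: cvgM; first exact: cvg_cst.
    by apply: cvg_expr; rewrite ger0_norm.
  have /cvgrPdist_lt /(_ _ e0) := hK.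
  apply: filterS => n; rewrite sub0r normrN => hn.
  rewrite distrC; apply: le_trans (hu n) _; apply: le_trans (ltW hn); exact: ler_norm.
have E : (fun n => approx n a) = (fun n => ((approx n a).1, (approx n a).2)).
  by apply/funext => n; case: (approx n a).
rewrite E; apply: (@cvg_pair _ _ _ _ (nbhs (address a).1) (nbhs (address a).2)).
  by apply: h => n; case: (approx_address n a).
by apply: h => n; case: (approx_address n a).
Qed.

Lemma address_P a : P (address a).
Proof.
apply: (@closed_cvg _ _ \oo _ (fun n => approx n a) P P_closed _ _ (@address_cvg a)).
by exists 0%N => // n _; exact: approx_P.
Qed.

Lemma N_approx_address n a : N (approx n a - address a) <= c2 * (c1 * Delta * K ^+ n *+ 2).
Proof.
apply: le_trans (N_le _) _; apply: ler_wpM2l => //.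
by have [h1 h2] := approx_address n a; rewrite mulr2n; apply: lerD.
Qed.

(** Two limits of one sequence agree; the rate may carry any constant [c], which is what lets both
    [addressE] and [address_surj] identify an address. *)
Lemma address_eq x a : (exists c, forall n, N (approx n a - x) <= c * K ^+ n) ->
  x = address a.
Proof.
move=> [c hc].
have h n : `|x.1 - (address a).1| <= (c1 * c + c1 * Delta) * K ^+ n /\
           `|x.2 - (address a).2| <= (c1 * c + c1 * Delta) * K ^+ n.
  have [h1 h2] := N_coord (approx n a - x); have [h3 h4] := approx_address n a.
  have hN := ler_wpM2l c1_ge0 (hc n).
  rewrite mulrDl -(mulrA c1 c).
  split.
    rewrite -[x.1 - (address a).1](subrKA (approx n a).1); apply: le_trans (ler_normD _ _) _.
    by apply: lerD => //; rewrite distrC; apply: le_trans h1 _.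
  rewrite -[x.2 - (address a).2](subrKA (approx n a).2); apply: le_trans (ler_normD _ _) _.
  by apply: lerD => //; rewrite distrC; apply: le_trans h2 _.
apply: injective_projections.
  by apply: (@eq_eps _ _ (c1 * c + c1 * Delta)) => n; case: (h n).
by apply: (@eq_eps _ _ (c1 * c + c1 * Delta)) => n; case: (h n).
Qed.

Lemma addressE a : address a = F (a 0%N) (address (shift 1 a)).
Proof.
have D0 := Delta_ge0.
have C0 : 0 <= c2 * (c1 * Delta *+ 2) by rewrite !mulr_ge0 // mulrn_wge0 // mulr_ge0.
apply/esym/address_eq; exists (Delta + c2 * (c1 * Delta *+ 2)) => -[|n].
  rewrite mulr1 /=; apply: (@le_trans _ _ Delta); last by rewrite lerDl.
  by apply: P_diam => //; apply/F_P/address_P.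
rewrite /=; apply: le_trans (F_lip _ (approx_P _ _) (address_P _)) _.
apply: (@le_trans _ _ (K * (c2 * (c1 * Delta * K ^+ n *+ 2)))).
  exact/ler_wpM2l/N_approx_address.
rewrite exprS -mulrnAl mulrCA !mulrA mulrDl mulrDl.
rewrite -[leLHS]add0r; apply: lerD; first by rewrite !mulr_ge0 ?exprn_ge0.
by rewrite le_eqVlt; apply/orP; left; apply/eqP; rewrite !mulr2n; ring.
Qed.

Lemma address_continuous1 : cylinder_continuous (fun a => (address a).1).
Proof.
move=> e e0; have [n hn] := expr_lt_eps (c1 * Delta *+ 2) K_ge0 K_lt1 e0.
exists n => a b hab; apply: le_lt_trans hn.
have [h1 _] := approx_address n a; have [h2 _] := approx_address n b.
rewrite -(approx_eq hab) in h2.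
rewrite -(subrKA (approx n a).1) mulrnAl mulr2n; apply: le_trans (ler_normD _ _) _.
by apply: lerD => //; rewrite distrC.
Qed.

Lemma address_continuous2 : cylinder_continuous (fun a => (address a).2).
Proof.
move=> e e0; have [n hn] := expr_lt_eps (c1 * Delta *+ 2) K_ge0 K_lt1 e0.
exists n => a b hab; apply: le_lt_trans hn.
have [_ h1] := approx_address n a; have [_ h2] := approx_address n b.
rewrite -(approx_eq hab) in h2.
rewrite -(subrKA (approx n a).2) mulrnAl mulr2n; apply: le_trans (ler_normD _ _) _.
by apply: lerD => //; rewrite distrC.
Qed.

(** Choosing a preimage again and again by [F_cover] gives an orbit in [P], whose branch indices are
    the digits. The compositions of branches started at [p0] instead of the orbit point differ by at
    most [Delta * K ^+ n]. *)
Lemma address_surj x : P x -> exists a, address a = x.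
Proof.
move=> Px.
have /choice[f hf] : forall y, exists z : bool * (R * R), P y -> P z.2 /\ F z.1 z.2 = y.
  move=> y; have [Py|nPy] := pselect (P y); last by exists (true, y).
  by have [i [z [Pz E]]] := F_cover Py; exists (i, z).
pose orb n := iter n (fun y => (f y).2) x.
have orbP n : P (orb n) by elim: n => //= n IH; case: (hf _ IH).
exists (fun n => (f (orb n)).1).
apply/esym/address_eq; exists Delta => n.
suff H m : N (approx n (shift m (fun n => (f (orb n)).1)) - orb m) <= Delta * K ^+ n.
  exact: (H 0%N).
elim: n m => [|n IH] m; first by rewrite mulr1; exact: P_diam.
rewrite approx_shift; have [_ E] := hf _ (orbP m).
have -> : forall y, N (y - orb m) = N (y - F (f (orb m)).1 (orb m.+1)).
  by move=> y; rewrite E.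
apply: le_trans (F_lip _ (approx_P _ _) (hf _ (orbP m)).1) _.
by rewrite exprS mulrCA; apply: ler_wpM2l => //; exact: (IH m.+1).
Qed.

(** Horner scheme for [A^n] applied to the difference of the two expansions truncated after [n]
    digits. *)
Fixpoint digit_diff (a b : nat -> bool) (n : nat) : L :=
  if n is n'.+1 then A (digit_diff a b n') + (v *+ a n' - v *+ b n') else 0.

Lemma address_shift n a : address (shift n a) = F (a n) (address (shift n.+1 a)).
Proof.
by rewrite addressE shift1_shift /shift addn0.
Qed.

(** By induction through [F_glue], the addresses of the n-th tails differ exactly by
    [iota (digit_diff a b n)]. Both lie in [P], so its diameter bounds this lattice vector. *)
Lemma address_eq_bounded a b : address a = address b ->
  exists k, forall n, (size (digit_diff a b n) <= k)%N.
Proof.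
move=> eab.
have h n : address (shift n b) = address (shift n a) + iota (digit_diff a b n).
  elim: n => [|n IH]; first by rewrite raddf0 addr0.
  have {}IH : address (shift n a) = address (shift n b) + iota (- digit_diff a b n).
    by rewrite raddfN IH addrK.
  move: IH; rewrite (address_shift n a) (address_shift n b) => /F_glue.
  move=> /(_ (address_P _) (address_P _)) IH /=.
  have -> : address (shift n.+1 b) = address (shift n.+1 a) + iota (v *+ a n) -
      iota (v *+ b n + A (- digit_diff a b n)) by rewrite IH addrK.
  rewrite -addrA -raddfB; congr (_ + iota _).
  by rewrite raddfN opprD opprK addrA [RHS]addrC.
have [k hk] := size_bounded (c1 * Delta).
exists k => n.
have [h1 h2] := N_coord (address (shift n b) - address (shift n a)).
have := ler_wpM2l c1_ge0 (P_diam (address_P (shift n b)) (address_P (shift n a))).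
rewrite h addrAC subrr add0r in h1 h2 * => h3.
by apply: hk; [apply: le_trans h1 _|apply: le_trans h2 _].
Qed.

Lemma residue_choice : exists f : L -> bool * L, forall n, n = v *+ (f n).1 + A (f n).2.
Proof.
have /choice[f hf] : forall n, exists z : bool * L, n = v *+ z.1 + A z.2.
  by move=> n; have [i [m E]] := residues n; exists (i, m).
by exists f.
Qed.

(* [pull n m x] lifts the [n]-fold contraction to the translate [x + iota m] of
   [P]: by [F_glue] it depends only on the point [x + iota m]. *)
Section Pull.
Variable f : L -> bool * L.
Hypothesis fE : forall n, n = v *+ (f n).1 + A (f n).2.

Fixpoint pull (n : nat) (m : L) (x : R * R) : R * R :=
  if n is n'.+1 then pull n' (f m).2 (F (f m).1 x) else x + iota m.

Lemma pull_glue n m m' x x' : P x -> P x' -> x + iota m = x' + iota m' ->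
  pull n m x = pull n m' x'.
Proof.
elim: n m m' x x' => [|n IH] m m' x x' Px Px' //= E.
apply: IH; [exact: F_P|exact: F_P|].
have /F_glue -> // : x + iota (v *+ (f m).1) = x' + iota (v *+ (f m').1 + A ((f m').2 - (f m).2)).
  apply: (addIr (iota (A (f m).2))); rewrite -!addrA -!raddfD -fE E; congr (_ + iota _).
  by rewrite [LHS]fE raddfB -addrA subrK.
by rewrite -addrA -raddfD subrK.
Qed.

Lemma pull_dist n m x y : P x -> P y -> N (pull n m x - pull n m y) <= K ^+ n * Delta.
Proof.
suff h : P x -> P y -> N (pull n m x - pull n m y) <= K ^+ n * N (x - y).
  by move=> Px Py; apply: le_trans (h Px Py) _; apply: ler_wpM2l; rewrite ?exprn_ge0 ?P_diam.
elim: n m x y => [|n IH] m x y Px Py /=.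
  by rewrite opprD addrACA subrr addr0 mul1r.
apply: le_trans (IH _ _ _ (F_P _ Px) (F_P _ Py)) _.
by rewrite exprSr -mulrA; apply: ler_wpM2l; rewrite ?exprn_ge0 ?F_lip.
Qed.

(** A path of [k] steps from [m] to [m'] passes through translates that meet successively; by
    [pull_glue] their images meet too. Each image has diameter at most [K ^+ n * Delta], and [k.+1]
    of them are crossed. *)
Lemma pull_chain k n m m' x y : P x -> P y -> (size (m - m') <= k)%N ->
  N (pull n m x - pull n m' y) <= K ^+ n * Delta * k.+1%:R.
Proof.
have D0 := Delta_ge0; have KD : 0 <= K ^+ n * Delta by rewrite mulr_ge0 ?exprn_ge0.
elim: k m x => [|k IH] m x Px Py.
  rewrite leqn0 => /eqP/size0/eqP; rewrite subr_eq0 => /eqP ->.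
  by rewrite mulr1; exact: pull_dist.
case E : (size (m - m')) => [|j] hj.
  apply: le_trans (IH _ _ Px Py _) _; first by rewrite E.
  by rewrite ler_wpM2l // ler_nat.
have [e [he [z [z' [Pz Pz' zE]]]]] := size_step E.
have G : pull n m z' = pull n (m - e) z.
  by apply: pull_glue => //; rewrite zE raddfB addrACA subrr addr0.
apply: le_trans (N_triangle _ (pull n m z') _) _.
rewrite -natr1 mulrDr mulr1 addrC; apply: lerD; last exact: pull_dist.
rewrite G; apply: IH => //.
by rewrite addrAC; apply: leq_trans he _.
Qed.

Fixpoint digit_sum (a : nat -> bool) (n : nat) : L :=
  if n is n'.+1 then A (digit_sum a n') + v *+ a n' else 0.

Lemma digit_sumB a b n : digit_sum a n - digit_sum b n = digit_diff a b n.
Proof.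
elim: n => [|n IH] /=; first by rewrite subr0.
by rewrite -IH raddfB opprD addrACA.
Qed.

(** The nonlinear form of the identity saying that a number is [A^-n] times its integer part plus
    tail: [pull] plays the role of [A^-n]. *)
Lemma pull_address a n : pull n (digit_sum a n) (address (shift n a)) = address a.
Proof.
elim: n => [|n IH] /=; first by rewrite raddf0 addr0.
set m := _ + _; rewrite -IH; apply: pull_glue; [exact/F_P/address_P|exact: address_P|].
rewrite (address_shift n a).
have /F_glue -> // : address (shift n.+1 a) + iota (v *+ (f m).1) =
    address (shift n.+1 a) + iota (v *+ a n + A (digit_sum a n - (f m).2)).
- congr (_ + iota _); apply: (addIr (A (f m).2)); rewrite -fE /m.
  by rewrite -addrA -raddfD subrK addrC.
- by rewrite -addrA -raddfD subrK.
- exact: address_P.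
- exact: address_P.
Qed.

End Pull.

(** For every [n] the two addresses are n-fold pulls from translates at most [k] steps apart, so
    [pull_chain] bounds their distance by a quantity tending to 0. *)
Lemma bounded_address_eq a b : (exists k, forall n, (size (digit_diff a b n) <= k)%N) ->
  address a = address b.
Proof.
move=> [k hk]; have [f fE] := residue_choice.
have h n : N (address a - address b) <= K ^+ n * Delta * k.+1%:R.
  rewrite -(pull_address fE a n) -(pull_address fE b n).
  by apply: pull_chain => //; rewrite ?digit_sumB //; exact: address_P.
have [h1 h2] := N_coord (address a - address b).
apply: injective_projections; apply: (@eq_eps _ _ (c1 * (Delta * k.+1%:R))) => n.
  by apply: le_trans h1 _; rewrite -mulrA; apply: ler_wpM2l => //; rewrite mulrC mulrA.
by apply: le_trans h2 _; rewrite -mulrA; apply: ler_wpM2l => //; rewrite mulrC mulrA.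
Qed.

Theorem model_address : exists phi : (nat -> bool) -> R * R,
  [/\ cylinder_continuous (fun a => (phi a).1), cylinder_continuous (fun a => (phi a).2),
      forall a, P (phi a), forall x, P x -> exists a, phi a = x &
      forall a b, phi a = phi b <-> exists k, forall n, (size (digit_diff a b n) <= k)%N].
Proof.
exists address; split; [exact: address_continuous1|exact: address_continuous2
  |exact: address_P|exact: address_surj|].
by move=> a b; split; [exact: address_eq_bounded|exact: bounded_address_eq].
Qed.

End Model.

(** * Polygons and piecewise affine maps of the plane *)

Lemma quad_ge0 (R : realType) (a h c x y : R) : 0 < a -> h ^+ 2 <= a * c ->
  0 <= a * x ^+ 2 + 2 * h * x * y + c * y ^+ 2.
Proof.
move=> a0 hac; rewrite -(pmulr_rge0 _ a0).
have -> : a * (a * x ^+ 2 + 2 * h * x * y + c * y ^+ 2) =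
  (a * x + h * y) ^+ 2 + (a * c - h ^+ 2) * y ^+ 2 by ring.
by rewrite addr_ge0 ?sqr_ge0 // mulr_ge0 ?sqr_ge0 // subr_ge0.
Qed.

Section QuadraticNorm.
Variables (R : realType) (a h c : R).
Hypotheses (a_gt0 : 0 < a) (det_gt0 : h ^+ 2 < a * c).

Definition qform (p : R * R) : R := a * p.1 ^+ 2 + 2 * h * p.1 * p.2 + c * p.2 ^+ 2.
Definition qnorm (p : R * R) : R := Num.sqrt (qform p).

Lemma qform_ge0 p : 0 <= qform p.
Proof. exact/quad_ge0/ltW. Qed.

Lemma qnorm_ge0 p : 0 <= qnorm p. Proof. exact: sqrtr_ge0. Qed.

Lemma sqr_qnorm p : qnorm p ^+ 2 = qform p.
Proof. by rewrite sqr_sqrtr ?qform_ge0. Qed.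

Lemma qnormD p q : qnorm (p + q) <= qnorm p + qnorm q.
Proof.
rewrite -(@ler_pXn2r _ 2%N) ?nnegrE ?addr_ge0 ?qnorm_ge0 //.
rewrite sqrrD !sqr_qnorm.
pose s := a * p.1 * q.1 + h * (p.1 * q.2 + p.2 * q.1) + c * p.2 * q.2.
have E : qform (p + q) = qform p + s *+ 2 + qform q.
  by rewrite /qform /s /= mulr2n; ring.
rewrite E lerD2r lerD2l lerMn2r /=.
apply: le_trans (ler_norm s) _.
rewrite -(@ler_pXn2r _ 2%N) ?nnegrE ?mulr_ge0 ?qnorm_ge0 ?normr_ge0 //.
rewrite real_normK ?num_real // exprMn !sqr_qnorm -subr_ge0.
(* Lagrange's identity for the form whose polar form is [s]; it yields the Cauchy-Schwarz
   inequality. *)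
have -> : qform p * qform q - s ^+ 2 = (a * c - h ^+ 2) * (p.1 * q.2 - p.2 * q.1) ^+ 2.
  by rewrite /qform /s; ring.
by rewrite mulr_ge0 ?sqr_ge0 // subr_ge0 ltW.
Qed.

Lemma qnorm_triangle x y z : qnorm (x - z) <= qnorm (x - y) + qnorm (y - z).
Proof. by rewrite -[x - z](subrKA y); exact: qnormD. Qed.

Lemma qnormZ t (p : R * R) : 0 <= t -> qnorm (t * p.1, t * p.2) = t * qnorm p.
Proof.
move=> t0; rewrite /qnorm.
have -> : qform (t * p.1, t * p.2) = t ^+ 2 * qform p by rewrite /qform /=; ring.
by rewrite sqrtrM ?sqr_ge0 // sqrtr_sqr ger0_norm.
Qed.

Lemma norm_le_qnorm : h ^+ 2 <= (a - 1) * c -> h ^+ 2 <= a * (c - 1) -> 1 < a ->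
  forall p, `|p.1| <= 1 * qnorm p /\ `|p.2| <= 1 * qnorm p.
Proof.
move=> h1 h2 a1 p; rewrite mul1r.
have le_sqr x : x ^+ 2 <= qform p -> `|x| <= qnorm p.
  move=> hx; rewrite -(@ler_pXn2r _ 2%N) ?nnegrE ?qnorm_ge0 ?normr_ge0 //.
  by rewrite real_normK ?num_real // sqr_qnorm.
split; apply: le_sqr; rewrite -subr_ge0.
  have -> : qform p - p.1 ^+ 2 = (a - 1) * p.1 ^+ 2 + 2 * h * p.1 * p.2 + c * p.2 ^+ 2.
    by rewrite /qform; ring.
  by apply: quad_ge0 => //; rewrite subr_gt0.
have -> : qform p - p.2 ^+ 2 = a * p.1 ^+ 2 + 2 * h * p.1 * p.2 + (c - 1) * p.2 ^+ 2.
  by rewrite /qform; ring.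
exact: quad_ge0.
Qed.

Lemma qnorm_le_norm (k : R) : 0 <= k -> a <= k ^+ 2 -> `|h| <= k ^+ 2 -> c <= k ^+ 2 ->
  forall p, qnorm p <= k * (`|p.1| + `|p.2|).
Proof.
move=> k0 ha hh hc p.
have n1 := normr_ge0 p.1; have n2 := normr_ge0 p.2.
rewrite -(@ler_pXn2r _ 2%N) ?nnegrE ?mulr_ge0 ?addr_ge0 ?qnorm_ge0 //.
rewrite sqr_qnorm exprMn /qform -(real_normK (num_real p.1)) -(real_normK (num_real p.2)).
have h1 := ler_wpM2r (sqr_ge0 `|p.1|) ha.
have h2 := ler_wpM2r (sqr_ge0 `|p.2|) hc.
have h3 : h * p.1 * p.2 <= k ^+ 2 * `|p.1| * `|p.2|.
  apply: le_trans (ler_norm _) _; rewrite !normrM.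
  by apply: ler_wpM2r => //; apply: ler_wpM2r.
have -> : k ^+ 2 * (`|p.1| + `|p.2|) ^+ 2 =
  k ^+ 2 * `|p.1| ^+ 2 + 2 * (k ^+ 2 * `|p.1| * `|p.2|) + k ^+ 2 * `|p.2| ^+ 2 by ring.
by apply: lerD => //; apply: lerD => //; rewrite -!mulrA (mulrA h) ler_pM2l //;
  rewrite !mulrA in h3 *.
Qed.

(** [B11], [B12], [B22] are the entries of [k^2 Q - L^T Q L], where [Q] is the matrix of the form
    and [L] that of the linear map. Its positivity is tested on minors, that is, on inequalities
    between explicit numbers. *)
Lemma qnorm_contract (k p1 p2 p3 p4 : R) : 0 <= k ->
  let B11 := k ^+ 2 * a - (a * p1 ^+ 2 + 2 * h * p1 * p3 + c * p3 ^+ 2) in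
  let B12 := k ^+ 2 * h - (a * p1 * p2 + h * (p1 * p4 + p2 * p3) + c * p3 * p4) in
  let B22 := k ^+ 2 * c - (a * p2 ^+ 2 + 2 * h * p2 * p4 + c * p4 ^+ 2) in
  0 < B11 -> B12 ^+ 2 <= B11 * B22 ->
  forall x y, qnorm (p1 * x + p2 * y, p3 * x + p4 * y) <= k * qnorm (x, y).
Proof.
move=> k0 B11 B12 B22 hB hdet x y.
rewrite -(@ler_pXn2r _ 2%N) ?nnegrE ?mulr_ge0 ?qnorm_ge0 //.
rewrite exprMn !sqr_qnorm -subr_ge0.
have -> : k ^+ 2 * qform (x, y) - qform (p1 * x + p2 * y, p3 * x + p4 * y) =
   B11 * x ^+ 2 + 2 * B12 * x * y + B22 * y ^+ 2.
  by rewrite /qform /B11 /B12 /B22 /=; ring.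
exact: quad_ge0.
Qed.
End QuadraticNorm.

Definition halfplane (R : realType) (l : R * R * R) (p : R * R) : bool :=
  0 <= l.1.1 * p.1 + l.1.2 * p.2 + l.2.

Definition opp_halfplane (R : realType) (l : R * R * R) : R * R * R :=
  (- l.1.1, - l.1.2, - l.2).

Definition polygon (R : realType) (s : seq (R * R * R)) : set (R * R) :=
  [set p : R * R | all (fun l => halfplane l p) s].

Definition segment_point (R : realType) (x y : R * R) (t : R) : R * R :=
  (x.1 + t * (y.1 - x.1), x.2 + t * (y.2 - x.2)).

Lemma polygon_convex (R : realType) (s : seq (R * R * R)) x y t :
  polygon s x -> polygon s y -> 0 <= t <= 1 -> polygon s (segment_point x y t).
Proof.
rewrite /polygon /= => /allP hx /allP hy /andP[t0 t1]; apply/allP => l hl.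
move: (hx l hl) (hy l hl); rewrite /halfplane /= => {}hx {}hy.
have -> : l.1.1 * (x.1 + t * (y.1 - x.1)) + l.1.2 * (x.2 + t * (y.2 - x.2)) + l.2 =
  (1 - t) * (l.1.1 * x.1 + l.1.2 * x.2 + l.2) + t * (l.1.1 * y.1 + l.1.2 * y.2 + l.2).
  by ring.
by rewrite addr_ge0 // mulr_ge0 // subr_ge0.
Qed.

Lemma polygon_closed (R : realType) (s : seq (R * R * R)) : closed (polygon s).
Proof.
elim: s => [|l s IH].
  have -> : polygon [::] = [set: R * R] by apply/seteqP; split.
  exact: closedT.
have -> : polygon (l :: s) =
    [set p : R * R | 0 <= l.1.1 * p.1 + l.1.2 * p.2 + l.2] `&` polygon s.
  by apply/seteqP; split => p /= => [/andP[]|[] h1 h2]; [|apply/andP].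
apply: closedI => //.
have h : continuous (fun p : R * R => l.1.1 * p.1 + l.1.2 * p.2 + l.2); last first.
  by move/continuous_closedP: h => /(_ _ (@closed_ge R 0)).
move=> p; apply: cvgD; last exact: cvg_cst.
by apply: cvgD; (apply: cvgM; first exact: cvg_cst); [exact: cvg_fst|exact: cvg_snd].
Qed.

(* Lipschitz bounds on the two sides of a line add up along a segment that
   crosses it. *)
Lemma lipschitz_split (R : realType) (a h c k : R) (f : R * R -> R * R) l s :
  0 < a -> h ^+ 2 < a * c ->
  (forall x y, polygon (l :: s) x -> polygon (l :: s) y ->
     qnorm a h c (f x - f y) <= k * qnorm a h c (x - y)) ->
  (forall x y, polygon (opp_halfplane l :: s) x -> polygon (opp_halfplane l :: s) y ->
     qnorm a h c (f x - f y) <= k * qnorm a h c (x - y)) ->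
  forall x y, polygon s x -> polygon s y ->
     qnorm a h c (f x - f y) <= k * qnorm a h c (x - y).
Proof.
move=> a0 hac h1 h2.
have oppE (p : R * R) : halfplane (opp_halfplane l) p = (l.1.1 * p.1 + l.1.2 * p.2 + l.2 <= 0).
  by rewrite /halfplane /= -[RHS]oppr_ge0; congr (_ <= _); ring.
have sym x y : qnorm a h c (x - y) = qnorm a h c (y - x).
  by rewrite /qnorm; congr (Num.sqrt _); rewrite /qform /=; ring.
have main x y : polygon s x -> polygon s y -> halfplane l x -> halfplane (opp_halfplane l) y ->
    qnorm a h c (f x - f y) <= k * qnorm a h c (x - y).
  move=> sx sy lx; rewrite oppE; rewrite /halfplane in lx.
  set u := l.1.1 * x.1 + _ + _ in lx; set w := l.1.1 * y.1 + _ + _ => wy.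
  (* Since [w <= 0 <= u], equality puts both points on the line; otherwise the segment crosses it at
     the parameter [u / (u - w)]. *)
  have [uw|uw] := eqVneq u w.
    by apply: h1; apply/andP; split => //; rewrite /halfplane -/u -/w; lra.
  have uw0 : 0 < u - w by rewrite lt_neqAle eq_sym subr_eq0 uw /=; lra.
  pose t := u / (u - w).
  have tE : t * (u - w) = u by rewrite divfK // gt_eqF.
  have t01 : 0 <= t <= 1 by rewrite /t divr_ge0 ?(ltW uw0) //= ler_pdivrMr // mul1r; lra.
  pose z := segment_point x y t.
  have sz : polygon s z by apply: polygon_convex.
  have z0 : l.1.1 * z.1 + l.1.2 * z.2 + l.2 = 0.
    have -> : l.1.1 * z.1 + l.1.2 * z.2 + l.2 = u - t * (u - w) by rewrite /z /u /w /=; ring.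
    by rewrite tE subrr.
  have lz : halfplane l z by rewrite /halfplane z0.
  have lz' : halfplane (opp_halfplane l) z by rewrite oppE z0.
  have ly : halfplane (opp_halfplane l) y by rewrite oppE.
  have /andP[t0 t1] := t01.
  have E1 : qnorm a h c (x - z) = t * qnorm a h c (x - y).
    rewrite -qnormZ //; congr (qnorm _ _ _ _); apply: injective_projections; rewrite /z /=; ring.
  have E2 : qnorm a h c (z - y) = (1 - t) * qnorm a h c (x - y).
    rewrite -qnormZ ?subr_ge0 //; congr (qnorm _ _ _ _).
    by apply: injective_projections; rewrite /z /=; ring.
  apply: le_trans (qnorm_triangle a0 hac _ (f z) _) _.
  have g1 : qnorm a h c (f x - f z) <= k * qnorm a h c (x - z).
    by apply: h1; apply/andP.
  have g2 : qnorm a h c (f z - f y) <= k * qnorm a h c (z - y).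
    by apply: h2; apply/andP.
  rewrite E1 in g1; rewrite E2 in g2; apply: le_trans (lerD g1 g2) _.
  by rewrite -mulrDr -mulrDl addrC subrK mul1r.
move=> x y sx sy.
have cases p : halfplane l p \/ halfplane (opp_halfplane l) p.
  by rewrite oppE /halfplane; have [?|?] := leP 0 (l.1.1 * p.1 + l.1.2 * p.2 + l.2);
    [left|right; lra].
have [lx|lx] := cases x; have [ly|ly] := cases y.
- by apply: h1; apply/andP.
- exact: main.
- by rewrite sym (sym x); exact: main.
- by apply: h2; apply/andP.
Qed.

(** * Hexagonal models of the quadratic tiles *)

(* Multiplication by [y] on [Z[y]/(y^2 + b y + 2)], in the basis [1, y]. *)
Definition quad_mul (b : int) (m : int * int) : int * int := (- 2 * m.2, m.1 - b * m.2).

Lemma quad_mul_additive b : zmod_morphism (quad_mul b).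
Proof. by move=> m n; rewrite /quad_mul /=; apply: injective_projections => /=; ring. Qed.
HB.instance Definition _ b := GRing.isZmodMorphism.Build _ _ (quad_mul b) (quad_mul_additive b).

Definition lattice (R : realType) (e1 e2 : R * R) (m : int * int) : R * R :=
  (m.1%:~R * e1.1 + m.2%:~R * e2.1, m.1%:~R * e1.2 + m.2%:~R * e2.2).

Lemma lattice_additive (R : realType) (e1 e2 : R * R) : zmod_morphism (lattice e1 e2).
Proof.
by move=> m n; rewrite /lattice /=; apply: injective_projections => /=; rewrite !intrB; ring.
Qed.
HB.instance Definition _ (R : realType) (e1 e2 : R * R) :=
  GRing.isZmodMorphism.Build _ _ (lattice e1 e2) (lattice_additive e1 e2).

Lemma int_bounded (R : realType) (C : R) : exists k : nat, forall n : int,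
  `|n%:~R : R| <= C -> (`|n| <= k)%N.
Proof.
exists (Num.bound C) => n hn.
have hC : 0 <= C := le_trans (normr_ge0 _) hn.
have := le_lt_trans hn (archi_boundP hC).
by rewrite -intr_norm -natr_absz ltr_nat => /ltnW.
Qed.

Lemma int_parity (X : int) : exists (i : bool) (q : int), X = (i : nat)%:Z - 2 * q.
Proof.
have E := divz_eq X 2; have r0 : 0 <= (X %% 2)%Z by exact: modz_ge0.
have r1 : (X %% 2)%Z < 2 by exact: ltz_pmod.
move: (X %/ 2)%Z (X %% 2)%Z E r0 r1 => q r -> r0 r1.
by exists (r == 1), (- q); case: eqP => /= h; lia.
Qed.

Lemma absz_sub_sg (n : int) : n != 0 -> (absz (n - Num.sg n)).+1 = absz n.
Proof.
case: n => [[|n]|n] // _.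
  by rewrite gtr0_sg //; have -> : n.+1%:Z - 1 = n by rewrite intS addrC addKr.
rewrite ltr0_sg // NegzE opprK.
by have -> : - n.+1%:Z + 1 = - n%:Z; [rewrite intS opprD addrC addNKr|rewrite !abszN].
Qed.

Lemma absz_add (m n : int) : (absz (m + n)%R <= absz m + absz n)%N.
Proof. lia. Qed.

Lemma sgz_or (n : int) : n != 0 -> Num.sg n = 1 \/ Num.sg n = -1.
Proof.
by case: n => [[|n]|n] // _; [left; exact: gtr0_sg|right; exact: ltr0_sg].
Qed.

(* By central symmetry, [neighbor1] and [neighbor2] say that the hexagon meets its
   translates by [e1] and [e2 - t e1]. *)
Record hexagon_ifs (R : realType) (b t : int) (a h c K C Delta : R)
    (s : seq (R * R * R)) (e1 e2 : R * R) (F : R * R -> R * R) : Prop := HexagonIfs {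
  a_gt1 : 1 < a;
  h_lt1 : h ^+ 2 < (a - 1) * c;
  h_lt2 : h ^+ 2 < a * (c - 1);
  C_ge0 : 0 <= C;
  aC : a <= C ^+ 2;
  hC : `|h| <= C ^+ 2;
  cC : c <= C ^+ 2;
  K_ge0 : 0 <= K;
  K_lt1 : K < 1;
  P_opp : forall x, polygon s x -> polygon s (- x);
  P_diam : forall x y, polygon s x -> polygon s y -> qnorm a h c (x - y) <= Delta;
  F_P : forall x, polygon s x -> polygon s (F x);
  F_lip : forall x y, polygon s x -> polygon s y ->
    qnorm a h c (F x - F y) <= K * qnorm a h c (x - y);
  F_cover : forall y, polygon s y -> exists2 x, polygon s x & F x = y \/ F x = - y;
  F_glue_same : forall x x' m, polygon s x -> polygon s x' ->
    x - x' = lattice e1 e2 (quad_mul b m) <-> F x - F x' = lattice e1 e2 m;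
  F_glue_opp : forall x x' m, polygon s x -> polygon s x' ->
    x + x' = lattice e1 e2 ((1, 0) + quad_mul b m) <-> F x + F x' = lattice e1 e2 m;
  e_det : e1.1 * e2.2 - e1.2 * e2.1 != 0;
  neighbor1 : polygon s (e1.1 / 2, e1.2 / 2);
  neighbor2 : polygon s ((e2.1 - t%:~R * e1.1) / 2, (e2.2 - t%:~R * e1.2) / 2) }.

(* Conjugation [y |-> - y] turns the model of [y^2 + b y + 2] into that of
   [y^2 - b y + 2]. *)
Lemma hexagon_ifs_opp (R : realType) (b t : int) (a h c K C Delta : R) s e1 e2 F :
  hexagon_ifs b t a h c K C Delta s e1 e2 F ->
  hexagon_ifs (- b) (- t) a h c K C Delta s e1 (- e2) (fun x => - F x).
Proof.
move=> H.
have latE m : lattice e1 (- e2) m = lattice e1 e2 (m.1, - m.2).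
  by rewrite /lattice /=; apply: injective_projections => /=; rewrite intrN; ring.
have latN m : lattice e1 e2 (- m.1, m.2) = - lattice e1 (- e2) m.
  by rewrite /lattice /=; apply: injective_projections => /=; rewrite intrN; ring.
(* Conjugation intertwines multiplication by [y] with multiplication by [- y]; the extra sign is the
   reason for replacing [F] by [- F]. *)
have mulE m : quad_mul (- b) m = ((quad_mul b (- m.1, m.2)).1, - (quad_mul b (- m.1, m.2)).2).
  by rewrite /quad_mul /=; apply: injective_projections => /=; ring.
have pairE (p : int * int) : ((p.1, - p.2).1, - (p.1, - p.2).2) = p.
  by case: p => p q /=; rewrite opprK.
have oppB (x y : R * R) : - x - - y = - (x - y) by rewrite opprD.
have oppE (x y : R * R) : - x = y <-> x = - y by split=> [<-|->]; rewrite opprK.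
have symE x y : qnorm a h c (- x - - y) = qnorm a h c (x - y).
  by rewrite oppB /qnorm; congr (Num.sqrt _); rewrite /qform /=; ring.
case: H => h1 h2 h3 h4 h5 h6 h7 h8 h9 h10 h11 h12 h13 h14 h15 h16 h17 h18 h19.
split => //.
- by move=> x Px; apply/h10/h12.
- by move=> x y Px Py; rewrite symE h13.
- by move=> y Py; have [x Px [E|E]] := h14 y Py; exists x => //; [right|left]; rewrite E ?opprK.
- move=> x x' m Px Px'; rewrite oppB oppE -latN latE mulE pairE.
  exact: h15.
- move=> x x' m Px Px'; rewrite -opprD oppE -latN latE mulE.
  have oneE (p : int * int) : ((((1, 0) : int * int) + (p.1, - p.2)).1,
      - (((1, 0) : int * int) + (p.1, - p.2)).2) = (1, 0) + p.
    by apply: injective_projections => /=; rewrite ?add0r ?opprK.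
  rewrite oneE.
  exact: h16.
- apply: contra h17 => /eqP E; apply/eqP; rewrite -[LHS]opprK -[X in _ = X]oppr0 -E /=; ring.
- by have /h10 := h19; congr polygon; apply: injective_projections => /=; rewrite intrN; field.
Qed.

Section HexagonModel.
Variables (R : realType) (b t : int) (a h c K C Delta : R) (s : seq (R * R * R)).
Variables (e1 e2 : R * R) (F : R * R -> R * R).
Hypothesis ifs : hexagon_ifs b t a h c K C Delta s e1 e2 F.
Let N := qnorm a h c.
Let P := polygon s.
Let iota := lattice e1 e2.
Let P_opp' : forall x, P x -> P (- x). Proof. exact: (P_opp ifs). Qed.
Let P_diam' : forall x y, P x -> P y -> N (x - y) <= Delta. Proof. exact: (P_diam ifs). Qed.
Let F_P' : forall x, P x -> P (F x). Proof. exact: (F_P ifs). Qed.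
Let F_lip' : forall x y, P x -> P y -> N (F x - F y) <= K * N (x - y).
Proof. exact: (F_lip ifs). Qed.
Let F_cover' : forall y, P y -> exists2 x, P x & F x = y \/ F x = - y.
Proof. exact: (F_cover ifs). Qed.
Let F_glue_same' : forall x x' m, P x -> P x' ->
  x - x' = iota (quad_mul b m) <-> F x - F x' = iota m.
Proof. exact: (F_glue_same ifs). Qed.
Let F_glue_opp' : forall x x' m, P x -> P x' ->
  x + x' = iota ((1, 0) + quad_mul b m) <-> F x + F x' = iota m.
Proof. exact: (F_glue_opp ifs). Qed.
Let iN n : iota (- n) = - iota n. Proof. exact: raddfN. Qed.

Definition branch (i : bool) (x : R * R) := if i then - F (- x) else F x.

(** Central symmetry leaves two cases: equal digits reduce to [F_glue_same], for the points or for
    their opposites, and distinct digits reduce to [F_glue_opp], with one point replaced by its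
    opposite. *)
Lemma branch_glue i j x x' m : P x -> P x' ->
  (x + iota ((1, 0) *+ nat_of_bool i) =
   x' + iota ((1, 0) *+ nat_of_bool j + quad_mul b m)) <->
  branch i x = branch j x' + iota m.
Proof.
move=> Px Px'; have [Qx Qx'] := (P_opp' Px, P_opp' Px').
have eqB (u w z y : R * R) : u + w = z + y <-> u - z = y - w.
  split=> [E|E].
    by apply: (addIr w); rewrite subrK addrAC E addrAC subrr add0r.
  by rewrite -[u](subrK z) E addrAC subrK addrC.
have eqB' (u z y : R * R) : u = z + y <-> u - z = y by rewrite -[u]addr0 eqB subr0 addr0.
apply: (iff_trans (eqB _ _ _ _)); apply: (iff_trans _ (iff_sym (eqB' _ _ _))).
rewrite -raddfB; case: i; case: j; rewrite /branch /= ?mulr1n ?mulr0n ?subr0 ?add0r.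
- rewrite addrAC subrr add0r.
  have -> : - F (- x) - - F (- x') = F (- x') - F (- x) by rewrite opprK addrC.
  by rewrite -F_glue_same' // opprK addrC.
- have -> : - F (- x) - F x' = - (F x' + F (- x)) by rewrite opprD addrC.
  have G := F_glue_opp' (- m) Px' Qx; split=> E.
    have -> : F x' + F (- x) = iota (- m).
      by apply/G; rewrite -opprB E -iN opprB (raddfN (quad_mul b)).
    by rewrite iN opprK.
  have : x' - x = iota ((1, 0) + quad_mul b (- m)) by apply/G; rewrite iN -E opprK.
  by rewrite -opprB => /eqP; rewrite eqr_oppLR -iN (raddfN (quad_mul b)) opprB => /eqP ->.
- by have := F_glue_opp' m Px Qx'; rewrite opprK.
- exact: F_glue_same'.
Qed.

(** Path length in the basis [e1], [e2 - t e1] of translations between neighbors: there the vector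
    [X e1 + Y e2] has coefficients [X + t Y] and [Y]. *)
Definition lattice_size (m : int * int) : nat := (absz (m.1 + t * m.2)%R + absz m.2)%N.

Theorem hexagon_model : exists phi : (nat -> bool) -> R * R,
  [/\ cylinder_continuous (fun a => (phi a).1), cylinder_continuous (fun a => (phi a).2),
      forall a, P (phi a), forall x, P x -> exists a, phi a = x &
      forall u w, phi u = phi w <->
        exists k, forall n, (lattice_size (digit_diff (quad_mul b) (1%:Z, 0%:Z) u w n) <= k)%N].
Proof.
have [a0 ha] : 0 < a /\ h ^+ 2 < a * c.
  split; first exact: lt_trans ltr01 (a_gt1 ifs).
  have ac : 0 < (a - 1) * c by apply: le_lt_trans (h_lt1 ifs); exact: sqr_ge0.
  have c0 : 0 < c by rewrite pmulr_rgt0 ?subr_gt0 ?(a_gt1 ifs) in ac.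
  by apply: lt_trans (h_lt1 ifs) _; rewrite mulrBl mul1r gtrBl.
(* The origin is the midpoint of the point of [neighbor1] and its opposite. *)
have P0 : P (0, 0).
  have := polygon_convex (neighbor1 ifs) (P_opp' (neighbor1 ifs)) (t := 1/2).
  rewrite /segment_point /= => /(_ _); move=> H.
  have {}H := H ltac:(lra).
  by have -> : (0, 0) = (e1.1 / 2 + 1 / 2 * (- (e1.1 / 2) - e1.1 / 2),
     e1.2 / 2 + 1 / 2 * (- (e1.2 / 2) - e1.2 / 2)) :> R * R
    by apply: injective_projections => /=; field.
have N_branch i x y : P x -> P y -> N (branch i x - branch i y) <= K * N (x - y).
  case: i => /= Px Py; last exact: F_lip'.
  have sym u w : N (u - w) = N (w - u).
    by rewrite /N /qnorm; congr (Num.sqrt _); rewrite /qform /=; ring.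
  have -> : - F (- x) - - F (- y) = F (- y) - F (- x) by rewrite opprK addrC.
  have -> : N (x - y) = N (- y - - x) by rewrite opprK addrC.
  by apply: F_lip'; exact: P_opp'.
have [[K0 K1] C0] := (K_ge0 ifs, K_lt1 ifs, C_ge0 ifs).
apply: (@model_address R (int * int)%type (quad_mul b) (1%:Z, 0%:Z) iota lattice_size N 1 C Delta K P branch (0, 0)) => //.
- exact: qnorm_triangle.
- exact: (norm_le_qnorm a0 ha (ltW (h_lt1 ifs)) (ltW (h_lt2 ifs)) (a_gt1 ifs)).
- exact: (qnorm_le_norm a0 ha C0 (aC ifs) (hC ifs) (cC ifs)).
- exact: polygon_closed.
- by case=> x Px /=; [apply/P_opp'/F_P'/P_opp'|exact: F_P'].
- move=> y Py; have [x Px [E|E]] := F_cover' Py; first by exists false, x.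
  by exists true, (- x); split; [exact: P_opp'|rewrite /= opprK E opprK].
- by move=> i j x x' m; exact: branch_glue.
- move=> [X Y]; have [i [q XE]] := int_parity X; exists i, (Y + b * q, q).
  by case: i XE => ->; apply: injective_projections => /=; ring.
- move=> [X Y] /eqP; rewrite /lattice_size /= addn_eq0 !absz_eq0 => /andP[/eqP h1 /eqP h2].
  by move: h1; rewrite h2 mulr0 addr0 => ->.
- have step (u : R * R) e : P u -> iota e = u + u -> forall e', e' = e \/ e' = - e ->
      exists x y, [/\ P x, P y & x = y + iota e'].
    move=> Pu E e' [->|->]; [exists u, (- u)|exists (- u), u].
      by split => //; [exact: P_opp'|rewrite E addKr].
    by split => //; [exact: P_opp'|rewrite iN E opprD addNKr].
  have s1 := step _ (1, 0) (neighbor1 ifs); have s2 := step _ (- t, 1) (neighbor2 ifs).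
  have {}s1 := s1 _; have {}s2 := s2 _.
  move=> [X Y] k; rewrite /lattice_size /= => E.
  have [Y0|Y0] := eqVneq Y 0.
    have X0 : X != 0 by apply: contra_eqN E => /eqP ->; rewrite Y0 mulr0.
    move: E; rewrite Y0 mulr0 addr0 addn0 => E.
    exists (Num.sg X, 0); split.
      by rewrite /= subr0 mulr0 addr0 addn0 addn0 -ltnS absz_sub_sg // E.
    apply: s1; first by apply: injective_projections => /=; field.
    by case: (sgz_or X0) => ->; [left|right].
  exists (- t * Num.sg Y, Num.sg Y); split.
    rewrite /= -ltnS -addnS absz_sub_sg // -E.
    by rewrite mulrBr mulNr opprK addrACA subrr addr0.
  apply: s2; first by apply: injective_projections => /=; rewrite intrN; field.
  by case: (sgz_or Y0) => ->; [left|right]; rewrite ?mulr1 ?mulrN1.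
- move=> B.
  (* Cramer's rule bounds the coefficients of a lattice vector by its coordinates. *)
  pose d := e1.1 * e2.2 - e1.2 * e2.1.
  have [k1 hk1] := int_bounded ((B * `|e2.2| + B * `|e2.1|) / `|d|).
  have [k2 hk2] := int_bounded ((B * `|e1.2| + B * `|e1.1|) / `|d|).
  have d0 : 0 < `|d| by rewrite normr_gt0; exact: (e_det ifs).
  exists (k1 + absz t * k2 + k2)%N => -[X Y] h1 h2.
  have bnd (u w z : R) : z * d = (iota (X, Y)).1 * u - (iota (X, Y)).2 * w ->
      `|z| <= (B * `|u| + B * `|w|) / `|d|.
    move=> E; rewrite ler_pdivlMr // -normrM E; apply: le_trans (ler_normB _ _) _.
    by rewrite !normrM; apply: lerD; apply: ler_wpM2r.
  have hX : (`|X| <= k1)%N by apply: hk1; apply: bnd; rewrite /d /=; ring.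
  have hY : (`|Y| <= k2)%N.
    apply: hk2; rewrite -normrN; apply: bnd; rewrite /d /=; ring.
  rewrite /lattice_size /= leq_add //.
  apply: (leq_trans (absz_add X (t * Y))).
  by rewrite abszM leq_add // leq_mul.
Qed.
End HexagonModel.

(** * The hexagon of the twindragon *)

Lemma affine_lipschitz (R : realType) (a h c k p1 p2 p3 p4 q1 q2 : R) s (f : R * R -> R * R) :
  0 < a -> h ^+ 2 < a * c -> 0 <= k ->
  0 < k ^+ 2 * a - (a * p1 ^+ 2 + 2 * h * p1 * p3 + c * p3 ^+ 2) ->
  (k ^+ 2 * h - (a * p1 * p2 + h * (p1 * p4 + p2 * p3) + c * p3 * p4)) ^+ 2 <=
  (k ^+ 2 * a - (a * p1 ^+ 2 + 2 * h * p1 * p3 + c * p3 ^+ 2)) *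
  (k ^+ 2 * c - (a * p2 ^+ 2 + 2 * h * p2 * p4 + c * p4 ^+ 2)) ->
  (forall p, polygon s p -> f p = (p1 * p.1 + p2 * p.2 + q1, p3 * p.1 + p4 * p.2 + q2)) ->
  forall x y, polygon s x -> polygon s y ->
    qnorm a h c (f x - f y) <= k * qnorm a h c (x - y).
Proof.
move=> a0 ha k0 B1 B2 fE x y sx sy; rewrite !fE //.
have -> : x - y = (x.1 - y.1, x.2 - y.2) by [].
have -> : (p1 * x.1 + p2 * x.2 + q1, p3 * x.1 + p4 * x.2 + q2) -
  (p1 * y.1 + p2 * y.2 + q1, p3 * y.1 + p4 * y.2 + q2) =
  (p1 * (x.1 - y.1) + p2 * (x.2 - y.2), p3 * (x.1 - y.1) + p4 * (x.2 - y.2)).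
  by apply: injective_projections => /=; ring.
exact: qnorm_contract.
Qed.

Section Twin.
Variable R : realType.

(** A fundamental domain, up to its boundary, of the lattice spanned by [(2, -6)] and [(8, -8)]:
    both have area 32. Opposite sides differ by [(2, -6)], [(6, -2)] and [(4, 4)]. *)
Definition twin_hexagon : seq (R * R * R) :=
  [:: (-1, 0, 3); (1, 0, 3); (0, -1, 3); (0, 1, 3); (-1, -1, 4); (1, 1, 4)].

Lemma twin_hexagonP (p : R * R) : polygon twin_hexagon p <->
  [/\ -3 <= p.1 <= 3, -3 <= p.2 <= 3 & -4 <= p.1 + p.2 <= 4].
Proof.
rewrite /polygon /halfplane /=; split.
  by move=> /and5P[h1 h2 h3 h4 /and3P[h5 h6 _]]; split; apply/andP; split; lra.
move=> [/andP[h1 h2] /andP[h3 h4] /andP[h5 h6]].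
by apply/and5P; split; try lra; apply/and3P; split => //; lra.
Qed.

(* Affine on the four triangles cut by the diagonals from the vertex (-3, 3);
   the vertices (-1,-3), (3,-3), (3,1), (1,3), (-3,3), (-3,-1) go to
   (-3,2), (3,-2), (3,0), (3,1), (1,3), (-3,3). *)
Definition twin_map (p : R * R) : R * R :=
  let: (x, y) := p in
  if 6 <= x + 3 * y then (x / 2 + y / 2 + 1, - x / 2 + 3 / 2)
  else if 0 <= x + y then (x / 3 + 2, - x / 3 + y / 2 + 1 / 2)
  else if -6 <= 3 * x + y then (3 / 2 * x + 7 / 6 * y + 2, - x - y / 6 + 1 / 2)
  else (x + y + 1, - x / 2 + 3 / 2).

Lemma twin_map_half p : polygon twin_hexagon p ->
  polygon twin_hexagon (twin_map p) /\ 0 <= 2 * (twin_map p).1 + 3 * (twin_map p).2.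
Proof.
case: p => x y /twin_hexagonP[/andP[a1 a2] /andP[b1 b2] /andP[c1 c2]]; simpl in *.
rewrite twin_hexagonP /twin_map; case: ifP => h1; [|case: ifP => h2; [|case: ifP => h3]].
all: split; [split; simpl; apply/andP; split; lra | simpl; lra].
Qed.

Lemma twin_map_inj p q : polygon twin_hexagon p -> polygon twin_hexagon q ->
  twin_map p = twin_map q -> p = q.
Proof.
case: p => x y /twin_hexagonP[/andP[a1 a2] /andP[b1 b2] /andP[c1 c2]]; simpl in *.
case: q => x' y' /twin_hexagonP[/andP[a1' a2'] /andP[b1' b2'] /andP[c1' c2']]; simpl in *.
rewrite /twin_map.
do 3 try case: ifP => ?; do 3 try case: ifP => ?; move=> [e1 e2]; congr pair; lra.
Qed.

Lemma twin_map_cover_half (y : R * R) : polygon twin_hexagon y -> 0 <= 2 * y.1 + 3 * y.2 ->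
  exists2 x, polygon twin_hexagon x & twin_map x = y.
Proof.
case: y => X Y /twin_hexagonP[/andP[a1 a2] /andP[b1 b2] /andP[c1 c2]] half; simpl in *.
(* The three lines pass through [(1, 3)], the image of the common vertex of the triangles, and
   separate their images; the witnesses are the inverse affine maps. *)
have [k1|k1] := leP 9 (3 * X + 2 * Y); last have [k2|k2] := leP 11 (5 * X + 2 * Y);
  last have [k3|k3] := leP (-11) (X - 4 * Y).
- exists (3 - 2 * Y, 2 * X + 2 * Y - 5).
    by apply/twin_hexagonP; split => /=; apply/andP; split; lra.
  by rewrite /twin_map; do 3 try case: ifP => ?; congr pair; lra.
- exists (3 * X - 6, 2 * X + 2 * Y - 5).
    by apply/twin_hexagonP; split => /=; apply/andP; split; lra.
  by rewrite /twin_map; do 3 try case: ifP => ?; congr pair; lra.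
- exists (1 - 2 / 11 * X - 14 / 11 * Y, 12 / 11 * X + 18 / 11 * Y - 3).
    by apply/twin_hexagonP; split => /=; apply/andP; split; lra.
  by rewrite /twin_map; do 3 try case: ifP => ?; congr pair; lra.
- exists (3 - 2 * Y, X - 4 + 2 * Y).
    by apply/twin_hexagonP; split => /=; apply/andP; split; lra.
  by rewrite /twin_map; do 3 try case: ifP => ?; congr pair; lra.
Qed.

(** In the Euclidean norm this fails: the third piece sends [(1, 0)] to [(3/2, -1)]. The form
    [6 x^2 + 10 x y + 7 y^2] is contracted by all four pieces, which [lipschitz_split] assembles
    along the diagonals. *)
Lemma twin_map_lipschitz (x y : R * R) : polygon twin_hexagon x -> polygon twin_hexagon y ->
  qnorm 6 5 7 (twin_map x - twin_map y) <= 97 / 100 * qnorm 6 5 7 (x - y).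
Proof.
have a0 : 0 < 6 :> R by lra.
have ha : (5 : R) ^+ 2 < 6 * 7 by lra.
move: x y; apply: (lipschitz_split (l := (1, 3, -6))) => //; last first.
  apply: (lipschitz_split (l := (1, 1, 0))) => //; last first.
    apply: (lipschitz_split (l := (3, 1, 6))) => //; last first.
      apply: (@affine_lipschitz _ _ _ _ _ 1 1 (-1/2) 0 1 (3/2)) => //; try lra.
      move=> [u w]; rewrite /polygon /halfplane /= => /and5P[g1 g2 g3 g4 /and5P[g5 g6 g7 g8 _]].
      by rewrite /twin_map; do 3 try case: ifP => ?; congr pair; lra.
    apply: (@affine_lipschitz _ _ _ _ _ (3/2) (7/6) (-1) (-1/6) 2 (1/2)) => //; try lra.
    move=> [u w]; rewrite /polygon /halfplane /= => /and5P[g1 g2 g3 g4 /and5P[g5 g6 g7 g8 _]].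
    by rewrite /twin_map; do 3 try case: ifP => ?; congr pair; lra.
  apply: (@affine_lipschitz _ _ _ _ _ (1/3) 0 (-1/3) (1/2) 2 (1/2)) => //; try lra.
  move=> [u w]; rewrite /polygon /halfplane /= => /and5P[g1 g2 g3 g4 /and5P[g5 g6 g7 g8 _]].
  by rewrite /twin_map; do 3 try case: ifP => ?; congr pair; lra.
apply: (@affine_lipschitz _ _ _ _ _ (1/2) (1/2) (-1/2) 0 1 (3/2)) => //; try lra.
move=> [u w]; rewrite /polygon /halfplane /= => /and5P[g1 g2 g3 g4 /and4P[g5 g6 g7 _]].
by rewrite /twin_map; do 3 try case: ifP => ?; congr pair; lra.
Qed.
End Twin.

Section TwinGlue.
Variable R : realType.
Implicit Types p : R * R.

(** Distinct lattice translates meet only along sides, so the gluing involves only these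
    restrictions. The bottom side goes to the cut [2 x + 3 y = 0] that halves the hexagon, the
    others to sides or parts of sides. *)
Lemma twin_map_edges p : polygon (twin_hexagon R) p ->
  [/\ p.2 = -3 -> twin_map p = (3 / 2 * p.1 - 3 / 2, 1 - p.1),
      p.1 = 3 -> twin_map p = (3, p.2 / 2 - 1 / 2),
      p.1 + p.2 = 4 -> twin_map p = (3, (3 - p.1) / 2),
      p.2 = 3 -> twin_map p = (p.1 / 2 + 5 / 2, (3 - p.1) / 2) &
      p.1 = -3 -> twin_map p = (p.2 - 2, 3)] /\
  (p.1 + p.2 = -4 -> twin_map p = (-3, (3 - p.1) / 2)).
Proof.
case: p => x y /twin_hexagonP[/andP[a1 a2] /andP[b1 b2] /andP[c1 c2]]; simpl in *.
rewrite /twin_map.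
by split; [split|] => E; do 3 try case: ifP => ?; congr pair; lra.
Qed.

(** The side [x = 3] receives two sides of the hexagon, which meet at [(3, 0)]: hence the conditions
    on the sign of [q.2]. *)
Lemma twin_map_inv_edges p : polygon (twin_hexagon R) p ->
  let q := twin_map p in
  [/\ 2 * q.1 + 3 * q.2 = 0 -> p = (1 - q.2, -3),
      q.1 = 3 -> q.2 <= 0 -> p = (3, 2 * q.2 + 1),
      q.1 = 3 -> 0 <= q.2 -> p = (3 - 2 * q.2, 1 + 2 * q.2),
      q.1 + q.2 = 4 -> p = (2 * q.1 - 5, 3) &
      q.2 = 3 -> p = (-3, q.1 + 2)] /\
  (q.1 = -3 -> p = (3 - 2 * q.2, 2 * q.2 - 7)).
Proof.
case: p => x y /twin_hexagonP[/andP[a1 a2] /andP[b1 b2] /andP[c1 c2]]; simpl in *.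
rewrite /twin_map.
do 3 try case: ifP => ?; simpl; (split; [split|]) => *; congr pair; lra.
Qed.

Let e1 : R * R := (2, -6).
Let e2 : R * R := (8, -8).

(** The bounds hold for differences, and by symmetry for sums, of two points of the hexagon. Over
    [int] they leave finitely many lattice vectors, which [lia] enumerates. *)
Lemma twin_lattice_bound (n : int * int) (d : R * R) : d = lattice e1 e2 n ->
  -6 <= d.1 <= 6 -> -6 <= d.2 <= 6 -> -8 <= d.1 + d.2 <= 8 ->
  [/\ -6 <= 2 * n.1 + 8 * n.2 <= 6, -6 <= - 6 * n.1 - 8 * n.2 <= 6 & -8 <= - 4 * n.1 <= 8].
Proof.
move=> -> /=; rewrite -!(ler_int R) !(intrD, intrM, intrN) /= => h1 h2 h3.
by split; lra.
Qed.

Lemma twin_glue_same x x' m : polygon (twin_hexagon R) x -> polygon (twin_hexagon R) x' ->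
  x - x' = lattice e1 e2 (quad_mul (-2) m) <->
  twin_map x - twin_map x' = lattice e1 e2 m.
Proof.
move=> Px Px'.
have [[_ _ ec _ _] ec'] := twin_map_edges Px.
have [[_ _ fc _ _] fc'] := twin_map_edges Px'.
have [[_ _ ic _ _] ic'] := twin_map_inv_edges Px.
have [[_ _ jc _ _] jc'] := twin_map_inv_edges Px'.
have [Qx Hx] := twin_map_half Px; have [Qx' Hx'] := twin_map_half Px'.
move/twin_hexagonP: (Px) => [/andP[a1 a2] /andP[a3 a4] /andP[a5 a6]].
move/twin_hexagonP: (Px') => [/andP[b1 b2] /andP[b3 b4] /andP[b5 b6]].
move/twin_hexagonP: Qx => [/andP[c1 c2] /andP[c3 c4] /andP[c5 c6]].
move/twin_hexagonP: Qx' => [/andP[d1 d2] /andP[d3 d4] /andP[d5 d6]].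
case: m => m1 m2; split => E.
{ have B := twin_lattice_bound E; have E1 := congr1 fst E; have E2 := congr1 snd E.
  rewrite /= in B E1 E2; clear E; case: B.
  1-3: by clear -a1 a2 a3 a4 a5 a6 b1 b2 b3 b4 b5 b6; lra.
  move=> h1 h2 h3.
  have [[F1 F2]|[[F1 F2]|[F1 F2]]] :
      (m1 = 0 /\ m2 = 0) \/ (m1 = -1 /\ m2 = 1) \/ (m1 = 1 /\ m2 = -1).
    by clear -h1 h2 h3; lia.
  all: rewrite F1 F2 /= in E1 E2 *.
  + have -> : x = x' by apply: injective_projections; clear -E1 E2; lra.
    by apply: injective_projections => /=; clear; lra.
  + rewrite (ec ltac:(clear -a6 b5 E1 E2; lra)) (fc' ltac:(clear -a6 b5 E1 E2; lra)).
    by apply: injective_projections => /=; clear -E1 E2; lra.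
  + rewrite (ec' ltac:(clear -a5 b6 E1 E2; lra)) (fc ltac:(clear -a5 b6 E1 E2; lra)).
    by apply: injective_projections => /=; clear -E1 E2; lra. }
have B := twin_lattice_bound E; have E1 := congr1 fst E; have E2 := congr1 snd E.
  rewrite /= in B E1 E2; clear E; case: B.
  1-3: by clear -c1 c2 c3 c4 c5 c6 d1 d2 d3 d4 d5 d6; lra.
  move=> h1 h2 h3.
  have H : (m1 = 0 /\ m2 = 0) \/ (m1 = -1 /\ m2 = 1) \/ (m1 = 1 /\ m2 = -1) \/
      (m1 = 1 /\ m2 = 0) \/ (m1 = -1 /\ m2 = 0) \/ (m1 = -2 /\ m2 = 1) \/
      (m1 = 2 /\ m2 = -1).
    by clear -h1 h2 h3; lia.
  case: H => [[F1 F2]|[[F1 F2]|[[F1 F2]|[[F1 F2]|[[F1 F2]|[[F1 F2]|[F1 F2]]]]]]].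
  all: rewrite F1 F2 /= in E1 E2 *.
  (* These four vectors would put one of the images on the side [y = -3] or [x + y = -4], and both
     lie strictly on the other side of the cut. *)
  4-7: exfalso; have : (1 : R) <= 0 by clear -E1 E2 Hx Hx' c1 c2 c3 c4 c5 c6 d1 d2 d3 d4 d5 d6; lra.
  4-7: by rewrite ler10.
  + have -> : x = x'.
      by apply: twin_map_inj => //; apply: injective_projections; clear -E1 E2; lra.
    by apply: injective_projections => /=; clear; lra.
  + rewrite {1}(ic ltac:(clear -c2 d1 E1; lra) ltac:(clear -c2 d1 Hx' E1 E2; lra)).
    rewrite {1}(jc' ltac:(clear -c2 d1 E1; lra)).
    by apply: injective_projections => /=; clear -E1 E2; lra.
  + rewrite {1}(ic' ltac:(clear -c1 d2 E1; lra)).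
    rewrite {1}(jc ltac:(clear -c1 d2 E1; lra) ltac:(clear -c1 d2 Hx E1 E2; lra)).
    by apply: injective_projections => /=; clear -E1 E2; lra.
Qed.

(** For [m = 0] the half-turn about the midpoint of the bottom side becomes the half-turn about the
    origin on the cut: this is where the two halves are sewn together. The other three vectors match
    half-turns of whole sides with half-turns about midpoints of outer sides. *)
Lemma twin_glue_opp x x' m : polygon (twin_hexagon R) x -> polygon (twin_hexagon R) x' ->
  x + x' = lattice e1 e2 ((1, 0) + quad_mul (-2) m) <->
  twin_map x + twin_map x' = lattice e1 e2 m.
Proof.
move=> Px Px'.
have [[ea eb _ ea' eb'] _] := twin_map_edges Px.
have [[fa fb _ fa' fb'] _] := twin_map_edges Px'.
have [[ia ib _ ia' ib'] _] := twin_map_inv_edges Px.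
have [[ja jb _ ja' jb'] _] := twin_map_inv_edges Px'.
have [Qx Hx] := twin_map_half Px; have [Qx' Hx'] := twin_map_half Px'.
move/twin_hexagonP: (Px) => [/andP[a1 a2] /andP[a3 a4] /andP[a5 a6]].
move/twin_hexagonP: (Px') => [/andP[b1 b2] /andP[b3 b4] /andP[b5 b6]].
move/twin_hexagonP: Qx => [/andP[c1 c2] /andP[c3 c4] /andP[c5 c6]].
move/twin_hexagonP: Qx' => [/andP[d1 d2] /andP[d3 d4] /andP[d5 d6]].
case: m => m1 m2; split => E.
{ have B := twin_lattice_bound E; have E1 := congr1 fst E; have E2 := congr1 snd E.
  rewrite /= in B E1 E2; clear E; case: B.
  1-3: by clear -a1 a2 a3 a4 a5 a6 b1 b2 b3 b4 b5 b6; lra.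
  move=> h1 h2 h3.
  have H : (m1 = 0 /\ m2 = 0) \/ (m1 = -2 /\ m2 = 1) \/ (m1 = -1 /\ m2 = 1) \/
      (m1 = -1 /\ m2 = 0).
    by clear -h1 h2 h3; lia.
  case: H => [[F1 F2]|[[F1 F2]|[[F1 F2]|[F1 F2]]]]; rewrite F1 F2 /= in E1 E2 *.
  + rewrite (ea ltac:(clear -a3 b3 E2; lra)) (fa ltac:(clear -a3 b3 E2; lra)).
    by apply: injective_projections => /=; clear -E1 E2; lra.
  + rewrite (ea' ltac:(clear -a4 b4 E2; lra)) (fa' ltac:(clear -a4 b4 E2; lra)).
    by apply: injective_projections => /=; clear -E1 E2; lra.
  + rewrite (eb ltac:(clear -a2 b2 E1; lra)) (fb ltac:(clear -a2 b2 E1; lra)).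
    by apply: injective_projections => /=; clear -E1 E2; lra.
  + rewrite (eb' ltac:(clear -a1 b1 E1; lra)) (fb' ltac:(clear -a1 b1 E1; lra)).
    by apply: injective_projections => /=; clear -E1 E2; lra. }
have B := twin_lattice_bound E; have E1 := congr1 fst E; have E2 := congr1 snd E.
  rewrite /= in B E1 E2; clear E; case: B.
  1-3: by clear -c1 c2 c3 c4 c5 c6 d1 d2 d3 d4 d5 d6; lra.
  move=> h1 h2 h3.
  have H : (m1 = 0 /\ m2 = 0) \/ (m1 = -2 /\ m2 = 1) \/ (m1 = -1 /\ m2 = 1) \/
      (m1 = -1 /\ m2 = 0) \/ (m1 = 1 /\ m2 = 0) \/ (m1 = 1 /\ m2 = -1) \/
      (m1 = 2 /\ m2 = -1).
    by clear -h1 h2 h3; lia.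
  case: H => [[F1 F2]|[[F1 F2]|[[F1 F2]|[[F1 F2]|[[F1 F2]|[[F1 F2]|[F1 F2]]]]]]].
  all: rewrite F1 F2 /= in E1 E2 *.
  5-7: exfalso; have : (1 : R) <= 0 by clear -E1 E2 Hx Hx'; lra.
  5-7: by rewrite ler10.
  + rewrite {1}(ia ltac:(clear -Hx Hx' E1 E2; lra)) {1}(ja ltac:(clear -Hx Hx' E1 E2; lra)).
    by apply: injective_projections => /=; clear -E1 E2; lra.
  + rewrite {1}(ia' ltac:(clear -c6 d6 E1 E2; lra)) {1}(ja' ltac:(clear -c6 d6 E1 E2; lra)).
    by apply: injective_projections => /=; clear -E1 E2; lra.
  + rewrite {1}(ib ltac:(clear -c2 d2 E1; lra) ltac:(clear -c2 d2 Hx' E1 E2; lra)).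
    rewrite {1}(jb ltac:(clear -c2 d2 E1; lra) ltac:(clear -c2 d2 Hx E1 E2; lra)).
    by apply: injective_projections => /=; clear -E1 E2; lra.
  + rewrite {1}(ib' ltac:(clear -c4 d4 E2; lra)) {1}(jb' ltac:(clear -c4 d4 E2; lra)).
    by apply: injective_projections => /=; clear -E1 E2; lra.
Qed.

Lemma twin_ifs : hexagon_ifs (-2) 1 6 5 7 (97 / 100) 3 36 (twin_hexagon R) e1 e2 (@twin_map R).
Proof.
have opp p : polygon (twin_hexagon R) p -> polygon (twin_hexagon R) (- p).
  move=> /twin_hexagonP[/andP[a1 a2] /andP[a3 a4] /andP[a5 a6]]; apply/twin_hexagonP.
  by split; apply/andP; split; rewrite /=; lra.
split; [lra|lra|lra|lra|lra| |lra|lra|lra|..].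
- by rewrite ger0_norm; lra.
- exact: opp.
(* The bound 36 is [3 * (6 + 6)]: the factor comes from [7 <= 3 ^+ 2], and the hexagon lies in a
   square of side 6. *)
- move=> x y /twin_hexagonP[/andP[a1 a2] /andP[a3 a4] _] /twin_hexagonP[/andP[b1 b2] /andP[b3 b4] _].
  have h5 : `|5 : R| <= 3 ^+ 2 by rewrite ger0_norm; lra.
  apply: (le_trans (qnorm_le_norm _ _ (k := 3) _ _ h5 _ _)); [lra|lra|lra|lra|lra|].
  have : `|x.1 - y.1| <= 6 by rewrite ler_norml; lra.
  have : `|x.2 - y.2| <= 6 by rewrite ler_norml; lra.
  rewrite /=; lra.
- by move=> p /twin_map_half[].
- exact: twin_map_lipschitz.
- move=> y Py; have [h|h] := leP 0 (2 * y.1 + 3 * y.2).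
    by have [x Px <-] := twin_map_cover_half Py h; exists x => //; left.
  have [|x Px E] := twin_map_cover_half (opp _ Py); first by rewrite /=; lra.
  by exists x => //; right.
- exact: twin_glue_same.
- exact: twin_glue_opp.
- by rewrite /=; apply/eqP; lra.
- by apply/twin_hexagonP; split; rewrite /=; lra.
- by apply/twin_hexagonP; split; rewrite /=; lra.
Qed.
End TwinGlue.

(** * The hexagon of the tame twindragon *)

Section Tame.
Variable R : realType.

(** A fundamental domain, up to its boundary, of the lattice spanned by [(2, -6)] and [(10, -4)]:
    both have area 52. Opposite sides differ by these two vectors and by [(8, 2)]. *)
Definition tame_hexagon : seq (R * R * R) :=
  [:: (-1, 0, 5); (1, 0, 5); (0, -1, 3); (0, 1, 3); (-2, -1, 9); (2, 1, 9)].

Lemma tame_hexagonP (p : R * R) : polygon tame_hexagon p <->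
  [/\ -5 <= p.1 <= 5, -3 <= p.2 <= 3 & -9 <= 2 * p.1 + p.2 <= 9].
Proof.
rewrite /polygon /halfplane /=; split.
  by move=> /and5P[h1 h2 h3 h4 /and3P[h5 h6 _]]; split; apply/andP; split; lra.
move=> [/andP[h1 h2] /andP[h3 h4] /andP[h5 h6]].
by apply/and5P; split; try lra; apply/and3P; split => //; lra.
Qed.

(* Affine on the four triangles cut by the diagonals from the vertex (5, -1);
   the vertices (-3,-3), (5,-3), (5,-1), (3,3), (-5,3), (-5,1) go to
   (-3,3), (3,-3), (5,-3), (5,-1), (3,3), (1,3). *)
Definition tame_map (p : R * R) : R * R :=
  let: (x, y) := p in
  if 5 <= 2 * x + 5 * y then (x / 4 + y / 8 + 31 / 8, - x / 2 + y / 4 - 1 / 4)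
  else if 0 <= x + 5 * y then (3 / 5 * x + y + 3, - (3 / 5) * x)
  else if x - 4 * y <= 9 then (2 / 3 * x + 4 / 3 * y + 3, - (2 / 3) * x - y / 3)
  else (3 / 4 * x + y + 9 / 4, - (3 / 4) * x + 3 / 4).

Lemma tame_map_half p : polygon tame_hexagon p ->
  polygon tame_hexagon (tame_map p) /\ 0 <= (tame_map p).1 + (tame_map p).2.
Proof.
case: p => x y /tame_hexagonP[/andP[a1 a2] /andP[b1 b2] /andP[c1 c2]]; simpl in *.
rewrite tame_hexagonP /tame_map; case: ifP => h1; [|case: ifP => h2; [|case: ifP => h3]].
all: split; [split; simpl; apply/andP; split; lra | simpl; lra].
Qed.

Lemma tame_map_inj p q : polygon tame_hexagon p -> polygon tame_hexagon q ->
  tame_map p = tame_map q -> p = q.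
Proof.
case: p => x y /tame_hexagonP[/andP[a1 a2] /andP[b1 b2] /andP[c1 c2]]; simpl in *.
case: q => x' y' /tame_hexagonP[/andP[a1' a2'] /andP[b1' b2'] /andP[c1' c2']]; simpl in *.
rewrite /tame_map.
do 3 try case: ifP => ?; do 3 try case: ifP => ?; move=> [e1 e2]; congr pair; lra.
Qed.

Lemma tame_map_cover_half (y : R * R) : polygon tame_hexagon y -> 0 <= y.1 + y.2 ->
  exists2 x, polygon tame_hexagon x & tame_map x = y.
Proof.
case: y => X Y /tame_hexagonP[/andP[a1 a2] /andP[b1 b2] /andP[c1 c2]] half; simpl in *.
(* Again the lines separating the images of the triangles, here through [(5, -3)], the image of
   their common vertex. *)
have [k1|k1] := leP 12 (3 * X + Y); last have [k2|k2] := leP 9 (3 * X + 2 * Y);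
  last have [k3|k3] := leP 3 (3 * X + 4 * Y).
- exists (2 * X - Y - 8, 4 * X + 2 * Y - 15).
    by apply/tame_hexagonP; split => /=; apply/andP; split; lra.
  by rewrite /tame_map; do 3 try case: ifP => ?; congr pair; lra.
- exists (- (5 / 3) * Y, X - 3 + Y).
    by apply/tame_hexagonP; split => /=; apply/andP; split; lra.
  by rewrite /tame_map; do 3 try case: ifP => ?; congr pair; lra.
- exists (- X / 2 - 2 * Y + 3 / 2, X + Y - 3).
    by apply/tame_hexagonP; split => /=; apply/andP; split; lra.
  by rewrite /tame_map; do 3 try case: ifP => ?; congr pair; lra.
- exists (1 - 4 / 3 * Y, X + Y - 3).
    by apply/tame_hexagonP; split => /=; apply/andP; split; lra.
  by rewrite /tame_map; do 3 try case: ifP => ?; congr pair; lra.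
Qed.

(** The third piece sends [(0, 1)] to [(4/3, -1/3)], so a form other than the Euclidean one is
    needed: [5 x^2 + 6 x y + 8 y^2]. *)
Lemma tame_map_lipschitz (x y : R * R) : polygon tame_hexagon x -> polygon tame_hexagon y ->
  qnorm 5 3 8 (tame_map x - tame_map y) <= 97 / 100 * qnorm 5 3 8 (x - y).
Proof.
have a0 : 0 < 5 :> R by lra.
have ha : (3 : R) ^+ 2 < 5 * 8 by lra.
move: x y; apply: (lipschitz_split (l := (2, 5, -5))) => //; last first.
  apply: (lipschitz_split (l := (1, 5, 0))) => //; last first.
    apply: (lipschitz_split (l := (-1, 4, 9))) => //; last first.
      apply: (@affine_lipschitz _ _ _ _ _ (3/4) 1 (-(3/4)) 0 (9/4) (3/4)) => //; try lra.
      move=> [u w]; rewrite /polygon /halfplane /= => /and5P[g1 g2 g3 g4 /and5P[g5 g6 g7 g8 _]].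
      by rewrite /tame_map; do 3 try case: ifP => ?; congr pair; lra.
    apply: (@affine_lipschitz _ _ _ _ _ (2/3) (4/3) (-(2/3)) (-(1/3)) 3 0) => //; try lra.
    move=> [u w]; rewrite /polygon /halfplane /= => /and5P[g1 g2 g3 g4 /and5P[g5 g6 g7 g8 _]].
    by rewrite /tame_map; do 3 try case: ifP => ?; congr pair; lra.
  apply: (@affine_lipschitz _ _ _ _ _ (3/5) 1 (-(3/5)) 0 3 0) => //; try lra.
  move=> [u w]; rewrite /polygon /halfplane /= => /and5P[g1 g2 g3 g4 /and5P[g5 g6 g7 g8 _]].
  by rewrite /tame_map; do 3 try case: ifP => ?; congr pair; lra.
apply: (@affine_lipschitz _ _ _ _ _ (1/4) (1/8) (-(1/2)) (1/4) (31/8) (-(1/4))) => //; try lra.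
move=> [u w]; rewrite /polygon /halfplane /= => /and5P[g1 g2 g3 g4 /and4P[g5 g6 g7 _]].
by rewrite /tame_map; do 3 try case: ifP => ?; congr pair; lra.
Qed.
End Tame.

Section TameGlue.
Variable R : realType.
Implicit Types p : R * R.

(** The bottom side goes to the cut [x + y = 0]. The sides [x = -5] and [2 x + y = -9] share the top
    side as image, meeting at [(1, 3)]. *)
Lemma tame_map_edges p : polygon (tame_hexagon R) p ->
  [/\ p.2 = -3 -> tame_map p = (3 / 4 * p.1 - 3 / 4, 3 / 4 - 3 / 4 * p.1),
      p.1 = 5 -> tame_map p = (p.2 + 6, -3),
      2 * p.1 + p.2 = 9 -> tame_map p = (5, 2 - p.1),
      p.2 = 3 -> tame_map p = (p.1 / 4 + 17 / 4, (1 - p.1) / 2) &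
      p.1 = -5 -> tame_map p = (p.2, 3)] /\
  (2 * p.1 + p.2 = -9 -> tame_map p = (- 2 * p.1 - 9, 3)).
Proof.
case: p => x y /tame_hexagonP[/andP[a1 a2] /andP[b1 b2] /andP[c1 c2]]; simpl in *.
rewrite /tame_map.
by split; [split|] => E; do 3 try case: ifP => ?; congr pair; lra.
Qed.

Lemma tame_map_inv_edges p : polygon (tame_hexagon R) p ->
  let q := tame_map p in
  [/\ q.1 + q.2 = 0 -> p = (4 / 3 * q.1 + 1, -3),
      q.2 = -3 -> p = (5, q.1 - 6),
      q.1 = 5 -> p = (2 - q.2, 5 + 2 * q.2),
      2 * q.1 + q.2 = 9 -> p = (4 * q.1 - 17, 3) &
      q.2 = 3 -> 1 <= q.1 -> p = (-5, q.1)] /\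
  (q.2 = 3 -> q.1 <= 1 -> p = (- (q.1 + 9) / 2, q.1)).
Proof.
case: p => x y /tame_hexagonP[/andP[a1 a2] /andP[b1 b2] /andP[c1 c2]]; simpl in *.
rewrite /tame_map.
do 3 try case: ifP => ?; simpl; (split; [split|]) => *; congr pair; lra.
Qed.

Let e1 : R * R := (2, -6).
Let e2 : R * R := (10, -4).

Lemma tame_lattice_bound (n : int * int) (d : R * R) : d = lattice e1 e2 n ->
  -10 <= d.1 <= 10 -> -6 <= d.2 <= 6 -> -18 <= 2 * d.1 + d.2 <= 18 ->
  [/\ -10 <= 2 * n.1 + 10 * n.2 <= 10, -6 <= - 6 * n.1 - 4 * n.2 <= 6 &
     -18 <= - 2 * n.1 + 16 * n.2 <= 18].
Proof.
move=> -> /=; rewrite -!(ler_int R) !(intrD, intrM, intrN) /= => h1 h2 h3.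
by split; lra.
Qed.

Lemma tame_glue_same x x' m : polygon (tame_hexagon R) x -> polygon (tame_hexagon R) x' ->
  x - x' = lattice e1 e2 (quad_mul (-1) m) <->
  tame_map x - tame_map x' = lattice e1 e2 m.
Proof.
move=> Px Px'.
have [[_ ec _ _ ec'] _] := tame_map_edges Px.
have [[_ fc _ _ fc'] _] := tame_map_edges Px'.
have [[_ ic _ _ ic'] _] := tame_map_inv_edges Px.
have [[_ jc _ _ jc'] _] := tame_map_inv_edges Px'.
have [Qx Hx] := tame_map_half Px; have [Qx' Hx'] := tame_map_half Px'.
move/tame_hexagonP: (Px) => [/andP[a1 a2] /andP[a3 a4] /andP[a5 a6]].
move/tame_hexagonP: (Px') => [/andP[b1 b2] /andP[b3 b4] /andP[b5 b6]].
move/tame_hexagonP: Qx => [/andP[c1 c2] /andP[c3 c4] /andP[c5 c6]].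
move/tame_hexagonP: Qx' => [/andP[d1 d2] /andP[d3 d4] /andP[d5 d6]].
case: m => m1 m2; split => E.
{ have B := tame_lattice_bound E; have E1 := congr1 fst E; have E2 := congr1 snd E.
  rewrite /= in B E1 E2; clear E; case: B.
  1-3: by clear -a1 a2 a3 a4 a5 a6 b1 b2 b3 b4 b5 b6; lra.
  move=> h1 h2 h3.
  have [[F1 F2]|[[F1 F2]|[F1 F2]]] :
      (m1 = 0 /\ m2 = 0) \/ (m1 = 1 /\ m2 = 0) \/ (m1 = -1 /\ m2 = 0).
    by clear -h1 h2 h3; lia.
  all: rewrite F1 F2 /= in E1 E2 *.
  + have -> : x = x' by apply: injective_projections; clear -E1 E2; lra.
    by apply: injective_projections => /=; clear; lra.
  + rewrite (ec ltac:(clear -a2 b1 E1; lra)) (fc' ltac:(clear -a2 b1 E1; lra)).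
    by apply: injective_projections => /=; clear -E1 E2; lra.
  + rewrite (ec' ltac:(clear -a1 b2 E1; lra)) (fc ltac:(clear -a1 b2 E1; lra)).
    by apply: injective_projections => /=; clear -E1 E2; lra. }
have B := tame_lattice_bound E; have E1 := congr1 fst E; have E2 := congr1 snd E.
  rewrite /= in B E1 E2; clear E; case: B.
  1-3: by clear -c1 c2 c3 c4 c5 c6 d1 d2 d3 d4 d5 d6; lra.
  move=> h1 h2 h3.
  have H : (m1 = 0 /\ m2 = 0) \/ (m1 = 1 /\ m2 = 0) \/ (m1 = -1 /\ m2 = 0) \/
      (m1 = 0 /\ m2 = 1) \/ (m1 = 0 /\ m2 = -1) \/ (m1 = -1 /\ m2 = 1) \/
      (m1 = 1 /\ m2 = -1).
    by clear -h1 h2 h3; lia.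
  case: H => [[F1 F2]|[[F1 F2]|[[F1 F2]|[[F1 F2]|[[F1 F2]|[[F1 F2]|[F1 F2]]]]]]].
  all: rewrite F1 F2 /= in E1 E2 *.
  4-7: exfalso; have : (1 : R) <= 0 by clear -E1 E2 Hx Hx' c1 c2 c3 c4 c5 c6 d1 d2 d3 d4 d5 d6; lra.
  4-7: by rewrite ler10.
  + have -> : x = x'.
      by apply: tame_map_inj => //; apply: injective_projections; clear -E1 E2; lra.
    by apply: injective_projections => /=; clear; lra.
  + rewrite {1}(ic ltac:(clear -c3 d4 E2; lra)).
    rewrite {1}(jc' ltac:(clear -c3 d4 E2; lra) ltac:(clear -c3 d4 Hx E1 E2; lra)).
    by apply: injective_projections => /=; clear -E1 E2; lra.
  + rewrite {1}(ic' ltac:(clear -c4 d3 E2; lra) ltac:(clear -c4 d3 Hx' E1 E2; lra)).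
    rewrite {1}(jc ltac:(clear -c4 d3 E2; lra)).
    by apply: injective_projections => /=; clear -E1 E2; lra.
Qed.

Lemma tame_glue_opp x x' m : polygon (tame_hexagon R) x -> polygon (tame_hexagon R) x' ->
  x + x' = lattice e1 e2 ((1, 0) + quad_mul (-1) m) <->
  tame_map x + tame_map x' = lattice e1 e2 m.
Proof.
move=> Px Px'.
have [[ea _ eb ea' _] eb'] := tame_map_edges Px.
have [[fa _ fb fa' _] fb'] := tame_map_edges Px'.
have [[ia _ ib ia' _] ib'] := tame_map_inv_edges Px.
have [[ja _ jb ja' _] jb'] := tame_map_inv_edges Px'.
have [Qx Hx] := tame_map_half Px; have [Qx' Hx'] := tame_map_half Px'.
move/tame_hexagonP: (Px) => [/andP[a1 a2] /andP[a3 a4] /andP[a5 a6]].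
move/tame_hexagonP: (Px') => [/andP[b1 b2] /andP[b3 b4] /andP[b5 b6]].
move/tame_hexagonP: Qx => [/andP[c1 c2] /andP[c3 c4] /andP[c5 c6]].
move/tame_hexagonP: Qx' => [/andP[d1 d2] /andP[d3 d4] /andP[d5 d6]].
case: m => m1 m2; split => E.
{ have B := tame_lattice_bound E; have E1 := congr1 fst E; have E2 := congr1 snd E.
  rewrite /= in B E1 E2; clear E; case: B.
  1-3: by clear -a1 a2 a3 a4 a5 a6 b1 b2 b3 b4 b5 b6; lra.
  move=> h1 h2 h3.
  have H : (m1 = 0 /\ m2 = 0) \/ (m1 = -1 /\ m2 = 1) \/ (m1 = 0 /\ m2 = 1) \/
      (m1 = -1 /\ m2 = 0).
    by clear -h1 h2 h3; lia.
  case: H => [[F1 F2]|[[F1 F2]|[[F1 F2]|[F1 F2]]]]; rewrite F1 F2 /= in E1 E2 *.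
  + rewrite (ea ltac:(clear -a3 b3 E2; lra)) (fa ltac:(clear -a3 b3 E2; lra)).
    by apply: injective_projections => /=; clear -E1 E2; lra.
  + rewrite (ea' ltac:(clear -a4 b4 E2; lra)) (fa' ltac:(clear -a4 b4 E2; lra)).
    by apply: injective_projections => /=; clear -E1 E2; lra.
  + rewrite (eb ltac:(clear -a6 b6 E1 E2; lra)) (fb ltac:(clear -a6 b6 E1 E2; lra)).
    by apply: injective_projections => /=; clear -E1 E2; lra.
  + rewrite (eb' ltac:(clear -a5 b5 E1 E2; lra)) (fb' ltac:(clear -a5 b5 E1 E2; lra)).
    by apply: injective_projections => /=; clear -E1 E2; lra. }
have B := tame_lattice_bound E; have E1 := congr1 fst E; have E2 := congr1 snd E.
  rewrite /= in B E1 E2; clear E; case: B.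
  1-3: by clear -c1 c2 c3 c4 c5 c6 d1 d2 d3 d4 d5 d6; lra.
  move=> h1 h2 h3.
  have H : (m1 = 0 /\ m2 = 0) \/ (m1 = -1 /\ m2 = 1) \/ (m1 = 0 /\ m2 = 1) \/
      (m1 = -1 /\ m2 = 0) \/ (m1 = 1 /\ m2 = 0) \/ (m1 = 0 /\ m2 = -1) \/
      (m1 = 1 /\ m2 = -1).
    by clear -h1 h2 h3; lia.
  case: H => [[F1 F2]|[[F1 F2]|[[F1 F2]|[[F1 F2]|[[F1 F2]|[[F1 F2]|[F1 F2]]]]]]].
  all: rewrite F1 F2 /= in E1 E2 *.
  5-7: exfalso; have : (1 : R) <= 0 by clear -E1 E2 Hx Hx'; lra.
  5-7: by rewrite ler10.
  + rewrite {1}(ia ltac:(clear -Hx Hx' E1 E2; lra)) {1}(ja ltac:(clear -Hx Hx' E1 E2; lra)).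
    by apply: injective_projections => /=; clear -E1 E2; lra.
  + rewrite {1}(ia' ltac:(clear -c6 d6 E1 E2; lra)) {1}(ja' ltac:(clear -c6 d6 E1 E2; lra)).
    by apply: injective_projections => /=; clear -E1 E2; lra.
  + rewrite {1}(ib ltac:(clear -c2 d2 E1; lra)).
    rewrite {1}(jb ltac:(clear -c2 d2 E1; lra)).
    by apply: injective_projections => /=; clear -E1 E2; lra.
  + rewrite {1}(ib' ltac:(clear -c4 d4 E2; lra) ltac:(clear -c4 d4 Hx' E1 E2; lra)).
    rewrite {1}(jb' ltac:(clear -c4 d4 E2; lra) ltac:(clear -c4 d4 Hx E1 E2; lra)).
    by apply: injective_projections => /=; clear -E1 E2; lra.
Qed.

Lemma tame_ifs : hexagon_ifs (-1) 0 5 3 8 (97 / 100) 3 48 (tame_hexagon R) e1 e2 (@tame_map R).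
Proof.
have opp p : polygon (tame_hexagon R) p -> polygon (tame_hexagon R) (- p).
  move=> /tame_hexagonP[/andP[a1 a2] /andP[a3 a4] /andP[a5 a6]]; apply/tame_hexagonP.
  by split; apply/andP; split; rewrite /=; lra.
split; [lra|lra|lra|lra|lra| |lra|lra|lra|..].
- by rewrite ger0_norm; lra.
- exact: opp.
- move=> x y /tame_hexagonP[/andP[a1 a2] /andP[a3 a4] _] /tame_hexagonP[/andP[b1 b2] /andP[b3 b4] _].
  have h5 : `|3 : R| <= 3 ^+ 2 by rewrite ger0_norm; lra.
  apply: (le_trans (qnorm_le_norm _ _ (k := 3) _ _ h5 _ _)); [lra|lra|lra|lra|lra|].
  have : `|x.1 - y.1| <= 10 by rewrite ler_norml; lra.
  have : `|x.2 - y.2| <= 6 by rewrite ler_norml; lra.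
  rewrite /=; lra.
- by move=> p /tame_map_half[].
- exact: tame_map_lipschitz.
- move=> y Py; have [h|h] := leP 0 (y.1 + y.2).
    by have [x Px <-] := tame_map_cover_half Py h; exists x => //; left.
  have [|x Px E] := tame_map_cover_half (opp _ Py); first by rewrite /=; lra.
  by exists x => //; right.
- exact: tame_glue_same.
- exact: tame_glue_opp.
- by rewrite /=; apply/eqP; lra.
- by apply/tame_hexagonP; split; rewrite /=; lra.
- by apply/tame_hexagonP; split; rewrite /=; lra.
Qed.
End TameGlue.

(** * Gauges of the models *)

(** Minkowski functional of the hexagon cut out by three strips centered at the origin. *)
Definition gauge (R : realType) (r1 r2 r3 u : R) (p : R * R) : R :=
  Num.max (Num.max (`|p.1| / r1) (`|p.2| / r2)) (`|u * p.1 + p.2| / r3).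

Section Gauge.
Variables (R : realType) (r1 r2 r3 u : R).
Hypotheses (r1_gt0 : 0 < r1) (r2_gt0 : 0 < r2) (r3_gt0 : 0 < r3).

Lemma gauge_continuous : continuous (gauge r1 r2 r3 u).
Proof.
have h1 : continuous (fun q : R * R => q.1) by move=> p; exact: cvg_fst.
have h2 : continuous (fun q : R * R => q.2) by move=> p; exact: cvg_snd.
have c1 : continuous (fun q : R * R => `|q.1| / r1).
  by move=> p; apply: cvgM; [apply: cvg_norm; exact: h1|exact: cvg_cst].
have c2 : continuous (fun q : R * R => `|q.2| / r2).
  by move=> p; apply: cvgM; [apply: cvg_norm; exact: h2|exact: cvg_cst].
have c3 : continuous (fun q : R * R => `|u * q.1 + q.2| / r3).
  move=> p; apply: cvgM; last exact: cvg_cst.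
  by apply: cvg_norm; apply: cvgD; [apply: cvgM; [exact: cvg_cst|exact: h1]|exact: h2].
exact: (max_fun_continuous (max_fun_continuous c1 c2) c3).
Qed.

Lemma gauge_homog t p : 0 <= t -> gauge r1 r2 r3 u (t * p.1, t * p.2) = t * gauge r1 r2 r3 u p.
Proof.
move=> t0; rewrite /gauge /=.
have -> : u * (t * p.1) + t * p.2 = t * (u * p.1 + p.2) by ring.
by rewrite !normrM (ger0_norm t0) !maxr_pMr // !mulrA.
Qed.

Lemma gauge_ge_norm (p : R * R) : `|p.1| <= r1 * gauge r1 r2 r3 u p /\
  `|p.2| <= r2 * gauge r1 r2 r3 u p.
Proof. by split; rewrite mulrC -ler_pdivrMr // !le_max lexx ?orbT. Qed.

Lemma gauge_gt0 p : p != 0 -> 0 < gauge r1 r2 r3 u p.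
Proof.
move=> p0; rewrite ltNge; apply: contra p0 => g0.
have [h1 h2] := gauge_ge_norm p.
have e1 : p.1 = 0.
  by apply/eqP; rewrite -normr_le0; apply: le_trans h1 _; rewrite pmulr_rle0.
have e2 : p.2 = 0.
  by apply/eqP; rewrite -normr_le0; apply: le_trans h2 _; rewrite pmulr_rle0.
by apply/eqP; apply: injective_projections.
Qed.

Lemma gauge_le1 p : gauge r1 r2 r3 u p <= 1 <->
  [/\ `|p.1| <= r1, `|p.2| <= r2 & `|u * p.1 + p.2| <= r3].
Proof.
rewrite /gauge !ge_max !ler_pdivrMr // !mul1r; split.
  by move=> /andP[/andP[]].
by case=> -> -> ->.
Qed.
End Gauge.

Definition quad_bounded (b : int) (u w : nat -> bool) : Prop := exists k, forall n,
  (absz (digit_diff (quad_mul b) (1%:Z, 0%:Z) u w n).1 <= k)%N /\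
  (absz (digit_diff (quad_mul b) (1%:Z, 0%:Z) u w n).2 <= k)%N.

Lemma lattice_size_bounded t (z : nat -> int * int) :
  (exists k, forall n, (lattice_size t (z n) <= k)%N) <->
  (exists k, forall n, (absz (z n).1 <= k)%N /\ (absz (z n).2 <= k)%N).
Proof.
split=> [[k hk]|[k hk]].
  exists (k + absz t * k)%N => n; move: (hk n); rewrite /lattice_size => h.
  have h2 : (absz (z n).2 <= k)%N by apply: leq_trans h; rewrite leq_addl.
  have h1 : (absz ((z n).1 + t * (z n).2)%R <= k)%N by apply: leq_trans h; rewrite leq_addr.
  split; last by apply: leq_trans h2 _; rewrite leq_addr.
  have -> : (z n).1 = ((z n).1 + t * (z n).2) + - (t * (z n).2) by rewrite addrK.
  by apply: leq_trans (absz_add _ _) _; rewrite abszN abszM leq_add // leq_mul.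
exists (k + absz t * k + k)%N => n; case: (hk n) => h1 h2.
rewrite /lattice_size leq_add //; apply: leq_trans (absz_add _ _) _.
by rewrite abszM leq_add // leq_mul.
Qed.

Theorem quad_model (R : realType) (b : int) : (absz b == 1)%N || (absz b == 2)%N ->
  exists (H : R * R -> R) (phi : (nat -> bool) -> R * R),
  [/\ continuous H, forall t p, 0 <= t -> H (t * p.1, t * p.2) = t * H p,
      forall p, p != 0 -> 0 < H p &
  [/\ cylinder_continuous (fun a => (phi a).1), cylinder_continuous (fun a => (phi a).2),
      forall a, H (phi a) <= 1, forall x, H x <= 1 -> exists a, phi a = x &
      forall u w, phi u = phi w <-> quad_bounded b u w]].
Proof.
have main (r1 r2 r3 v : R) s t a h c C K Delta (e1 e2 : R * R) F : 0 < r1 -> 0 < r2 -> 0 < r3 ->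
  (forall p, polygon s p <-> [/\ `|p.1| <= r1, `|p.2| <= r2 & `|v * p.1 + p.2| <= r3]) ->
  hexagon_ifs b t a h c K C Delta s e1 e2 F ->
  exists (H : R * R -> R) (phi : (nat -> bool) -> R * R),
  [/\ continuous H, forall t p, 0 <= t -> H (t * p.1, t * p.2) = t * H p,
      forall p, p != 0 -> 0 < H p &
  [/\ cylinder_continuous (fun a => (phi a).1), cylinder_continuous (fun a => (phi a).2),
      forall a, H (phi a) <= 1, forall x, H x <= 1 -> exists a, phi a = x &
      forall u w, phi u = phi w <-> quad_bounded b u w]].
  move=> h1 h2 h3 sE /hexagon_model[phi [k1 k2 k3 k4 k5]].
  have PE p : gauge r1 r2 r3 v p <= 1 <-> polygon s p by rewrite gauge_le1 // sE.
  exists (gauge r1 r2 r3 v), phi; split.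
  - exact: gauge_continuous.
  - by move=> t' p; exact: gauge_homog.
  - by move=> p; exact: gauge_gt0.
  - split => //.
    + by move=> a'; apply/PE.
    + by move=> x /PE; exact: k4.
    + by move=> u w; rewrite k5; exact: lattice_size_bounded.
have twinE (p : R * R) : polygon (twin_hexagon R) p <->
    [/\ `|p.1| <= 3, `|p.2| <= 3 & `|1 * p.1 + p.2| <= 4].
  by rewrite twin_hexagonP mul1r !ler_norml.
have tameE (p : R * R) : polygon (tame_hexagon R) p <->
    [/\ `|p.1| <= 5, `|p.2| <= 3 & `|2 * p.1 + p.2| <= 9].
  by rewrite tame_hexagonP !ler_norml.
move=> hb.
(* The hexagons were built for negative [b]; conjugation supplies the positive values. *)
have : b = 1 \/ b = -1 \/ b = 2 \/ b = -2 by lia.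
case=> [E|[E|[E|E]]]; subst b.
- by apply: (main _ _ _ _ _ _ _ _ _ _ _ _ _ _ _ _ _ _ tameE (hexagon_ifs_opp (tame_ifs R))); lra.
- by apply: (main _ _ _ _ _ _ _ _ _ _ _ _ _ _ _ _ _ _ tameE (tame_ifs R)); lra.
- by apply: (main _ _ _ _ _ _ _ _ _ _ _ _ _ _ _ _ _ _ twinE (hexagon_ifs_opp (twin_ifs R))); lra.
- by apply: (main _ _ _ _ _ _ _ _ _ _ _ _ _ _ _ _ _ _ twinE (twin_ifs R)); lra.
Qed.

(** * The interval model for multiplication by 2 or -2 *)

Definition int_scale (c m : int) : int := c * m.
Lemma int_scale_additive c : zmod_morphism (int_scale c).
Proof. by move=> m n; rewrite /int_scale mulrBr. Qed.
HB.instance Definition _ c := GRing.isZmodMorphism.Build _ _ (int_scale c) (int_scale_additive c).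

(** The interval [[-1, 1]] tiles the line by even translations; it is placed on the first axis so
    that the planar model applies. *)
Definition even_lattice (R : realType) (m : int) : R * R := (2 * m%:~R, 0).
Lemma even_lattice_additive (R : realType) : zmod_morphism (@even_lattice R).
Proof.
by move=> m n; rewrite /even_lattice intrB mulrBr; apply: injective_projections => //=; rewrite subr0.
Qed.
HB.instance Definition _ (R : realType) :=
  GRing.isZmodMorphism.Build _ _ (@even_lattice R) (@even_lattice_additive R).

Theorem interval_model (R : realType) (c : int) : absz c = 2%N ->
  exists phi : (nat -> bool) -> R,
  [/\ cylinder_continuous phi, forall a, `|phi a| <= 1,
      forall x, `|x| <= 1 -> exists a, phi a = x &
      forall u w, phi u = phi w <->
        exists k, forall n, (absz (digit_diff (int_scale c) 1%:Z u w n) <= k)%N].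
Proof.
move=> hc; have c2 : c = 2 \/ c = -2 by lia.
clear hc.
have nc : `|c%:~R| = 2 :> R by case: c2 => ->; rewrite ?intrN ?normrN normr_nat.
have c0 : c%:~R != 0 :> R by rewrite -normr_gt0 nc.
(* The digits are centered at [-1] and [1], which keeps the interval symmetric and treats both signs
   of [c] alike; the second coordinate is halved only to make the map a contraction of the plane. *)
pose F (i : bool) (x : R * R) := ((x.1 + (2 * i%:R - 1)) / c%:~R, x.2 / 2).
pose P := [set p : R * R | `|p.1| <= 1 /\ p.2 = 0].
pose N (p : R * R) := `|p.1| + `|p.2|.
have N_tri (x y z : R * R) : N (x - z) <= N (x - y) + N (y - z).
  rewrite /N addrACA; apply: lerD; [rewrite -[(x - z).1](subrKA y.1)|rewrite -[(x - z).2](subrKA y.2)];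
  exact: ler_normD.
have hX (x : R * R) : P x -> `|x.1| <= 1 by case.
have P0 : P (0, 0) by split => //=; rewrite normr0.
have [phi [h1 h2 h3 h4 h5]] : exists phi : (nat -> bool) -> R * R,
  [/\ cylinder_continuous (fun a => (phi a).1), cylinder_continuous (fun a => (phi a).2),
      forall a, P (phi a), forall x, P x -> exists a, phi a = x &
      forall a b, phi a = phi b <->
        exists k, forall n, (absz (digit_diff (int_scale c) 1%:Z a b n) <= k)%N].
  apply: (@model_address R int (int_scale c) 1%:Z (@even_lattice R) absz N 1 1 2 (1/2) P F (0, 0)) => //.
  - by move=> x; rewrite !mul1r /N; split; [rewrite lerDl|rewrite lerDr].
  - by move=> x; rewrite mul1r.
  - lra.
  - have -> : P = polygon [:: (-1, 0, 1); (1, 0, 1); (0, -1, 0); (0, 1, 0)].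
      apply/seteqP; split=> p; rewrite /P /polygon /halfplane /= ler_norml.
        by move=> [/andP[g1 g2] g3]; apply/and5P; split=> //; lra.
      move=> /and5P[g1 g2 g3 g4 _]; split; first by apply/andP; split; lra.
      by apply/eqP; rewrite eq_le; apply/andP; split; lra.
    exact: polygon_closed.
  - move=> x y [x1 x2] [y1 y2]; rewrite /N /= x2 y2 subrr normr0 addr0.
    by apply: le_trans (ler_normB _ _) _; lra.
  - move=> i x [x1 x2]; split; rewrite /F /=; last by rewrite x2 mul0r.
    rewrite normrM normfV nc ler_pdivrMr // mul1r; apply: le_trans (ler_normD _ _) _.
    have : `|2 * i%:R - 1 : R| <= 1.
      have [->|->] : i%:R = 1 :> R \/ i%:R = 0 :> R by case: i; [left|right].
        by rewrite ler_norml; clear; lra.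
      by rewrite ler_norml; clear; lra.
    by clear -x1; lra.
  - move=> i x y Px Py; rewrite /N /F /=.
    have -> : (x.1 + (2 * i%:R - 1)) / c%:~R - (y.1 + (2 * i%:R - 1)) / c%:~R = (x.1 - y.1) / c%:~R.
      by field.
    have -> : x.2 / 2 - y.2 / 2 = (x.2 - y.2) / 2 by field.
    by rewrite !normrM !normfV nc normr_nat; lra.
  - move=> y [y1 y2]; pose z : R := c%:~R * y.1; pose i := 0 <= z.
    exists i, (z - (2 * i%:R - 1), 0); split.
      split => //=; have : `|z| <= 2 by rewrite normrM nc; clear -y1; lra.
      by rewrite /i; case: (leP 0 z) => h; rewrite !ler_norml /= ?mulr1 ?mulr0 => /andP[g1 g2];
        clear -h g1 g2; lra.
    by rewrite /F /= subrK mulrC mulKf // mul0r -y2 -surjective_pairing.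
  - move=> i j x x' m Px Px'.
    have castE (k : bool) (n : int) : (1%:Z *+ k + n)%:~R = k%:R + n%:~R :> R.
      by rewrite intrD; case: k.
    have cast0 (k : bool) : (1%:Z *+ k)%:~R = k%:R :> R by case: k.
    split=> E; have E1 := congr1 fst E; have E2 := congr1 snd E; clear E;
      rewrite /= ?castE ?cast0 /int_scale ?intrM in E1 E2;
      apply: injective_projections; rewrite /= ?castE ?cast0 /int_scale ?intrM.
    - have -> : x.1 + (2 * i%:R - 1) = x'.1 + (2 * j%:R - 1) + 2 * m%:~R * c%:~R.
        by clear -E1; lra.
      by rewrite mulrDl mulfK.
    - by clear -E2; lra.
    - have E3 := congr1 (fun z => z * c%:~R) E1; rewrite /= divfK // [in RHS]mulrDl divfK // in E3.
      by clear -E3; lra.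
    - by clear -E2; lra.
  - move=> n; have [i [q ->]] := int_parity n.
    have -> : (i : nat)%:Z = 1%:Z *+ i by case: (i).
    (* [int_parity] produces [- 2 * q], so the quotient by [c] changes sign when [c = 2]. *)
    case: c2 => E; [exists i, (- q)|exists i, q]; congr (_ + _); rewrite E /= /int_scale.
      by rewrite mulrN.
    by rewrite mulNr.
  - by move=> n /eqP; rewrite absz_eq0 => /eqP.
  - move=> n k E; exists (Num.sg n).
    have n0 : n != 0 by rewrite -absz_gt0 E.
    split; first by rewrite -ltnS absz_sub_sg // E.
    by case: (sgz_or n0) => ->; [exists (1, 0), (-1, 0)|exists (-1, 0), (1, 0)];
      split; rewrite /P /= ?normrN ?normr1 //; apply: injective_projections => /=; clear; lra.
  - move=> C; have [k hk] := int_bounded C; exists k => n g1 _; apply: hk.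
    apply: le_trans g1; rewrite /= normrM normr_nat; have := normr_ge0 (n%:~R : R); lra.
exists (fun a => (phi a).1); split => //.
- by move=> a; case: (h3 a).
- by move=> x hx; have [|a E] := h4 (x, 0); [split|exists a; rewrite E].
- move=> u w; rewrite -h5; split=> [E|->//]; apply: injective_projections => //.
  by have [_ ->] := h3 u; have [_ ->] := h3 w.
Qed.

(** * Quotients of the Cantor space and radial maps *)

(** A continuous map from a compact space to a Hausdorff one is closed, and on the range of [p] the
    preimage of [C] under [f] is the image under [p] of the preimage under [q]. *)
Lemma quotient_continuous (X T U : topologicalType) (p : X -> T) (q : X -> U) (f : T -> U) :
  compact [set: X] -> hausdorff_space T -> continuous p -> continuous q ->
  (forall x, f (p x) = q x) -> {within range p, continuous f}.
Proof.
move=> cX hT cp cq fE; apply/continuous_closedP => C cC; apply/closed_subspaceP.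
exists (p @` (q @^-1` C)).
  apply: compact_closed => //; apply: continuous_compact.
    exact: continuous_subspaceT.
  apply: (@subclosed_compact _ _ [set: X]) => //.
  by move/continuous_closedP: cq; exact.
apply/seteqP; split => t [].
  move=> [x Cx <-] _; split; last by exists x.
  by change (C (f (p x))); rewrite fE.
move=> Ct [x _ E]; split; last by exists x.
exists x => //; change (C (q x)); rewrite -fE E; exact: Ct.
Qed.

Lemma quotient_homeomorphic (X : topologicalType) (T U : ptopologicalType)
    (p : X -> T) (q : X -> U) :
  compact [set: X] -> hausdorff_space T -> hausdorff_space U ->
  continuous p -> continuous q -> (forall x y, p x = p y <-> q x = q y) ->
  homeomorphic (range p) (range q).
Proof.
move=> cX hT hU cp cq ker.
have /choice[f fP] : forall t, exists u, forall x, p x = t -> u = q x.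
  move=> t; have [[x E]|N] := pselect (exists x, p x = t).
    by exists (q x) => y Ey; apply/ker; rewrite E Ey.
  by exists point => x E; case: N; exists x.
have /choice[g gP] : forall u, exists t, forall x, q x = u -> t = p x.
  move=> u; have [[x E]|N] := pselect (exists x, q x = u).
    by exists (p x) => y Ey; apply/ker; rewrite E Ey.
  by exists point => x E; case: N; exists x.
have fE x : f (p x) = q x by exact: fP.
have gE x : g (q x) = p x by exact: gP.
exists f, g; split.
- by split; [exact: (quotient_continuous cX hT cp cq)|exact: (quotient_continuous cX hU cq cp)].
- by move=> _ [x _ <-]; exists x.
- by move=> _ [x _ <-]; exists x.
- by move=> _ [x _ <-]; rewrite fE gE.
- by move=> _ [x _ <-]; rewrite gE fE.
Qed.

Lemma near_cylinder (n : nat) (a : cantor_space) :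
  \forall b \near a, forall k, (k < n)%N -> a k = b k.
Proof.
elim: n => [|n IH]; first by near=> b.
have h : \forall b \near a, a n = b n.
  have /= := @proj_continuous nat (fun _ => bool) n a.
  move=> /(_ [set a n]) H.
  have /H : nbhs (a n) [set a n] by rewrite nbhs_principalE; exact/principal_filterP.
  by apply: filterS => b /= <-.
near=> b => k; rewrite ltnS leq_eqVlt => /orP[/eqP ->|].
  by near: b.
by move: k; near: b.
Unshelve. all: by end_near.
Qed.

Lemma cylinder_continuousT (R : realType) (f : cantor_space -> R) :
  cylinder_continuous f -> continuous f.
Proof.
move=> cf a; apply/cvgrPdist_lt => e e0; have [n hn] := cf e e0.
by apply: filterS (near_cylinder n a) => b; exact: hn.
Qed.

Lemma cvg_mx (R : realType) (T : Type) (F : set_system T) (m n : nat)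
    (f : T -> 'M[R]_(m, n)) (M : 'M[R]_(m, n)) : Filter F ->
  (forall i j, (fun t => f t i j) @ F --> M i j) -> f @ F --> M.
Proof.
move=> FF h; apply/cvg_ballP => e e0.
have : \forall t \near F, forall ij : 'I_m * 'I_n, ball (M ij.1 ij.2) e (f t ij.1 ij.2).
  by apply: filter_forall => -[i j]; have /cvg_ballP/(_ _ e0) := h i j.
by apply: filterS => t ht; split => // i j; exact: (ht (i, j)).
Qed.

Section Radial.
Variables (R : realType) (V : normedModType R) (N1 N2 : V -> R) (C : R).
Hypotheses (N1_cont : continuous N1) (N2_cont : continuous N2).
Hypotheses (N1_homog : forall t x, 0 <= t -> N1 (t *: x) = t * N1 x).
Hypotheses (N2_homog : forall t x, 0 <= t -> N2 (t *: x) = t * N2 x).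
Hypotheses (N1_gt0 : forall x, x != 0 -> 0 < N1 x).
Hypotheses (N2_gt0 : forall x, x != 0 -> 0 < N2 x).
Hypothesis N2_bound : forall x, `|x| <= C * N2 x.

(** Rescales every ray so that [N2] of the image is [N1] of the point; at the origin the quotient
    [0 / 0] only multiplies the zero vector. *)
Definition radial (x : V) : V := (N1 x / N2 x) *: x.

Let N1_0 : N1 0 = 0. Proof. by rewrite -(scale0r 0) N1_homog // mul0r. Qed.
Let N2_0 : N2 0 = 0. Proof. by rewrite -(scale0r 0) N2_homog // mul0r. Qed.

Lemma N2_radial x : N2 (radial x) = N1 x.
Proof.
have [->|x0] := eqVneq x 0; first by rewrite /radial scaler0 N1_0 N2_0.
rewrite N2_homog; last by rewrite divr_ge0 // ltW // ?N1_gt0 ?N2_gt0.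
by rewrite divfK // gt_eqF // N2_gt0.
Qed.

Lemma radial_inj : injective radial.
Proof.
have radial0 x : radial x = 0 -> x = 0.
  move=> E; apply/eqP; apply/negP => /negP x0.
  by have := N1_gt0 x0; rewrite -N2_radial E N2_0 ltxx.
move=> x y E; have [x0|x0] := eqVneq x 0.
  by rewrite x0; apply/esym/radial0; rewrite -E x0 /radial scaler0.
have [y0|y0] := eqVneq y 0.
  by rewrite y0; apply/radial0; rewrite E y0 /radial scaler0.
have N1E : N1 x = N1 y by rewrite -!N2_radial E.
have n1 := N1_gt0 x0; have m1 := N2_gt0 x0; have m2 := N2_gt0 y0.
have xE : x = (N2 x / N2 y) *: y.
  have H : x = (N2 x / N1 x) *: radial x.
    by rewrite /radial scalerA mulrA divfK ?gt_eqF // divff ?gt_eqF // scale1r.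
  by rewrite {1}H E /radial scalerA N1E mulrA divfK // -N1E gt_eqF.
have : N1 x = N2 x / N2 y * N1 y by rewrite {1}xE N1_homog // divr_ge0 // ltW.
rewrite -N1E -{1}[N1 x]mul1r => /(mulIf (lt0r_neq0 n1)) H.
by rewrite xE -H scale1r.
Qed.

Lemma radial_surj y : exists x, radial x = y.
Proof.
have [->|y0] := eqVneq y 0; first by exists 0; rewrite /radial scaler0.
have n1 := N1_gt0 y0; have n2 := N2_gt0 y0.
exists ((N2 y / N1 y) *: y); rewrite /radial N1_homog ?N2_homog ?divr_ge0 ?ltW //.
rewrite divfK ?gt_eqF // scalerA.
have -> : N2 y / (N2 y / N1 y * N2 y) * (N2 y / N1 y) = 1; last by rewrite scale1r.
by field; rewrite !gt_eqF.
Qed.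

(** At the origin the quotient need not converge, but [N2_bound] and [N2_radial] bound the image by
    a multiple of [N1], which tends to 0. *)
Lemma radial_continuous : continuous radial.
Proof.
move=> x; have [->|x0] := eqVneq x 0; last first.
  apply: cvgZ; last exact: cvg_id.
  apply: cvgM; first exact: N1_cont.
  by apply: cvgV; [rewrite gt_eqF // N2_gt0|exact: N2_cont].
rewrite /continuous_at {2}/radial scaler0; apply/cvgr0Pnorm_le => e e0.
have hC : (fun y => `|C| * `|N1 y|) @ (0 : V) --> (0 : R).
  rewrite -(mulr0 `|C|); apply: cvgM; first exact: cvg_cst.
  have h := cvg_norm (N1_cont (x := 0)); rewrite N1_0 normr0 in h; exact: h.
have /cvgr0Pnorm_le /(_ e e0) := hC.
apply: filterS => y; rewrite normrM !normr_id => hy.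
have [->|y0] := eqVneq y 0; first by rewrite /radial scaler0 normr0 ltW.
apply: le_trans (N2_bound _) _; rewrite N2_radial; apply: le_trans hy.
apply: le_trans (ler_norm _) _; by rewrite normrM.
Qed.
End Radial.

(** * Characteristic polynomials of isotropic matrices *)

Lemma size_prod_1subX (C : idomainType) (s : seq C) :
  (size (\prod_(a <- s) (1 - a *: 'X))%R <= (size s).+1)%N.
Proof.
elim: s => [|a s IH]; first by rewrite big_nil size_poly1.
rewrite big_cons; apply: leq_trans (size_polyMleq _ _) _.
have h : (size (1 - a *: 'X : {poly C})%R <= 2)%N.
  apply: leq_trans (size_polyD _ _) _; rewrite size_poly1 size_polyN geq_max /=.
  by apply: leq_trans (size_scale_leq _ _) _; rewrite size_polyX.
by rewrite -subn1 leq_subLR; apply: leq_trans (leq_add h IH) _.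
Qed.

(** [\prod (1 - a X)] is the reciprocal polynomial of [\prod (X - a)]. *)
Lemma coef_prod_1subX (C : idomainType) (s : seq C) j : (j <= size s)%N ->
  (\prod_(a <- s) (1 - a *: 'X))`_j = (\prod_(a <- s) ('X - a%:P))`_(size s - j).
Proof.
elim: s j => [|a s IH] j; first by rewrite leqn0 => /eqP ->; rewrite !big_nil.
rewrite !big_cons mulrBl mul1r coefB -scalerAl coefZ coefXM.
set Q := \prod_(_ <- _) _; set P := \prod_(_ <- _) _.
have szP : size P = (size s).+1 by rewrite size_prod_XsubC.
rewrite mulrBl coefB coefXM mul_polyC coefZ => js.
case: j js => [|j] js.
  rewrite /= mulr0 subr0 IH // subn0 [P`_(size s).+1]nth_default ?szP //.
  by rewrite mulr0 subr0.
rewrite /= subSS [Q`_j]IH //.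
have [jn|jn] := ltnP j (size s).
  by rewrite IH // subnS; case: (size s - j)%N (subn_gt0 j (size s)) => [|k] //=; rewrite jn.
have -> : j = size s by apply/eqP; rewrite eqn_leq jn andbT.
by rewrite subnn /= [Q`_(size s).+1]nth_default ?size_prod_1subX.
Qed.

Section Reciprocal.
Variables (C : numClosedFieldType) (n : nat) (lam : 'I_n -> C) (t : C).
Hypothesis lam_norm : forall i, lam i * (lam i)^* = t.
Let p := \prod_(i < n) ('X - (lam i)%:P).
Hypothesis p_real : map_poly Num.conj p = p.

(* [lam |-> t / lam] is complex conjugation on the roots of [p]. *)
Lemma coef_reciprocal j : (j <= n)%N -> p`_j * t ^+ j = p`_0 * p`_(n - j).
Proof.
move=> jn.
have p0E : p`_0 = \prod_(i < n) - lam i.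
  rewrite -horner_coef0 /p horner_prod; apply: eq_bigr => i _.
  by rewrite hornerXsubC sub0r.
(* Factor by factor: [t = lam * conj lam] turns [t X - lam] into [- lam * (1 - conj lam X)]. *)
have scaleE : p \Po (t *: 'X) = p`_0 *: \prod_(a <- [seq (lam i)^* | i : 'I_n]) (1 - a *: 'X).
  rewrite /p (rmorph_prod (comp_poly (t *: 'X))) p0E big_map big_enum /=.
  rewrite -[RHS]mul_polyC (rmorph_prod (@polyC C)) -big_split /=; apply: eq_bigr => i _.
  rewrite rmorphB /= comp_polyX comp_polyC -(lam_norm i) mulrBr mulr1 polyCN.
  by rewrite mulNr opprK mul_polyC scalerA addrC.
have := congr1 (fun q : {poly C} => q`_j) scaleE.
have szs : size [seq (lam i)^* | i : 'I_n] = n by rewrite size_image card_ord.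
rewrite coefZ coef_prod_1subX szs //.
have -> : \prod_(a <- [seq (lam i)^* | i : 'I_n]) ('X - a%:P) = p.
  rewrite -[RHS]p_real /p rmorph_prod big_map big_enum /=; apply: eq_bigr => i _.
  by rewrite rmorphB /= map_polyX map_polyC.
move=> <-; have szp : size p = n.+1 by rewrite size_prod_XsubC /index_enum -enumT size_enum_ord.
rewrite coef_comp_poly szp (bigD1 (Ordinal (jn : j < n.+1)%N)) //= exprZn coefZ coefXn eqxx mulr1.
rewrite big1 ?addr0 // => i; rewrite -val_eqE /= => ij.
by rewrite exprZn coefZ coefXn eq_sym (negPf ij) mulr0 mulr0.
Qed.
End Reciprocal.

Lemma char_poly_conj (F : fieldType) n (A D V : 'M[F]_n) : V \in unitmx ->
  V *m A = D *m V -> char_poly A = char_poly D.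
Proof.
move=> Vu E; have dV : \det (map_mx (@polyC F) V) != 0.
  by rewrite det_map_mx polyC_eq0 -unitfE -unitmxE.
apply: (mulfI dV); rewrite /char_poly -det_mulmx [RHS]mulrC -det_mulmx; congr (\det _).
rewrite /char_poly_mx mulmxBr mulmxBl -!map_mxM E; congr (_ - _).
by rewrite -scalar_mxC.
Qed.

Section Spectrum.
Variables (C : numClosedFieldType) (d : nat) (M : 'M[int]_d.+1).
Let n := d.+1.
Let MC : 'M[C]_n := map_mx intr M.

Lemma spectral : diagonalizable MC -> exists (lam : 'rV[C]_n) (V : 'M[C]_n),
  [/\ V \in unitmx, MC = invmx V *m diag_mx lam *m V,
      char_poly MC = \prod_(i < n) ('X - (lam 0 i)%:P) &
      forall i, eigenvalue MC (lam 0 i)].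
Proof.
move=> [V Vu /(similar_diagLR Vu)[lam E]]; exists lam, V.
have E2 : MC = invmx V *m diag_mx lam *m V by rewrite E conjumx ?unitmx_inv // invmxK.
have cE : char_poly MC = \prod_(i < n) ('X - (lam 0 i)%:P).
  rewrite (@char_poly_conj _ _ _ (diag_mx lam) V) //; last first.
    by rewrite E2 !mulmxA mulmxV // mul1mx.
  rewrite char_poly_trig ?diag_mx_is_trig //.
  by apply: eq_bigr => i _; rewrite mxE eqxx.
split => // i; rewrite eigenvalue_root_char cE /root horner_prod.
by rewrite (bigD1 i) //= hornerXsubC subrr mul0r.
Qed.
End Spectrum.

Section Classification.
Variables (C : numClosedFieldType) (d : nat) (M : 'M[int]_d.+1) (lam : 'rV[C]_d.+1) (r : C).
Let n := d.+1.
Let p := char_poly M.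
Hypothesis pE : map_poly intr p = \prod_(i < n) ('X - (lam 0 i)%:P).
Hypothesis lam_norm : forall i, `|lam 0 i| = r.
Hypothesis det2 : `|\det M| = 2.

Lemma coef0_char_poly : `|p`_0| = 2.
Proof. by rewrite char_poly_det normrM normrX normrN1 expr1n mul1r. Qed.

Lemma coef_char_polyC j : (map_poly intr p : {poly C})`_j = (p`_j)%:~R.
Proof. by rewrite coef_map. Qed.

Lemma norm_intr (z : int) : `|z%:~R : C| = (absz z)%:R.
Proof. by rewrite -intr_norm natr_absz. Qed.

Lemma absz_coef0 : absz p`_0 = 2%N.
Proof. by apply/eqP; rewrite -eqz_nat abszE coef0_char_poly. Qed.

Lemma r_pow : r ^+ n = 2.
Proof.
have : `|(map_poly intr p : {poly C})`_0| = r ^+ n.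
  rewrite pE -horner_coef0 horner_prod normr_prod.
  under eq_bigr => i _ do rewrite hornerXsubC sub0r normrN lam_norm.
  by rewrite prodr_const card_ord.
by rewrite coef_char_polyC norm_intr absz_coef0.
Qed.

Lemma r_ge0 : 0 <= r. Proof. by rewrite -(lam_norm 0). Qed.

Lemma coef_relationC j : (j <= n)%N ->
  (p`_j)%:~R * (r ^+ 2) ^+ j = (p`_0)%:~R * (p`_(n - j))%:~R :> C.
Proof.
move=> jn.
have lamC i : lam 0 i * (lam 0 i)^* = r ^+ 2 by rewrite -normCK lam_norm.
have real : map_poly Num.conj (\prod_(i < n) ('X - (lam 0 i)%:P)) =
   \prod_(i < n) ('X - (lam 0 i)%:P).
  rewrite -pE -map_poly_comp; apply: eq_map_poly => z /=; exact: rmorph_int.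
by have := coef_reciprocal lamC real jn; rewrite -pE !coef_char_polyC.
Qed.

(** Raising to the power [n] replaces [r], an n-th root of 2, by an integer, and leaves an identity
    between natural numbers. *)
Lemma coef_relation j : (j <= n)%N ->
  (absz (p`_j)%R ^ n * 2 ^ (2 * j) = 2 ^ n * absz (p`_(n - j))%R ^ n)%N.
Proof.
move=> /coef_relationC E.
have := congr1 (fun z => `|z| ^+ n) E.
rewrite !normrM !exprMn !norm_intr -exprD normrX (ger0_norm r_ge0) -exprM.
rewrite (_ : (j + j) * n = n * (2 * j))%N; last by lia.
rewrite exprM r_pow absz_coef0 -!natrX -!natrM => /eqP.
by rewrite eqr_nat => /eqP.
Qed.

(** Compare 2-adic valuations in [coef_relation]: all terms but [2 * j] are multiples of [n]. *)
Lemma coef_support j : (j <= n)%N -> p`_j != 0 -> (n %| 2 * j)%N.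
Proof.
move=> jn pj0; have E := coef_relation jn.
have x0 : (0 < absz (p`_j)%R)%N by rewrite absz_gt0.
have y0 : (0 < absz (p`_(n - j))%R)%N.
  rewrite lt0n; apply/negP => /eqP z; move: E; rewrite z exp0n // muln0 => E.
  have : (0 < absz (p`_j)%R ^ n * 2 ^ (2 * j))%N by rewrite muln_gt0 !expn_gt0 x0.
  by rewrite E.
have := congr1 (logn 2) E.
rewrite !lognM ?expn_gt0 ?x0 ?y0 // !lognX.
rewrite !(logn_prime _ (isT : prime 2)) /= !muln1 => E2.
have : (n %| n * logn 2 (absz (p`_j)%R) + 2 * j)%N by rewrite E2 dvdn_add // dvdn_mulr.
by rewrite dvdn_addr // dvdn_mulr.
Qed.

Lemma half_support j : (j <= n)%N -> p`_j != 0 -> [\/ j = 0%N, j = n | (j + j)%N = n].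
Proof.
move=> jn /(coef_support jn)/dvdnP[k E].
have : (k <= 2)%N by rewrite -(leq_pmul2r (isT : 0 < n)%N) -E leq_mul2l jn orbT.
case: k E => [|[|[|k]]] // E _; [constructor 1|constructor 3|constructor 2]; lia.
Qed.

(* Since [2^(2j/n)] is irrational unless [n | 2j], the characteristic polynomial
   is [x^n + c] or [x^(2m) + b x^m + c]. *)
Theorem power_relation :
  (exists c : int, absz c = 2%N /\ M ^+ n = c%:A) \/
  (exists (m : nat) (b : int), [/\ n = (m + m)%N, (absz b == 1)%N || (absz b == 2)%N &
     M ^+ (m + m) = - (b *: M ^+ m) - 2%:A]).
Proof.
have pn : p`_n = 1.
  have /eqP := char_poly_monic M.
  by rewrite /lead_coef size_char_poly.
have szp : size p = n.+1 by rewrite size_char_poly.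
(* A vanishing middle coefficient belongs to the first alternative. *)
have [[m [nm pm]]|N] := pselect (exists m, n = (m + m)%N /\ p`_m != 0); last first.
  left; exists (- p`_0); split; first by rewrite abszN absz_coef0.
  have E : p = 'X^n + (p`_0)%:P.
    apply/polyP => j; rewrite coefD coefXn coefC.
    have [jn|jn] := ltnP n j.
      rewrite nth_default ?szp // (gtn_eqF jn) (gtn_eqF (leq_ltn_trans (leq0n _) jn)).
      by rewrite addr0.
    have [->|j0] := eqVneq j 0%N; first by rewrite add0r.
    have [->|jn'] := eqVneq j n; first by rewrite pn addr0.
    rewrite addr0; apply/eqP/negPn/negP => pj; case: (half_support jn pj) => E.
    - by rewrite E in j0.
    - by rewrite E eqxx in jn'.
    - by case: N; exists j.
  have CH : horner_mx M p = 0 by exact: Cayley_Hamilton.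
  rewrite E rmorphD rmorphXn /= horner_mx_X horner_mx_C in CH.
  by move/eqP: CH; rewrite addr_eq0 => /eqP ->; rewrite scaleNr -scalemx1.
right; exists m, p`_m.
have m0 : (0 < m)%N by case: m nm {pm}.
have mn : (m <= n)%N by rewrite nm leq_addr.
have mm : (m + m == m)%N = false by clear -m0; lia.
(* At the middle index [r ^+ 2 ^+ m = 2], so [coef_relationC] equates [p_m * 2] with [p_0 * p_m],
   and [p_m] cancels. *)
have p0E : p`_0 = 2.
  have := coef_relationC mn; rewrite -exprM mul2n -addnn -nm r_pow [X in (X - _)%N]nm addnK mulrC.
  move=> /mulIf H; apply/eqP; rewrite -(eqr_int C) -H ?intr_eq0 //.
have E : p = 'X^(m + m) + p`_m *: 'X^m + 2%:P.
  apply/polyP => j; rewrite !coefD coefXn coefZ coefXn coefC -nm.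
  have [jn|jn] := ltnP n j.
    rewrite nth_default ?szp // (gtn_eqF jn) (gtn_eqF (leq_ltn_trans mn jn)).
    by rewrite (gtn_eqF (leq_ltn_trans (leq0n _) jn)) mulr0 !addr0.
  have [->|j0] := eqVneq j 0%N.
    by rewrite p0E ?(ltn_eqF m0) mulr0 !add0r.
  have [->|jn'] := eqVneq j n.
    by rewrite pn nm mm mulr0 !addr0.
  have [->|jm] := eqVneq j m; first by rewrite mulr1 add0r addr0.
  rewrite mulr0 !addr0; apply/eqP/negPn/negP => pj; case: (half_support jn pj) => E.
  - by rewrite E in j0.
  - by rewrite E eqxx in jn'.
  - by move: jm; rewrite -(inj_eq double_inj) -!addnn E nm eqxx.
split => //; last first.
  have CH : horner_mx M p = 0 by exact: Cayley_Hamilton.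
  rewrite E !rmorphD rmorphXn /= linearZ rmorphXn /= horner_mx_X horner_mx_C in CH.
  by move/eqP: CH; rewrite -addrA addr_eq0 => /eqP ->; rewrite opprD scaler_nat mulr2n.
(* With [y = lam ^+ m], of modulus the square root of 2, the product of the middle coefficient by
   [y] is [- (y ^+ 2 + 2)], of modulus at most 4; hence the coefficient has square at most 8. *)
suff : (absz (p`_m)%R <= 2)%N by move: pm; rewrite -absz_gt0; case: absz => [|[|[|k]]].
have root0 : (lam 0 0) ^+ m ^+ 2 + (p`_m)%:~R * (lam 0 0) ^+ m + 2 = 0.
  have : (map_poly intr p : {poly C}).[lam 0 0] = 0.
    by rewrite pE horner_prod (bigD1 ord0) //= hornerXsubC subrr mul0r.
  rewrite {1}E !rmorphD /= !hornerD map_polyXn hornerXn linearZ /= map_polyXn hornerZ hornerXn.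
  by rewrite map_polyC hornerC exprD => H; rewrite -[RHS]H expr2; congr (_ + _).
have y2 : `|(lam 0 0) ^+ m| ^+ 2 = 2.
  by rewrite normrX lam_norm -exprM muln2 -addnn -nm r_pow.
set y := lam 0 0 ^+ m in root0 y2.
have : `|(p`_m)%:~R * y| <= 4.
  have -> : (p`_m)%:~R * y = - (y ^+ 2 + 2).
    by apply/eqP; rewrite -addr_eq0 addrCA addrA -addrA -root0; apply/eqP; ring.
  rewrite normrN; apply: le_trans (ler_normD _ _) _.
  by rewrite normrX y2 normr_nat -natrD.
rewrite normrM norm_intr => h.
have : (absz p`_m)%:R ^+ 2 * 2 <= 16 :> C.
  rewrite -[X in _ * X]y2 -exprMn (_ : 16 = 4 ^+ 2 :> C); last by rewrite -natrX.
  by rewrite lerXn2r // nnegrE ?mulr_ge0.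
rewrite -natrX -natrM ler_nat; case: absz => [|[|[|k]]] //.
by move=> h3; exfalso; move: h3; rewrite leqNgt => /negP; apply; rewrite -addn3; nia.
Qed.
End Classification.

(** * Irreducibility and cyclic vectors *)

(** The constant coefficient is, up to sign, the leading one, a nonzero integer, times the product
    of the roots, each of modulus greater than 1. *)
Lemma expanding_coef0 (C : numClosedFieldType) (q : {poly int}) : (1 < size q)%N ->
  (forall a : C, root (map_poly intr q) a -> 1 < `|a|) -> (1 < absz (q`_0)%R)%N.
Proof.
move=> sq roots; set qC := map_poly intr q : {poly C}.
have szC : size qC = size q by rewrite size_map_inj_poly //; exact: intr_inj.
have [rs E] := closed_field_poly_normal qC.
have q0 : q != 0 by rewrite -size_poly_eq0 -lt0n ltnW.
have lead0 : lead_coef qC != 0 by rewrite lead_coef_eq0 -size_poly_eq0 szC size_poly_eq0.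
have lead1 : 1 <= `|lead_coef qC|.
  rewrite lead_coefE coef_map szC /= -lead_coefE norm_intr ler1n.
  by rewrite absz_gt0 lead_coef_eq0.
have rsz : (0 < size rs)%N.
  have H : size q = (size rs).+1 by rewrite -szC E size_scale // size_prod_XsubC.
  by rewrite -ltnS -H.
have rs1 a : a \in rs -> 1 < `|a|.
  by move=> ars; apply: roots; rewrite -/qC E rootZ // root_prod_XsubC.
have : 1 < `|qC`_0|.
  rewrite E coefZ normrM -horner_coef0 horner_prod normr_prod.
  under eq_bigr => i _ do rewrite hornerXsubC sub0r normrN.
  apply: lt_le_trans (_ : \prod_(j <- rs) `|j| <= _); last first.
    by rewrite -[leLHS]mul1r ler_wpM2r // prodr_ge0.
  case: rs rsz rs1 {E} => // a rs _ rs1; rewrite big_cons.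
  apply: lt_le_trans (rs1 a _) _; first by rewrite mem_head.
  rewrite -[leLHS]mulr1 ler_wpM2l //.
  elim: rs rs1 => [|b rs IH] rs1; first by rewrite big_nil.
  rewrite big_cons -[leLHS]mul1r ler_pM //.
    by apply/ltW/rs1; rewrite !inE eqxx orbT.
  by apply: IH => c; rewrite inE => /orP[/eqP ->|h]; apply: rs1; rewrite !inE ?eqxx ?h ?orbT.
by rewrite coef_map /= norm_intr ltr1n.
Qed.

(** By Gauss's lemma a rational factor may be taken integral. Two nonconstant integral factors would
    each have constant coefficient of absolute value at least 2 by [expanding_coef0], so their
    product could not be 2. *)
Lemma expanding_irreducible (C : numClosedFieldType) (p : {poly int}) : (1 < size p)%N ->
  (forall a : C, root (map_poly intr p) a -> 1 < `|a|) -> absz p`_0 = 2%N ->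
  irreducible_poly (map_poly intr p : {poly rat}).
Proof.
move=> sp roots p0; set pQ := map_poly intr p : {poly rat}.
have szQ (q : {poly int}) : size (map_poly intr q : {poly rat}) = size q.
  by rewrite size_map_inj_poly //; exact: intr_inj.
split; first by rewrite szQ.
move=> q sq /dvdpP_rat_int[p1 [a a0 qE] [r pE]].
have pn0 : p != 0 by rewrite -size_poly_eq0 -lt0n ltnW.
have p1n0 : p1 != 0 by apply: contraNneq pn0 => z; rewrite pE z mul0r.
have rn0 : r != 0 by apply: contraNneq pn0 => z; rewrite pE z mulr0.
have rootsM (s t : {poly int}) : p = s * t ->
    forall c : C, root (map_poly intr s) c -> 1 < `|c|.
  by move=> E c hc; apply: roots; rewrite E rmorphM rootM hc.
have p1big : (1 < absz (p1`_0)%R)%N.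
  apply: (expanding_coef0 _ (rootsM _ _ pE)).
  rewrite ltn_neqAle eq_sym lt0n size_poly_eq0 p1n0 andbT.
  by move: sq; rewrite qE size_scale // szQ.
have rsmall : (size r <= 1)%N.
  rewrite leqNgt; apply/negP => sr.
  have rbig : (1 < absz (r`_0)%R)%N.
    by apply: (expanding_coef0 sr (rootsM r p1 _)); rewrite mulrC.
  have := p0; rewrite pE coef0M abszM; move: (absz _) (absz _) p1big rbig => x y; nia.
have [c rE] : exists c, r = c%:P by exists r`_0; exact: size1_polyC.
have c0 : c != 0 by move: rn0; rewrite rE polyC_eq0.
rewrite qE /pQ pE rE rmorphM /= map_polyC /= mulrC mul_polyC.
have aQ : (c%:~R : rat) != 0 by rewrite intr_eq0.
by apply: (@eqp_trans _ (map_poly intr p1)); [exact: eqp_scale|rewrite eqp_sym; exact: eqp_scale].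
Qed.

Section CyclicVector.
Variables (d : nat) (M : 'M[int]_d.+1) (v : 'cV[int]_d.+1).
Let n := d.+1.

Definition krylov : 'M[int]_n := \matrix_(k, i) (M ^+ k *m v) i 0.

(** A linear dependence of the rows is a nonzero polynomial [f] of degree less than [n] with
    [f(M) v = 0]. It is coprime to the irreducible characteristic polynomial, and a Bezout relation
    evaluated at [M] kills [v]. *)
Lemma krylov_det : irreducible_poly (map_poly intr (char_poly M) : {poly rat}) -> v != 0 ->
  \det krylov != 0.
Proof.
move=> irr v0; apply/negP => /eqP det0.
pose MQ : 'M[rat]_n := map_mx intr M; pose vQ : 'cV[rat]_n := map_mx intr v.
have : \det (map_mx intr krylov : 'M[rat]_n) == 0 by rewrite det_map_mx det0.
move=> /det0P[c c0 cW].
pose f := rVpoly c.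
have f0 : f != 0 by apply: contraNneq c0 => z; rewrite -[c]rVpolyK -/f z linear0.
have MX k : MQ ^+ k = map_mx intr (M ^+ k) by rewrite rmorphXn.
have fv : horner_mx MQ f *m vQ = 0.
  have -> : horner_mx MQ f = \sum_(k < n) c 0 k *: MQ ^+ k.
    rewrite /f /rVpoly poly_def linear_sum /=; apply: eq_bigr => k _.
    by rewrite linearZ rmorphXn /= horner_mx_X valK.
  apply/colP => i; rewrite mulmx_suml summxE mxE.
  have := congr1 (fun A : 'rV[rat]_n => A 0 i) cW; rewrite !mxE => E.
  rewrite -[RHS]E; apply: eq_bigr => k _; rewrite -scalemxAl mxE; congr (_ * _).
  by rewrite MX -map_mxM !mxE.
have cop : coprimep (map_poly intr (char_poly M)) f.
  rewrite irreducible_poly_coprime //; apply/negP => /dvdp_leq -/(_ f0).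
  rewrite size_map_inj_poly //; last exact: intr_inj.
  by rewrite size_char_poly ltnNge size_poly.
have [[u w] /= E] := Bezout_coprimepP _ _ cop.
have [a a0 aE] : exists2 a, a != 0 & u * map_poly intr (char_poly M) + w * f = a%:P.
  by apply/size_poly1P; rewrite (eqp_size E) size_poly1.
have : a *: vQ = 0.
  have <- : horner_mx MQ (a%:P) *m vQ = a *: vQ by rewrite horner_mx_C mul_scalar_mx.
  rewrite -aE rmorphD !rmorphM /= map_char_poly Cayley_Hamilton mulr0 add0r.
  by rewrite -mulmxA fv mulmx0.
move/eqP; rewrite scaler_eq0 (negPf a0) /=; apply/negP.
apply: contra v0 => /eqP z; apply/eqP/colP => i; apply/eqP.
have := congr1 (fun A : 'cV[rat]_n => A i 0) z; rewrite !mxE => /eqP.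
by rewrite intr_eq0.
Qed.

End CyclicVector.

(** The adjugate undoes [W] up to the factor [\det W] while staying integral. *)
Lemma mulmx_int_bounded (T : Type) m (W : 'M[int]_m) (z : T -> 'rV[int]_m) : \det W != 0 ->
  (exists k : nat, forall t i, (absz ((z t *m W) ord0 i) <= k)%N) <->
  (exists k : nat, forall t i, (absz (z t ord0 i) <= k)%N).
Proof.
have sum_le (A : 'M[int]_m) (y : T -> 'rV[int]_m) :
    (exists k : nat, forall t i, (absz (y t ord0 i) <= k)%N) ->
    exists k : nat, forall t i, (absz ((y t *m A) ord0 i) <= k)%N.
  move=> [k hk]; exists (\sum_i \sum_j k * absz (A j i))%N => t i; rewrite mxE.
  apply: leq_trans (_ : \sum_j absz (y t ord0 j * A j i)%R <= _)%N.
    elim/big_ind2: _ => // a a' b b' h1 h2.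
    by apply: leq_trans (absz_add _ _) _; exact: leq_add.
  apply: leq_trans (_ : \sum_j k * absz (A j i) <= _)%N.
    by apply: leq_sum => j _; rewrite abszM leq_mul2r hk orbT.
  by rewrite [leqRHS](bigD1 i) //= leq_addr.
move=> dW; split; last exact: sum_le.
move=> /(sum_le (\adj W))[k hk]; exists k => t i.
apply: leq_trans (hk t i); rewrite -mulmxA mul_mx_adj mul_mx_scalar mxE abszM.
by rewrite leq_pmull // absz_gt0.
Qed.

(** * Digit expansions of the attractor *)

(** Diagonalizability gives the growth [s ^+ k] without the polynomial factors of Jordan blocks;
    [expansion_eqP] relies on this exact rate. *)
Lemma conj_diag_pow_bound (C : numClosedFieldType) (d : nat) (A V : 'M[C]_d.+1)
    (mu : 'rV[C]_d.+1) (s : C) : V \in unitmx -> A = invmx V *m diag_mx mu *m V ->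
  (forall i, `|mu 0 i| = s) ->
  exists2 B, 0 <= B & forall k i j, `|(A ^+ k) i j| <= B * s ^+ k.
Proof.
move=> Vu AE mus.
have s0 : 0 <= s by rewrite -(mus 0).
have powE k : A ^+ k = invmx V *m diag_mx (\row_i mu 0 i ^+ k) *m V.
  elim: k => [|k IH].
    rewrite (_ : diag_mx _ = 1%:M) ?mulmx1 ?mulVmx //.
    by apply/matrixP => i j; rewrite !mxE expr0.
  rewrite exprSr IH AE -!mulmxE !mulmxA mulmxK // -!mulmxA; congr (_ *m _).
  rewrite !mulmxA; congr (_ *m _); rewrite mulmx_diag; congr diag_mx.
  by apply/rowP => i; rewrite !mxE exprSr.
pose B := \sum_i \sum_j \sum_l `|invmx V i l| * `|V l j|.
have inner0 i j : 0 <= \sum_l `|invmx V i l| * `|V l j|.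
  by apply: sumr_ge0 => l _; rewrite mulr_ge0.
exists B; first by apply: sumr_ge0 => i _; apply: sumr_ge0 => j _.
move=> k i j; rewrite powE mxE.
apply: le_trans (ler_norm_sum _ _ _) _.
apply: (@le_trans _ _ ((\sum_l `|invmx V i l| * `|V l j|) * s ^+ k)).
  rewrite mulr_suml; apply: ler_sum => l _; rewrite mul_mx_diag !mxE !normrM normrX mus.
  by rewrite mulrAC.
apply: ler_wpM2r; first exact: exprn_ge0.
rewrite /B [leRHS](bigD1 i) //= [X in _ <= X + _](bigD1 j) //= -addrA lerDl addr_ge0 //.
  by apply: sumr_ge0.
by apply: sumr_ge0 => i' _; apply: sumr_ge0.
Qed.

Lemma complex_ge0E (R : rcfType) (z : R[i]) : 0 <= z -> z = (complex.Re z)%:C%C.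
Proof. by move=> /ger0_Im /= H; rewrite [LHS]complexE; case: z H => x y /= ->; rewrite mulr0 addr0. Qed.

Section RealBounds.
Variables (R : realType) (d : nat) (M : 'M[int]_d.+1).
Let n := d.+1.
Let MC : 'M[R[i]]_n := map_mx intr M.
Let MR : 'M[R]_n := map_mx intr M.

Lemma lecR_norm (x y : R) : `|x%:C%C| <= y%:C%C -> `|x| <= y.
Proof. by rewrite normc_def /= expr0n addr0 sqrtr_sqr lecR. Qed.

Lemma pow_bounds (lam : 'rV[R[i]]_n) (V : 'M[R[i]]_n) (r : R) :
  V \in unitmx -> MC = invmx V *m diag_mx lam *m V -> (forall i, `|lam 0 i| = r%:C%C) -> 0 < r ->
  MR \in unitmx /\
  exists2 B : R, 0 <= B & forall k i j, `|(MR ^+ k) i j| <= B * r ^+ k /\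
     `|(invmx MR ^+ k) i j| <= B * r^-1 ^+ k.
Proof.
move=> Vu E lamr r0.
have lam0 i : lam 0 i != 0 by rewrite -normr_gt0 lamr ltcR.
have mapR : map_mx (real_complex R) MR = MC.
  by apply/matrixP => i j; rewrite !mxE rmorph_int.
pose mu := \row_i (lam 0 i)^-1.
have invE : MC *m (invmx V *m diag_mx mu *m V) = 1%:M.
  rewrite E !mulmxA mulmxK // -(mulmxA (invmx V)) mulmx_diag.
  rewrite (_ : diag_mx _ = 1%:M) ?mulmx1 ?mulVmx //.
  by apply/matrixP => i j; rewrite !mxE divff.
have [MCu _] := mulmx1_unit invE.
have invMC : invmx MC = invmx V *m diag_mx mu *m V by rewrite -[RHS](mulKmx MCu) invE mulmx1.
have mur i : `|mu 0 i| = (r^-1)%:C%C by rewrite mxE normfV lamr fmorphV.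
have MRu : MR \in unitmx by rewrite -(map_unitmx (real_complex R)) mapR.
have [B1 B10 h1] := conj_diag_pow_bound Vu E lamr.
have [B2 B20 h2] := conj_diag_pow_bound Vu invMC mur.
split => //; exists (complex.Re B1 + complex.Re B2).
  by rewrite addr_ge0 // -lecR -complex_ge0E.
have re1 : 0 <= complex.Re B1 by rewrite -lecR -complex_ge0E.
have re2 : 0 <= complex.Re B2 by rewrite -lecR -complex_ge0E.
have map_pow k (X : 'M[R]_n) : map_mx (real_complex R) (X ^+ k) = map_mx (real_complex R) X ^+ k.
  by rewrite rmorphXn.
move=> k i j; split; apply: lecR_norm.
  have -> : ((MR ^+ k) i j)%:C%C = (MC ^+ k) i j by rewrite -mapR -map_pow mxE.
  apply: le_trans (h1 k i j) _; rewrite rmorphM rmorphXn /=.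
  apply: ler_wpM2r; first by rewrite exprn_ge0 // lecR ltW.
  by rewrite [leLHS](complex_ge0E B10) lecR lerDl.
have -> : ((invmx MR ^+ k) i j)%:C%C = (invmx MC ^+ k) i j.
  by rewrite -mapR -map_invmx -map_pow mxE.
apply: le_trans (h2 k i j) _; rewrite rmorphM rmorphXn /=.
apply: ler_wpM2r; first by rewrite exprn_ge0 // lecR invr_ge0 ltW.
by rewrite [leLHS](complex_ge0E B20) lecR lerDr.
Qed.
End RealBounds.

Section Expansion.
Variables (R : realType) (d : nat) (M : 'M[int]_d.+1) (d0 d1 : 'cV[int]_d.+1) (B r : R).
Let n := d.+1.
Let MR : 'M[R]_n := map_mx intr M.
Hypothesis MR_unit : MR \in unitmx.
Hypothesis B_ge0 : 0 <= B.
Hypothesis r_gt1 : 1 < r.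
Hypothesis pow_bound : forall k i j, `|(MR ^+ k) i j| <= B * r ^+ k.
Hypothesis inv_bound : forall k i j, `|(invmx MR ^+ k) i j| <= B * r^-1 ^+ k.

Let r_gt0 : 0 < r. Proof. exact: lt_trans ltr01 r_gt1. Qed.
Let K := r^-1.
Let K_gt0 : 0 < K. Proof. by rewrite invr_gt0. Qed.
Let K_lt1 : K < 1. Proof. by rewrite invf_lt1. Qed.

Definition digit (b : bool) : 'cV[int]_n := if b then d1 else d0.

Definition partial_sum (a : nat -> bool) : nat -> 'cV[R]_n :=
  series (fun k => invmx MR ^+ k.+1 *m map_mx intr (digit (a k))).

Lemma partial_sumS a k : partial_sum a k.+1 =
  partial_sum a k + invmx MR ^+ k.+1 *m map_mx intr (digit (a k)).
Proof. by rewrite /partial_sum /series /= big_nat_recr. Qed.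

Let Dmax : R := \sum_i (`|(d0 i 0)%:~R| + `|(d1 i 0)%:~R|).

Lemma mulmx_entry_bound m (A : 'M[R]_m) (x : 'cV[R]_m) (e1 e2 : R) : 0 <= e1 ->
  (forall i j, `|A i j| <= e1) -> (forall j, `|x j 0| <= e2) ->
  forall i, `|(A *m x) i 0| <= e1 * (m%:R * e2).
Proof.
move=> e10 hA hx i; rewrite mxE; apply: le_trans (ler_norm_sum _ _ _) _.
have -> : e1 * (m%:R * e2) = \sum_(j < m) e1 * e2.
  by rewrite sumr_const card_ord mulr_natl mulrnAr.
by apply: ler_sum => j _; rewrite normrM ler_pM.
Qed.

Lemma digit_bound b j : `|(map_mx intr (digit b) : 'cV[R]_n) j 0| <= Dmax.
Proof.
rewrite mxE /Dmax (bigD1 j) //=.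
have h : 0 <= \sum_(i < n | i != j) (`|(d0 i 0)%:~R : R| + `|(d1 i 0)%:~R : R|).
  by apply: sumr_ge0 => i _; rewrite addr_ge0.
have h0 := normr_ge0 ((d0 j 0)%:~R : R); have h1 := normr_ge0 ((d1 j 0)%:~R : R).
by case: b; rewrite /digit; [move: h0|move: h1] => h'; lra.
Qed.

Let c1 : R := B * (n%:R * Dmax).
Let c2 : R := c1 / (1 - K).

Lemma Dmax_ge0 : 0 <= Dmax.
Proof. exact: le_trans (normr_ge0 _) (digit_bound true 0). Qed.

Lemma c1_ge0 : 0 <= c1. Proof. by rewrite !mulr_ge0 // Dmax_ge0. Qed.

Lemma term_bound a k i :
  `|(invmx MR ^+ k.+1 *m map_mx intr (digit (a k))) i 0| <= c1 * K ^+ k.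
Proof.
apply: le_trans (mulmx_entry_bound _ (fun i j => inv_bound k.+1 i j) (digit_bound (a k)) i) _.
  by rewrite mulr_ge0 // exprn_ge0 // ltW.
have -> : B * r^-1 ^+ k.+1 * (n%:R * Dmax) = c1 * K ^+ k.+1 by rewrite /c1 -/K; ring.
apply: ler_wpM2l; first exact: c1_ge0.
by rewrite exprS ler_piMl ?exprn_ge0 // ltW.
Qed.

Lemma partial_sum_cauchy a i m k :
  `|partial_sum a m i 0 - partial_sum a (m + k) i 0| <= c2 * K ^+ m.
Proof.
have K1 : 0 < 1 - K by rewrite subr_gt0.
(* The factor [1 - K ^+ k] is the finite geometric sum; it makes the induction close. *)
suff h : `|partial_sum a m i 0 - partial_sum a (m + k) i 0| <= c2 * K ^+ m * (1 - K ^+ k).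
  apply: le_trans h _; rewrite ler_piMr //.
    by rewrite mulr_ge0 ?exprn_ge0 ?divr_ge0 ?c1_ge0 ?ltW.
  by rewrite gerBl exprn_ge0 // ltW.
elim: k => [|k IH]; first by rewrite addn0 subrr normr0 expr0 subrr mulr0.
rewrite addnS partial_sumS mxE opprD addrA; apply: le_trans (ler_normB _ _) _.
have -> : c2 * K ^+ m * (1 - K ^+ k.+1) =
    c2 * K ^+ m * (1 - K ^+ k) + c1 * K ^+ (m + k).
  rewrite exprD exprS /c2; field; exact: lt0r_neq0.
by apply: lerD IH _; exact: term_bound.
Qed.

Definition expansion (a : nat -> bool) : 'cV[R]_n :=
  \col_i lim ((fun m => partial_sum a m i 0) @ \oo).

Lemma expansion_dist a m i : `|partial_sum a m i 0 - expansion a i 0| <= c2 * K ^+ m.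
Proof.
rewrite mxE; apply: (geometric_cvg (u := fun m => partial_sum a m i 0)) => //.
  exact: ltW.
by move=> m' k; exact: partial_sum_cauchy.
Qed.

Lemma expansion_cvg a : partial_sum a @ \oo --> expansion a.
Proof.
apply: cvg_mx => i j; rewrite ord1; apply/cvgrPdist_lt => e e0.
have hK : (fun m => c2 * K ^+ m) @ \oo --> (0 : R).
  rewrite -(mulr0 c2); apply: cvgM; first exact: cvg_cst.
  by apply: cvg_expr; rewrite ger0_norm // ltW.
have /cvgrPdist_lt /(_ _ e0) := hK.
apply: filterS => m; rewrite sub0r normrN => hm.
rewrite distrC; apply: le_lt_trans (expansion_dist a m i) _.
exact: le_lt_trans (ler_norm _) hm.
Qed.

Lemma attractorE : attractor M [set d0; d1] = range expansion.
Proof.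
apply/seteqP; split => [x [ds [hds hx]]|_ [a _ <-]].
  pose a k := `[< ds k = d1 >].
  have E k : digit (a k) = ds k.
    rewrite /digit /a; case: asboolP => [->//|N].
    by case: (hds k) => // ->.
  exists a => //; have := expansion_cvg (a := a).
  have -> : partial_sum a = series (fun k => invmx MR ^+ k.+1 *m map_mx intr (ds k)).
    by congr series; apply/funext => k; rewrite E.
  by move=> h; exact: (cvg_unique _ h hx).
exists (fun k => digit (a k)); split; last exact: expansion_cvg.
by move=> k; rewrite /digit; case: (a k); [right|left].
Qed.

Lemma expansion_continuous i : cylinder_continuous (fun a => expansion a i 0).
Proof.
move=> e e0; have [m hm] := expr_lt_eps (c2 *+ 2) (ltW K_gt0) K_lt1 e0.
exists m => a b hab; apply: le_lt_trans hm.
have E : partial_sum a m = partial_sum b m.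
  by rewrite /partial_sum /series /=; apply: eq_big_nat => k /andP[_ km]; rewrite hab.
rewrite -(subrKA (partial_sum a m i 0)) mulrnAl mulr2n; apply: le_trans (ler_normD _ _) _.
apply: lerD; first by rewrite distrC; exact: expansion_dist.
by rewrite E; exact: expansion_dist.
Qed.

Fixpoint digit_vec (a b : nat -> bool) (k : nat) : 'cV[int]_n :=
  if k is k'.+1 then M *m digit_vec a b k' + (digit (a k') - digit (b k')) else 0.

Lemma partial_sumB a b k :
  partial_sum a k - partial_sum b k = invmx MR ^+ k *m map_mx intr (digit_vec a b k).
Proof.
elim: k => [|k IH].
  by rewrite /partial_sum /series /= !big_geq // subrr map_mx0 mulmx0.
rewrite !partial_sumS opprD addrACA IH /= map_mxD map_mxM map_mxB mulmxDr; congr (_ + _).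
  by rewrite exprSr -mulmxE -mulmxA mulmxA mulmxA mulmxKV.
by rewrite mulmxBr.
Qed.

(** If the limits agree, the partial sums differ by a multiple of [K ^+ s], which [M ^+ s] enlarges
    by at most a multiple of [r ^+ s]; conversely, applying the inverse power to bounded vectors
    gives a vanishing difference. Multiples of [m] suffice, and only there do the digits
    decouple. *)
Lemma expansion_eqP m a b : (0 < m)%N -> expansion a = expansion b <->
  exists k : nat, forall t i, (absz (digit_vec a b (m * t)%N i 0)%R <= k)%N.
Proof.
move=> m0.
have powV s : MR ^+ s *m invmx MR ^+ s = 1%:M.
  by rewrite mulmxE (exprVn (MR : 'M[R]_n)) mulrV // unitrX.
split=> [E|[k hk]].
  have [k hk] := @int_bounded R (B * (n%:R * (c2 *+ 2))).
  exists k => t i; apply: hk.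
  set s := (m * t)%N.
  have -> : (digit_vec a b s i 0)%:~R = (MR ^+ s *m (partial_sum a s - partial_sum b s)) i 0.
    by rewrite partial_sumB mulmxA powV mul1mx mxE.
  have hx j : `|(partial_sum a s - partial_sum b s) j 0| <= c2 * K ^+ s *+ 2.
    have -> : (partial_sum a s - partial_sum b s) j 0 = (partial_sum a s j 0 - expansion a j 0) -
      (partial_sum b s j 0 - expansion b j 0) by rewrite E mxE [X in _ + X]mxE; ring.
    rewrite mulr2n; apply: le_trans (ler_normB _ _) _.
    by apply: lerD; exact: expansion_dist.
  apply: le_trans (mulmx_entry_bound _ (fun i j => pow_bound s i j) hx i) _.
    by rewrite mulr_ge0 // exprn_ge0 // ltW.
  have rK : r ^+ s * K ^+ s = 1 by rewrite -exprMn mulfV ?expr1n // gt_eqF.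
  have -> : B * r ^+ s * (n%:R * (c2 * K ^+ s *+ 2)) = B * (n%:R * (c2 *+ 2)) * (r ^+ s * K ^+ s).
    by rewrite !mulr2n; ring.
  by rewrite rK mulr1.
apply/colP => i; apply/eqP; rewrite -subr_eq0 -normr_le0 leNgt; apply/negP => e0.
pose c := c2 *+ 2 + B * (n%:R * k%:R).
have c2_ge0 : 0 <= c2 by rewrite divr_ge0 ?c1_ge0 // subr_ge0 ltW.
have [t ht] := expr_lt_eps c (ltW K_gt0) K_lt1 e0.
have := lt_le_trans ht; suff /[swap]/[apply] : `|expansion a i 0 - expansion b i 0| <= c * K ^+ t.
  by rewrite ltxx.
set s := (m * t)%N.
apply: (@le_trans _ _ (c * K ^+ s)); last first.
  apply: ler_wpM2l; first by rewrite addr_ge0 ?mulrn_wge0 // !mulr_ge0.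
  by apply: ler_wiXn2l; rewrite ?ltW // /s leq_pmull.
have -> : expansion a i 0 - expansion b i 0 =
    - (partial_sum a s i 0 - expansion a i 0) + (partial_sum b s i 0 - expansion b i 0)
    + (partial_sum a s - partial_sum b s) i 0.
  by rewrite [X in _ = _ + X]mxE [X in _ = _ + (_ + X)]mxE; ring.
rewrite /c mulrDl (mulr2n c2) mulrDl; apply: le_trans (ler_normD _ _) _; apply: lerD.
  apply: le_trans (ler_normD _ _) _; rewrite normrN.
  by apply: lerD; exact: expansion_dist.
rewrite partial_sumB.
have hx j : `|(map_mx intr (digit_vec a b s) : 'cV[R]_n) j 0| <= k%:R.
  by rewrite mxE -intr_norm -natr_absz ler_nat; exact: hk.
apply: le_trans (mulmx_entry_bound _ (fun i j => inv_bound s i j) hx i) _.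
  by rewrite mulr_ge0 // exprn_ge0 // ltW.
by rewrite mulrAC.
Qed.
End Expansion.

(** * Homeomorphisms onto the Euclidean ball *)

Lemma cV_norm_le (R : realType) n (x : 'cV[R]_n) (e : R) : 0 <= e ->
  (`|x| <= e) <-> (forall i, `|x i ord0| <= e).
Proof.
move=> e0; have -> : `|x| = mx_norm x by [].
rewrite mx_normrE; split.
  by move=> /bigmax_leP[_ h] i; exact: (h (i, ord0)).
by move=> h; apply/bigmax_leP; split => // -[i j] _ /=; rewrite ord1.
Qed.

Definition euclid (R : realType) n (x : 'cV[R]_n) : R := Num.sqrt (\sum_i x i ord0 ^+ 2).

Lemma sum_sqr_ge0 (R : realType) n (x : 'cV[R]_n) : 0 <= \sum_i x i ord0 ^+ 2.
Proof. by apply: sumr_ge0 => i _; exact: sqr_ge0. Qed.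

Lemma norm_le_euclid (R : realType) n (x : 'cV[R]_n) : `|x| <= 1 * euclid x.
Proof.
rewrite mul1r; apply/cV_norm_le; first exact: sqrtr_ge0.
move=> i; rewrite -sqrtr_sqr /euclid ler_sqrt ?sum_sqr_ge0 // (bigD1 i) //= lerDl.
by apply: sumr_ge0 => j _; exact: sqr_ge0.
Qed.

Lemma euclid_homog (R : realType) n t (x : 'cV[R]_n) : 0 <= t -> euclid (t *: x) = t * euclid x.
Proof.
move=> t0; rewrite /euclid.
have -> : \sum_i (t *: x) i ord0 ^+ 2 = t ^+ 2 * \sum_i x i ord0 ^+ 2.
  by rewrite mulr_sumr; apply: eq_bigr => i _; rewrite mxE exprMn.
by rewrite sqrtrM ?sqr_ge0 // sqrtr_sqr ger0_norm.
Qed.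

Lemma euclid_gt0 (R : realType) n (x : 'cV[R]_n) : x != 0 -> 0 < euclid x.
Proof.
move=> x0; have := norm_le_euclid x; rewrite mul1r; apply: lt_le_trans.
by rewrite normr_gt0.
Qed.

Lemma euclid_continuous (R : realType) n : continuous (@euclid R n).
Proof.
have c : continuous (fun y : 'cV[R]_n => \sum_i y i ord0 ^+ 2).
  apply: continuous_big => [|i _]; first exact: add_continuous.
  move=> x; apply: (@continuous_comp _ _ _ (fun y : 'cV[R]_n => y i ord0) (fun z : R => z ^+ 2)).
    exact: coord_continuous.
  exact: exprn_continuous.
by move=> x; apply: (continuous_comp (c x)); exact: sqrt_continuous.
Qed.

Lemma euclid_ball (R : realType) n (x : 'cV[R]_n) :
  @euclidean_closed_ball R n x <-> euclid x <= 1.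
Proof.
rewrite /euclidean_closed_ball /= /euclid; set s := \sum_i _.
by have -> : (Num.sqrt s <= 1) = (s <= 1) by rewrite -[X in _ <= X]sqrtr1 ler_sqrt.
Qed.

Lemma gauge_body_homeomorphic (R : realType) n (p psi : (nat -> bool) -> 'cV[R]_n)
    (N1 : 'cV[R]_n -> R) :
  (forall i, cylinder_continuous (fun a => p a i ord0)) ->
  (forall i, cylinder_continuous (fun a => psi a i ord0)) ->
  continuous N1 -> (forall t x, 0 <= t -> N1 (t *: x) = t * N1 x) ->
  (forall x, x != 0 -> 0 < N1 x) ->
  (forall a, N1 (psi a) <= 1) -> (forall x, N1 x <= 1 -> exists a, psi a = x) ->
  (forall a b, p a = p b <-> psi a = psi b) ->
  homeomorphic (range p) (@euclidean_closed_ball R n).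
Proof.
move=> cp cpsi N1c N1h N1p N1psi psi_surj ker.
have mxc (f : (nat -> bool) -> 'cV[R]_n) : (forall i, cylinder_continuous (fun a => f a i ord0)) ->
    continuous (f : cantor_space -> 'cV[R]_n).
  move=> cf a; apply: cvg_mx => i j; rewrite ord1.
  exact: (cylinder_continuousT (cf i)).
pose rad := radial N1 (@euclid R n).
have radc : continuous rad.
  exact: (radial_continuous N1c (@euclid_continuous R n) N1h (@euclid_homog R n) N1p
    (@euclid_gt0 R n) (@norm_le_euclid R n)).
have radi : injective rad.
  exact: (radial_inj N1h (@euclid_homog R n) N1p (@euclid_gt0 R n)).
have N2rad x : euclid (rad x) = N1 x.
  exact: (N2_radial N1h (@euclid_homog R n) N1p (@euclid_gt0 R n)).
have -> : @euclidean_closed_ball R n = range (rad \o psi).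
  apply/seteqP; split=> [y /euclid_ball yb|_ [a _ <-]]; last first.
    by apply/euclid_ball; rewrite /= N2rad.
  have [x E] := radial_surj N1h (@euclid_homog R n) N1p (@euclid_gt0 R n) y.
  have [|a Ea] := psi_surj x; first by rewrite -N2rad /rad E.
  by exists a => //=; rewrite Ea.
apply: (@quotient_homeomorphic cantor_space _ _ p (rad \o psi)).
- exact: cantor_space_compact.
- exact: norm_hausdorff.
- exact: norm_hausdorff.
- exact: mxc.
- by move=> a; apply: continuous_comp; [exact: mxc|exact: radc].
- by move=> a b; rewrite ker /=; split=> [->//|/radi].
Qed.

(** * Reduction to the planar and interval models *)

Definition substream (T : Type) (m i : nat) (a : nat -> T) : nat -> T := fun j => a (m * j + i)%N.

Lemma substream_continuous (R : realType) (m i : nat) (f : (nat -> bool) -> R) :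
  cylinder_continuous f -> (0 < m)%N -> (i < m)%N -> cylinder_continuous (fun a => f (substream m i a)).
Proof.
move=> cf m0 im e e0; have [N hN] := cf e e0.
exists (m * N)%N => a b hab; apply: hN => k kN; apply: hab.
apply: (@leq_trans (m * k.+1)%N); last by rewrite leq_mul2l kN orbT.
by rewrite mulnS addnC ltn_add2r.
Qed.

Lemma interleave (T : Type) (m : nat) (s : nat -> nat -> T) : (0 < m)%N ->
  exists a, forall i, (i < m)%N -> substream m i a = s i.
Proof.
move=> m0; exists (fun k => s (k %% m)%N (k %/ m)%N) => i im.
apply/funext => j; rewrite /substream mulnC modnMDl modn_small // divnMDl //.
by rewrite divn_small // addn0.
Qed.

Section Residues.
Variables (d : nat) (M : 'M[int]_d.+1) (d0 d1 : 'cV[int]_d.+1) (a b : nat -> bool).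
Let n := d.+1.
Let v := d1 - d0.
Let delta (k : nat) : int := 1%:Z *+ a k - 1%:Z *+ b k.

Lemma digitB k : digit d0 d1 (a k) - digit d0 d1 (b k) = delta k *: v.
Proof.
rewrite /digit /delta /v; case: (a k); case: (b k); rewrite ?mulr1n ?mulr0n.
- by rewrite !subrr scale0r.
- by rewrite subr0 scale1r.
- by rewrite sub0r scaleN1r opprB.
- by rewrite !subrr scale0r.
Qed.

Lemma digit_vecD s i : digit_vec M d0 d1 a b (s + i) =
  M ^+ i *m digit_vec M d0 d1 a b s + \sum_(l < i) delta (s + l) *: (M ^+ (i - l.+1) *m v).
Proof.
elim: i => [|i IH]; first by rewrite addn0 big_ord0 addr0 mul1mx.
rewrite addnS /= IH digitB mulmxDr mulmxA mulmxE -exprS -addrA; congr (_ + _).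
rewrite big_ord_recr /= subnn expr0 mul1mx; congr (_ + _).
rewrite mulmx_sumr; apply: eq_bigr => l _.
by rewrite -scalemxAr mulmxA mulmxE -exprS -subSn.
Qed.

(** A block of [n] digits multiplies the old vector by the scalar [c], so each residue class of
    digits runs its own Horner scheme along one vector [M ^+ (n - l.+1) *m v]. *)
Lemma digit_vec_scalar c t : M ^+ n = c%:A ->
  digit_vec M d0 d1 a b (n * t) = \sum_(l < n)
    digit_diff (int_scale c) 1%:Z (substream n l a) (substream n l b) t *: (M ^+ (n - l.+1) *m v).
Proof.
move=> Mn; elim: t => [|t IH].
  by rewrite muln0 /= big1 // => l _; rewrite scale0r.
rewrite mulnS addnC digit_vecD Mn IH -scalemxAl mul1mx scaler_sumr -big_split /=.
apply: eq_bigr => l _; rewrite scalerA -scalerDl; congr (_ *: _).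
Qed.

(** With [y] acting as [M ^+ m], the vectors [M ^+ k *m v] and [M ^+ (m + k) *m v] span a copy of
    [Z[y]], one for each residue class modulo [m]. *)
Lemma digit_vec_quad m q t : n = (m + m)%N -> M ^+ (m + m) = - (q *: M ^+ m) - 2%:A ->
  let z l := digit_diff (quad_mul q) (1%:Z, 0%:Z) (substream m l a) (substream m l b) t in
  digit_vec M d0 d1 a b (m * t) = \sum_(l < m)
    ((z l).1 *: (M ^+ (m - l.+1) *m v) + (z l).2 *: (M ^+ (m + (m - l.+1)) *m v)).
Proof.
move=> nm Mm; elim: t => [|t IH] z.
  by rewrite muln0 /= big1 // => l _; rewrite !scale0r addr0.
rewrite mulnS addnC digit_vecD IH mulmx_sumr -big_split /=.
apply: eq_bigr => l _; rewrite /z /=.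
set w := digit_diff _ _ _ _ t.
set k := (m - l.+1)%N; pose p1 := M ^+ k *m v; pose p2 := M ^+ (m + k) *m v.
have E1 : M ^+ m *m p1 = p2 by rewrite /p2 exprD -mulmxE mulmxA.
have E2 : M ^+ m *m p2 = - (q *: p2) - 2 *: p1.
  rewrite /p2 mulmxA mulmxE -exprD addnA exprD Mm mulrBl mulNr -!scalerAl mul1r -exprD.
  by rewrite mulmxBl mulNmx -!scalemxAl.
rewrite -/p1 -/p2 mulmxDr -!scalemxAr E1 E2 /delta /substream.
have -> : a (m * t + l)%N = substream m l a t by [].
have -> : b (m * t + l)%N = substream m l b t by [].
apply/matrixP => i j; rewrite !mxE.
by case: (substream m l a t); case: (substream m l b t) => /=; ring.
Qed.
End Residues.

Lemma uniform_bound (I : finType) (T : Type) (f : I -> T -> nat) :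
  (forall i, exists k, forall t, (f i t <= k)%N) -> exists k, forall i t, (f i t <= k)%N.
Proof.
move=> /choice[k hk]; exists (\sum_i k i)%N => i t.
by apply: leq_trans (hk i t) _; rewrite (bigD1 i) //= leq_addr.
Qed.

Lemma row_krylov (d : nat) (M : 'M[int]_d.+1) (v : 'cV[int]_d.+1) (z : 'rV[int]_d.+1) i :
  (z *m krylov M v) ord0 i = (\sum_k z ord0 k *: (M ^+ k *m v)) i ord0.
Proof.
by rewrite mxE summxE; apply: eq_bigr => k _; rewrite !mxE.
Qed.

Lemma scalar_bounded (d : nat) (M : 'M[int]_d.+1) (d0 d1 : 'cV[int]_d.+1) (a b : nat -> bool) c :
  \det (krylov M (d1 - d0)) != 0 -> M ^+ d.+1 = c%:A ->
  (exists k : nat, forall t i, (absz (digit_vec M d0 d1 a b (d.+1 * t)%N i ord0) <= k)%N) <->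
  forall l : 'I_d.+1, exists k : nat, forall t, (absz (digit_diff (int_scale c) 1%:Z
    (substream d.+1 l a) (substream d.+1 l b) t) <= k)%N.
Proof.
move=> W0 Mn.
(* Residue [l] goes with the power [n - l.+1], hence the reversal of indices. *)
pose z t : 'rV[int]_d.+1 := \row_k digit_diff (int_scale c) 1%:Z
  (substream d.+1 (rev_ord k) a) (substream d.+1 (rev_ord k) b) t.
have zE t i : digit_vec M d0 d1 a b (d.+1 * t)%N i ord0 = (z t *m krylov M (d1 - d0)) ord0 i.
  rewrite row_krylov (digit_vec_scalar _ _ _ _ _ Mn) (reindex_inj rev_ord_inj) /=; congr (fun_of_matrix _ _ _).
  apply: eq_bigr => k _; rewrite mxE; congr (_ *: (M ^+ _ *m _)).
  have := ltn_ord k; clear; rewrite /=; lia.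
have -> : (exists k : nat, forall t i, (absz (digit_vec M d0 d1 a b (d.+1 * t)%N i ord0) <= k)%N) <->
  (exists k : nat, forall t i, (absz ((z t *m krylov M (d1 - d0)) ord0 i) <= k)%N).
  by split=> -[k hk]; exists k => t i; [rewrite -zE | rewrite zE].
rewrite (mulmx_int_bounded z W0); split.
  by move=> [k hk] l; exists k => t; have := hk t (rev_ord l); rewrite mxE rev_ordK.
move=> /uniform_bound[k hk]; exists k => t i; rewrite mxE; exact: hk.
Qed.

Lemma quad_relation_bounded (d : nat) (M : 'M[int]_d.+1) (d0 d1 : 'cV[int]_d.+1)
    (a b : nat -> bool) m q :
  \det (krylov M (d1 - d0)) != 0 -> d.+1 = (m + m)%N ->
  M ^+ (m + m) = - (q *: M ^+ m) - 2%:A ->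
  (exists k : nat, forall t i, (absz (digit_vec M d0 d1 a b (m * t)%N i ord0) <= k)%N) <->
  forall l : 'I_m, quad_bounded q (substream m l a) (substream m l b).
Proof.
move=> W0 nm Mm.
pose y (l t : nat) := digit_diff (quad_mul q) (1%:Z, 0%:Z) (substream m l a) (substream m l b) t.
(* Coefficients in the Krylov rows: the first [m] hold the constant parts and the last [m] the [y]
   parts, residues being reversed in both halves. *)
pose F (t k : nat) := if (k < m)%N then (y (m - k.+1)%N t).1 else (y (m - (k - m).+1)%N t).2.
pose z t : 'rV[int]_d.+1 := \row_k F t k.
have FX t (l : 'I_m) : F t (m - l.+1)%N = (y l t).1.
  rewrite /F; have lm := ltn_ord l; have -> : (m - l.+1 < m)%N by lia.
  by have -> : (m - (m - l.+1).+1)%N = l by lia.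
have FY t (l : 'I_m) : F t (m + (m - l.+1))%N = (y l t).2.
  rewrite /F; have lm := ltn_ord l; have -> : (m + (m - l.+1) < m)%N = false by lia.
  by have -> : (m - (m + (m - l.+1) - m).+1)%N = l by lia.
have split_sum (V : zmodType) (G : nat -> V) :
    \sum_(k < d.+1) G k = \sum_(l < m) (G (m - l.+1)%N + G (m + (m - l.+1))%N).
  rewrite nm big_split_ord big_split /=.
  by congr (_ + _); rewrite (reindex_inj rev_ord_inj).
have zE t i : digit_vec M d0 d1 a b (m * t)%N i ord0 = (z t *m krylov M (d1 - d0)) ord0 i.
  rewrite row_krylov (digit_vec_quad _ _ _ _ _ nm Mm).
  have -> : \sum_k z t ord0 k *: (M ^+ k *m (d1 - d0)) =
      \sum_(k < d.+1) F t k *: (M ^+ k *m (d1 - d0)) by apply: eq_bigr => k _; rewrite mxE.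
  rewrite (split_sum _ (fun k => F t k *: (M ^+ k *m (d1 - d0)))); congr (fun_of_matrix _ _ _).
  by apply: eq_bigr => l _; rewrite FX FY.
have -> : (exists k : nat, forall t i, (absz (digit_vec M d0 d1 a b (m * t)%N i ord0) <= k)%N) <->
  (exists k : nat, forall t i, (absz ((z t *m krylov M (d1 - d0)) ord0 i) <= k)%N).
  by split=> -[k hk]; exists k => t i; [rewrite -zE | rewrite zE].
rewrite (mulmx_int_bounded z W0); split.
  move=> [k hk] l; exists k => t; have lm := ltn_ord l.
  have h1 : (m - l.+1 < d.+1)%N by rewrite nm; lia.
  have h2 : (m + (m - l.+1) < d.+1)%N by rewrite nm; lia.
  have := hk t (Ordinal h1); have := hk t (Ordinal h2).
  by rewrite !mxE /= FX FY.
move=> h.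
have /uniform_bound[k1 hk1] : forall l : 'I_m, exists k, forall t, (absz (y l t).1 <= k)%N.
  by move=> l; have [k hk] := h l; exists k => t; case: (hk t).
have /uniform_bound[k2 hk2] : forall l : 'I_m, exists k, forall t, (absz (y l t).2 <= k)%N.
  by move=> l; have [k hk] := h l; exists k => t; case: (hk t).
exists (k1 + k2)%N => t i; rewrite mxE /F; have im : (i < m + m)%N by rewrite -nm.
case: ltnP => [lt_im|le_mi].
  have h1 : (m - i.+1 < m)%N by lia.
  by apply: leq_trans (hk1 (Ordinal h1) t) _; rewrite leq_addr.
have h1 : (m - (i - m).+1 < m)%N by lia.
by apply: leq_trans (hk2 (Ordinal h1) t) _; rewrite leq_addl.
Qed.

(** The convex body is the cube, the unit ball of the library's sup norm, so this norm itself serves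
    as gauge. *)
Lemma scalar_homeomorphic (R : realType) (d : nat) (p : (nat -> bool) -> 'cV[R]_d.+1) c :
  absz c = 2%N -> (forall i, cylinder_continuous (fun a => p a i ord0)) ->
  (forall a b, p a = p b <-> forall l : 'I_d.+1, exists k : nat, forall t,
    (absz (digit_diff (int_scale c) 1%:Z (substream d.+1 l a) (substream d.+1 l b) t) <= k)%N) ->
  homeomorphic (range p) (@euclidean_closed_ball R d.+1).
Proof.
move=> hc p_cont p_ker.
have [phi [phi_cont phi_le phi_surj phi_ker]] := interval_model R hc.
pose psi a : 'cV[R]_d.+1 := \col_i phi (substream d.+1 i a).
apply: (@gauge_body_homeomorphic R d.+1 p psi (fun x => `|x|)) => //.
- move=> i; have -> : (fun a => psi a i ord0) = (fun a => phi (substream d.+1 i a)).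
    by apply/funext => a; rewrite mxE.
  exact: substream_continuous.
- exact: norm_continuous.
- by move=> t x t0; rewrite normrZ ger0_norm.
- by move=> x; rewrite normr_gt0.
- by move=> a; apply/cV_norm_le => // i; rewrite mxE; exact: phi_le.
- move=> x /cV_norm_le => /(_ ler01) hx.
  have /choice[s hs] : forall i : nat, exists a, (i < d.+1)%N -> phi a = x (inord i) ord0.
    by move=> i; have [a ha] := phi_surj _ (hx (inord i)); exists a.
  have [a ha] := interleave s (ltn0Sn d); exists a.
  by apply/colP => i; rewrite mxE ha // hs // inord_val.
- move=> a b; rewrite p_ker; split.
    by move=> h; apply/colP => i; rewrite !mxE; apply/phi_ker.
  by move=> /colP h l; have := h l; rewrite !mxE => /phi_ker.
Qed.

Lemma quad_homeomorphic (R : realType) (d m : nat) (p : (nat -> bool) -> 'cV[R]_d.+1) q :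
  (absz q == 1)%N || (absz q == 2)%N -> d.+1 = (m + m)%N ->
  (forall i, cylinder_continuous (fun a => p a i ord0)) ->
  (forall a b, p a = p b <-> forall l : 'I_m, quad_bounded q (substream m l a) (substream m l b)) ->
  homeomorphic (range p) (@euclidean_closed_ball R d.+1).
Proof.
move=> hq nm p_cont p_ker.
have [H [phi [H_cont H_homog H_gt0 [phi1_cont phi2_cont phi_le phi_surj phi_ker]]]] := quad_model R hq.
have m0 : (0 < m)%N by lia.
pose psi a : 'cV[R]_d.+1 := \col_k
  if (k < m)%N then (phi (substream m k a)).1 else (phi (substream m (k - m) a)).2.
(* Coordinates [i] and [m + i] form the i-th plane; the gauge of the product of hexagons is the sup
   norm of the vector [Hs] of the planar gauges. *)
pose pair_at (x : 'cV[R]_d.+1) (i : nat) := (x (inord i) ord0, x (inord (m + i)) ord0).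
pose Hs (x : 'cV[R]_d.+1) : 'cV[R]_m := \col_i H (pair_at x i).
have lo (i : 'I_m) : nat_of_ord (inord i : 'I_d.+1) = i.
  by rewrite inordK // nm ltn_addr.
have hi (i : 'I_m) : nat_of_ord (inord (m + i) : 'I_d.+1) = (m + i)%N.
  by rewrite inordK // nm ltn_add2l.
have psi_pair a (i : 'I_m) : pair_at (psi a) i = phi (substream m i a).
  rewrite /pair_at !mxE lo hi ltn_ord ltnNge leq_addr /= addKn.
  by case: (phi _).
have pair_ext (x y : 'cV[R]_d.+1) : (forall i : 'I_m, pair_at x i = pair_at y i) -> x = y.
  move=> h; apply/colP => k; have km : (k < m + m)%N by rewrite -nm.
  case: (ltnP k m) => [lt_km|le_mk].
    by have := congr1 fst (h (Ordinal lt_km)); rewrite /= inord_val.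
  have lt_km : (k - m < m)%N by lia.
  by have := congr1 snd (h (Ordinal lt_km)); rewrite /= subnKC // inord_val.
apply: (@gauge_body_homeomorphic R d.+1 p psi (fun x => `|Hs x|)) => //.
- move=> k; have km : (k < m + m)%N by rewrite -nm.
  case: (ltnP k m) => [lt_km|le_mk].
    have -> : (fun a => psi a k ord0) = (fun a => (phi (substream m k a)).1).
      by apply/funext => a; rewrite mxE lt_km.
    exact: (@substream_continuous R m k (fun a => (phi a).1)).
  have -> : (fun a => psi a k ord0) = (fun a => (phi (substream m (k - m) a)).2).
    by apply/funext => a; rewrite mxE ltnNge le_mk.
  by apply: (@substream_continuous R m (k - m) (fun a => (phi a).2)) => //; lia.
- have Hs_cont : continuous Hs.
    move=> x; apply: (@cvg_mx R _ (nbhs x) m 1 Hs (Hs x) (nbhs_filter x)) => i j; rewrite [X in _ --> X]mxE.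
    have -> : (fun t => Hs t i j) = H \o (fun t => pair_at t i).
      by apply/funext => t; rewrite mxE.
    apply: continuous_comp; last exact: H_cont.
    have c1 : (fun t : 'cV[R]_d.+1 => t (inord i) ord0) @ x --> x (inord i) ord0.
      exact: coord_continuous.
    have c2 : (fun t : 'cV[R]_d.+1 => t (inord (m + i)) ord0) @ x --> x (inord (m + i)) ord0.
      exact: coord_continuous.
    exact: (cvg_pair c1 c2).
  by move=> x; apply: (continuous_comp (Hs_cont x)); exact: norm_continuous.
- move=> t x t0; have -> : Hs (t *: x) = t *: Hs x.
    by apply/colP => i; rewrite !mxE -H_homog // /pair_at !mxE.
  by rewrite normrZ ger0_norm.
- move=> x x0; rewrite normr_gt0; apply: contra_neq x0 => Hs0.
  apply: pair_ext => i.
  have -> : pair_at 0 i = 0 by rewrite /pair_at !mxE.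
  apply/eqP/negPn/negP => /H_gt0; have := congr1 (fun y : 'cV[R]_m => y i ord0) Hs0.
  by rewrite !mxE => ->; rewrite ltxx.
- have H_ge0 y : 0 <= H y.
    have [->|/H_gt0/ltW//] := eqVneq y 0.
    by have := H_homog 0 (0, 0) (lexx _); rewrite !mul0r => ->.
  by move=> a; apply/cV_norm_le => // i; rewrite mxE psi_pair ger0_norm.
- move=> x /cV_norm_le => /(_ ler01) hx.
  have /choice[s hs] : forall i : nat, exists a, (i < m)%N -> phi a = pair_at x i.
    move=> i; case: (ltnP i m) => [lt_im|_]; last by exists (fun=> false).
    have := hx (Ordinal lt_im); rewrite mxE => /(le_trans (ler_norm _)) /phi_surj[a ha].
    by exists a.
  have [a ha] := interleave s m0; exists a.
  by apply: pair_ext => i; rewrite psi_pair ha // hs.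
- move=> a b; rewrite p_ker; split.
    by move=> h; apply: pair_ext => i; rewrite !psi_pair; apply/phi_ker.
  by move=> h l; apply/phi_ker; rewrite -!psi_pair h.
Qed.

Theorem corollary3 (R : realType) (d : nat) (hd : (2 <= d)%N)
    (G : set 'cV[R]_d) (hG : isotropic_2attractor G) :
  homeomorphic G (@euclidean_closed_ball R d).
Proof.
case: d hd G hG => [//|d] _ G [M [d0 [d1 [M_exp M_det M_digits [M_diag M_iso] ->]]]].
have [lam [V [V_unit ME char_E lam_eig]]] := spectral M_diag.
set MC : 'M[R[i]]_d.+1 := map_mx intr M in M_exp M_diag M_iso ME char_E lam_eig.
pose r := complex.Re `|lam 0 0|.
have rE : `|lam 0 0| = r%:C%C by exact: complex_ge0E.
have r_gt1 : 1 < r by rewrite -ltcR -rE; exact: M_exp.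
have lam_norm i : `|lam 0 i| = r%:C%C by rewrite -rE; exact: M_iso.
have [MR_unit [B B_ge0 bounds]] := pow_bounds V_unit ME lam_norm (lt_trans ltr01 r_gt1).
have pow_bound k i j := (bounds k i j).1.
have inv_bound k i j := (bounds k i j).2.
rewrite (attractorE d0 d1 B_ge0 r_gt1 inv_bound).
have mapE : map_poly intr (char_poly M) = \prod_(i < d.+1) ('X - (lam 0 i)%:P).
  by rewrite map_char_poly -char_E.
have irr : irreducible_poly (map_poly intr (char_poly M) : {poly rat}).
  apply: (@expanding_irreducible R[i]).
  - by rewrite size_char_poly.
  - move=> a; rewrite map_char_poly -eigenvalue_root_char; exact: M_exp.
  - exact: absz_coef0 M_det.
have W0 : \det (krylov M (d1 - d0)) != 0.
  (* The vector [d1 - d0] is nonzero because 0 is the image of 0 under [M]. *)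
  apply: krylov_det irr _; apply/eqP => v0; apply: M_digits.
  by exists 0; rewrite v0 mulmx0.
have p_cont := expansion_continuous d0 d1 B_ge0 r_gt1 inv_bound.
have p_ker := expansion_eqP d0 d1 MR_unit B_ge0 r_gt1 pow_bound inv_bound.
have [[c [c2 Mn]]|[m [q [nm q12 Mm]]]] := power_relation mapE lam_norm M_det.
  apply: (scalar_homeomorphic c2 p_cont) => a b.
  by rewrite (p_ker d.+1 a b (ltn0Sn d)); exact: scalar_bounded.
apply: (quad_homeomorphic q12 nm p_cont) => a b.
have m0 : (0 < m)%N by lia.
by rewrite (p_ker m a b m0); exact: quad_relation_bounded.
Qed.
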